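(* Let $0<\Phi<\pi/2$, let $y^\delta\in\operatorname{ran}(\mathcal{R}_\Phi)$, and let $$\mathcal{I}_\Phi^{\mathrm{invisible}}=\{(j,l,k)\in\mathcal{I}:\ \operatorname{supp}\hat\psi_{j,l,k}\cap W_\Phi=\emptyset\},\qquad W_\Phi=\{r(\cos\omega,\sin\omega):\ r\in\mathbb{R},\ |\omega|\le\Phi\}.$$ Then $$\hat c=\operatorname*{arg\,min}_{c\in\mathbb{R}^N}\left\{\tfrac12\|Kc-y^\delta\|^2_{L^2(S^1\times\mathbb{R})}+\|c\|_{1,w}\right\}$$ satisfies $$\hat c_{j,l,k}=0\quad\text{for all }(j,l,k)\in\mathcal{I}_\Phi^{\mathrm{invisible}}$$ (for those indices that occur in the finite family of curvelets defining $K$).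
   Context: Fourier transform on $\mathbb{R}^2$: $\hat f(\xi)=(2\pi)^{-1}\int_{\mathbb{R}^2}f(x)e^{-ix\cdot\xi}\,dx$. Radon transform: $\mathcal{R}f(\theta,s)=\int_{L(\theta,s)}f(x)\,dS(x)$, where $L(\theta,s)=\{x\in\mathbb{R}^2: x_1\cos\theta+x_2\sin\theta=s\}$, $s\in\mathbb{R}$, for $f$ such that these integrals exist for all $(\theta,s)$. The limited angle Radon transform $\mathcal{R}_\Phi f$ is $\mathcal{R}f$ regarded as a function on the limited angle domain $[-\Phi,\Phi]\times\mathbb{R}$ only; the data-space norm written $L^2(S^1\times\mathbb{R})$ is applied to such functions by integrating over $[-\Phi,\Phi]\times\mathbb{R}$. The data $y^\delta$ is an element of this $L^2$ space. Curvelets: Let $W$ (radial window, a function of $r$) and $V$ (angular window, a function of $\omega$) be real $C^\infty$ functions with $\operatorname{supp}W\subset(1/2,2)$, $\operatorname{supp}V\subset(-1,1)$, $\sum_{j=-\infty}^\infty W^2(2^jr)=1$ for $r\in(3/4,3/2)$ and $\sum_{l=-\infty}^\infty V^2(\omega-l)=1$ for $\omega\in(-1/2,1/2)$. For $j\in\mathbb{N}_0=\{0,1,2,\dots\}$ the generating curvelet $\psi_{j,0,0}$ is defined through its Fourier transform in polar coordinates $(r,\omega)$ ($r\ge 0$, polar angle $\omega\in[-\pi,\pi)$) by $$\widehat\psi_{j,0,0}(r,\omega)=2^{-3j/4}\,W(2^{-j}r)\,V\!\left(\frac{2^{\lceil j/2\rceil+1}}{\pi}\,\omega\right).$$ For $-2^{\lceil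 j/2\rceil+1}\le l<2^{\lceil j/2\rceil+1}$ and $k=(k_1,k_2)\in\mathbb{Z}^2$ put $\theta_{j,l}=l\,\pi\,2^{-\lceil j/2\rceil-1}$, $R_\eta=\begin{pmatrix}\cos\eta&\sin\eta\\-\sin\eta&\cos\eta\end{pmatrix}$, $b^{j,l}_k=R_{\theta_{j,l}}^{-1}(k_1/2^j,\,k_2/2^{j/2})^T$, and $$\psi_{j,l,k}(x)=\psi_{j,0,0}\big(R_{\theta_{j,l}}(x-b^{j,l}_k)\big).$$ The low-pass function $\psi_{-1,0,0}$ is defined by $\widehat\psi_{-1,0,0}(r,\omega)=W_0(r)$ with $W_0^2(r)=1-\sum_{j=0}^\infty W^2(2^{-j}r)$, and $\psi_{-1,0,k}$, $k\in\mathbb{Z}^2$, denote its translates (by $k$). The curvelet index set is $$\mathcal{I}=\{(-1,0,k):k\in\mathbb{Z}^2\}\cup\{(j,l,k):j\in\mathbb{N}_0,\ k\in\mathbb{Z}^2,\ -2^{\lceil j/2\rceil+1}\le l<2^{\lceil j/2\rceil+1}\}.$$ Discretization: The unknown objects are assumed to be finite linear combinations of curvelets. Fix a finite family $\psi_1,\dots,\psi_N$ of curvelets, enumerated by $n=n(j,l,k)$ with distinct indices $(j,l,k)\in\mathcal{I}$, and write $c_n=c_{j,l,k}$ for the components of $c\in\mathbb{R}^N$. The synthesis operator is $T^*c=\sum_{n=1}^N c_n\psi_n$, and $K:=\mathcal{R}_\Phi T^*$. The weighted norm is $\|c\|_{1,w}=\sum_n w_n|c_n|$ with weights satisfying $w_n\ge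 w_0>0$ for all $n$. The notation $\hat c=\operatorname{arg\,min}$ means that $\hat c$ is a minimizer of the functional. *)

(* Defs.v *)
From HB Require Import structures.
From mathcomp Require Import all_boot all_order all_algebra.
From mathcomp Require Import complex.
From mathcomp Require Import all_classical all_reals all_analysis.

Set Implicit Arguments.
Unset Strict Implicit.
Unset Printing Implicit Defensive.

Import Order.TTheory GRing.Theory Num.Theory.
Import numFieldNormedType.Exports.

Local Open Scope classical_set_scope.
Local Open Scope complex_scope.
Local Open Scope ring_scope.

(* The library integrates (extended-)real functions only; complex functions
   are integrated componentwise. *)
Definition cintegrable d (T : measurableType d) (R : realType)
    (mu : {measure set T -> \bar R}) (D : set T) (f : T -> R[i]) : Prop :=
  mu.-integrable D (EFin \o (@complex.Re R \o f)) /\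
  mu.-integrable D (EFin \o (@complex.Im R \o f)).

Definition cintegral d (T : measurableType d) (R : realType)
    (mu : {measure set T -> \bar R}) (D : set T) (f : T -> R[i]) : R[i] :=
  Rintegral mu D (@complex.Re R \o f) +i* Rintegral mu D (@complex.Im R \o f).

Definition cmeasurable d (T : measurableType d) (R : realType)
    (D : set T) (f : T -> R[i]) : Prop :=
  measurable_fun D (@complex.Re R \o f) /\
  measurable_fun D (@complex.Im R \o f).

Section Plane.
Variable R : realType.

Definition leb1 : {measure set (measurableTypeR R) -> \bar R} :=
  @lebesgue_measure R.

Definition leb2 :
    {measure set (measurableTypeR R * measurableTypeR R) -> \bar R} :=
  (@lebesgue_measure R \x @lebesgue_measure R)%E.

Definition dot (x y : R * R) : R := x.1 * y.1 + x.2 * y.2.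

Definition enorm (x : R * R) : R := Num.sqrt (x.1 ^+ 2 + x.2 ^+ 2).

(* The angle of x in [-pi, pi[; since x / 0 = 0, it is -pi/2 at the origin. *)
Definition polar_angle (x : R * R) : R :=
  if 0 < x.2 then acos (x.1 / enorm x) else - acos (x.1 / enorm x).

Definition rot (eta : R) (x : R * R) : R * R :=
  (cos eta * x.1 + sin eta * x.2, - sin eta * x.1 + cos eta * x.2).

Definition cis (t : R) : R[i] := cos t +i* sin t.

Definition fourier (f : R * R -> R[i]) (xi : R * R) : R[i] :=
  ((2 * pi)^-1)%:C *
  cintegral leb2 setT (fun x : R * R => f x * cis (- dot x xi)).

Definition inv_fourier (g : R * R -> R[i]) (x : R * R) : R[i] :=
  ((2 * pi)^-1)%:C *
  cintegral leb2 setT (fun xi : R * R => g xi * cis (dot x xi)).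

Definition csupp (f : R * R -> R[i]) : set (R * R) :=
  closure [set x | f x != 0].

(* The line L(theta, s), parametrized by arc length. *)
Definition line (theta s t : R) : R * R :=
  (s * cos theta - t * sin theta, s * sin theta + t * cos theta).

Definition in_radon_domain (f : R * R -> R[i]) : Prop :=
  forall theta s : R,
    cintegrable leb1 setT (fun t : R => f (line theta s t)).

(* Functions of (theta, s) are functions on R * R; theta is an angle. *)
Definition radon (f : R * R -> R[i]) (p : R * R) : R[i] :=
  cintegral leb1 setT (fun t : R => f (line p.1 p.2 t)).

Definition limited_domain (Phi : R) : set (R * R) := `[- Phi, Phi] `*` setT.

Definition data_sqnorm (Phi : R) (g : R * R -> R[i]) : \bar R :=
  (\int[leb2]_(p in limited_domain Phi)
     ((complex.Re (g p) ^+ 2 + complex.Im (g p) ^+ 2)%R%:E))%E.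

Definition data_L2 (Phi : R) (g : R * R -> R[i]) : Prop :=
  cmeasurable (limited_domain Phi : set (measurableTypeR R * measurableTypeR R))
    g /\ (data_sqnorm Phi g < +oo)%E.

(* Elements of the data space are classes modulo equality a.e. *)
Definition in_radon_range (Phi : R) (y : R * R -> R[i]) : Prop :=
  exists2 f : R * R -> R[i], in_radon_domain f &
    {ae leb2, forall p, limited_domain Phi p -> radon f p = y p}.

Definition smooth (f : R -> R) : Prop :=
  forall (n : nat) (x : R), derivable (derive1n n f) x 1.

Definition radial_window (W : R -> R) : Prop :=
  [/\ smooth W,
      closure [set r | W r != 0] `<=` `](1 / 2), 2[ &
      forall r : R, 3 / 4 < r < 3 / 2 ->
        (\esum_(j in [set: int]) (W ((2 : R) ^ j * r) ^+ 2)%R%:E = 1)%E].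

Definition angular_window (V : R -> R) : Prop :=
  [/\ smooth V,
      closure [set w | V w != 0] `<=` `](-1), 1[ &
      forall w : R, - (1 / 2) < w < 1 / 2 ->
        (\esum_(l in [set: int]) (V (w - l%:~R) ^+ 2)%R%:E = 1)%E].

(* The defining identity fixes only W0 ^+ 2.  Every continuous root is
   admitted: the nonnegative one, and the smooth ones (which may change sign
   when W does). *)
Definition lowpass_window (W W0 : R -> R) : Prop :=
  continuous W0 /\
  forall r : R, 0 <= r ->
    ((W0 r ^+ 2)%R%:E =
     1 - \esum_(j in [set: nat]) (W (2 ^- j * r) ^+ 2)%R%:E)%E.

(* The triple (j, l, k), with k = (k1, k2). *)
Definition curvelet_triple := (int * int * (int * int))%type.

(* uphalf j is the ceiling of j / 2. *)
Definition curvelet_index : set curvelet_triple :=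
  [set (-1, 0, k) | k in [set: int * int]] `|`
  [set i | exists (j : nat) (l : int) (k : int * int),
     i = (j%:Z, l, k) /\
     - (2 ^ (uphalf j).+1)%N%:Z <= l < (2 ^ (uphalf j).+1)%N%:Z].

Definition curvelet_hat0 (W V : R -> R) (j : nat) (xi : R * R) : R[i] :=
  ((2 : R) `^ (- (3 * j%:R / 4)) * W (2 ^- j * enorm xi) *
   V (2 ^+ (uphalf j).+1 / pi * polar_angle xi))%:C.

Definition lowpass_hat0 (W0 : R -> R) (xi : R * R) : R[i] :=
  (W0 (enorm xi))%:C.

Definition curvelet_angle (j : nat) (l : int) : R :=
  l%:~R * pi * 2 ^- (uphalf j).+1.

(* rot (- eta) is the inverse of rot eta. *)
Definition curvelet_center (j : nat) (l : int) (k : int * int) : R * R :=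
  rot (- curvelet_angle j l)
    (k.1%:~R / 2 ^+ j, k.2%:~R / (2 : R) `^ (j%:R / 2)).

(* A negative scale stands for -1; then l is not used. *)
Definition curvelet (W V W0 : R -> R) (i : curvelet_triple) (x : R * R) :
    R[i] :=
  let: (j, l, k) := i in
  match j with
  | Posz j => inv_fourier (curvelet_hat0 W V j)
                (rot (curvelet_angle j l) (x - curvelet_center j l k))
  | Negz _ => inv_fourier (lowpass_hat0 W0) (x - (k.1%:~R, k.2%:~R))
  end.

Definition wedge (Phi : R) : set (R * R) :=
  [set x | exists r w : R, `|w| <= Phi /\ x = (r * cos w, r * sin w)].

Definition invisible (W V W0 : R -> R) (Phi : R) : set curvelet_triple :=
  [set i | curvelet_index i /\
     csupp (fourier (curvelet W V W0 i)) `&` wedge Phi = set0].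

Definition synthesis (N : nat) (psi : 'I_N -> R * R -> R[i]) (c : 'rV[R]_N)
    (x : R * R) : R[i] :=
  \sum_(n < N) (c 0 n)%:C * psi n x.

Definition weighted_l1 (N : nat) (w : 'I_N -> R) (c : 'rV[R]_N) : R :=
  \sum_(n < N) w n * `|c 0 n|.

(* With K = radon \o synthesis psi.  The value is extended real, so that no
   integrability of K c has to be presupposed. *)
Definition objective (N : nat) (psi : 'I_N -> R * R -> R[i]) (w : 'I_N -> R)
    (Phi : R) (y : R * R -> R[i]) (c : 'rV[R]_N) : \bar R :=
  ((2^-1)%R%:E * data_sqnorm Phi (fun p => (radon (synthesis psi c) p - y p)%R)
   + (weighted_l1 w c)%:E)%E.

Definition minimizer (T : Type) (F : T -> \bar R) (c : T) : Prop :=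
  forall c' : T, (F c <= F c')%E.

End Plane.

(* Main.v *)
From HB Require Import structures.
Require Import Defs.
From mathcomp Require Import all_boot all_order all_algebra.
From mathcomp Require Import complex.
From mathcomp Require Import all_classical all_reals all_analysis.
From mathcomp Require Import measurable_realfun zify ring lra.

Set Implicit Arguments.
Unset Strict Implicit.
Unset Printing Implicit Defensive.

Import Order.TTheory GRing.Theory Num.Theory.
Import numFieldNormedType.Exports.
Local Open Scope classical_set_scope.
Local Open Scope ring_scope.

(** An invisible curvelet costs without contributing.  If its coefficient in a
    minimizer were nonzero, replacing that coefficient by 0 would leave the
    data term unchanged and strictly decrease the weighted norm; as the
    objective is finite (at [c = 0] it is half the square of the norm of the
    data), this is a contradiction.  The point is therefore that an invisible
    curvelet [psi] integrates to 0 along each line [line theta s] with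
    [`|theta| <= Phi] ([invisible_radon_eq0]).  By the slice theorem, the
    Fourier transform of the function [s |-> radon psi (theta, s)] is the
    restriction of the Fourier transform of [psi] to a line through the origin,
    which lies in the wedge, where the latter vanishes; and an integrable
    bounded continuous function with vanishing Fourier transform is 0
    ([fourier_uniqueness], by Abel-Poisson means).

    Curvelets are defined as inverse Fourier transforms, and the hypothesis
    bears on the Fourier integral of the result, so that all this makes sense
    only once [psi] is known to be integrable, over the plane and along lines.
    At a scale [j >= 0] the symbol of [psi] is of class C2 with bounded support
    ([curvelet_symbol_Ck]), hence [psi x] is at most of size
    [1 / (1 + `|x| ^+ 2)] ([transform_decay]).  This is enough along lines, but
    just fails to give integrability over the plane, which comes from a finer
    estimate ([integrable_cos_transform_sqrt]).

    The low-pass functions are never invisible ([lowpass_visible]): a Fourier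
    transform vanishing at the origin would mean that the function has integral
    0, hence, by Fourier inversion at the origin, that [W0 0 = 0], whereas
    [W0 0 ^+ 2 = 1].  Integrability is again needed, and delicate, since the
    symbol [W0 (enorm xi)] is merely a continuous square root of a smooth
    function: one has [W0 (enorm xi) ^+ 2 = w xi ^+ 2] with [w] of class C2
    ([lowpass_root_sqr], [lowpass_root_Ck]).  Such a square root may have
    corners where [w] vanishes, but its second differences with step [h] have a
    square integral of size [h ^+ 3] ([integral_sqr_second_difference]).
    Together with Bessel's inequality ([bessel_abel2]) this bounds the energy
    of the transform on dyadic annuli well enough to integrate its absolute
    value.

    Finally, low-pass functions are not shown to be integrable along lines, so
    that additivity of the Radon transform cannot be taken for granted.  An
    integral that does not converge has the value 0, however, and it stays
    divergent when an integrable function is added; thus removing a function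
    with vanishing line integrals has no effect in any case ([Rintegral_add_null]). *)

(** * Integration *)

Section RealIntegration.
Context d (T : measurableType d) (R : realType).
Variable mu : {measure set T -> \bar R}.

Local Notation integrable f := (mu.-integrable setT (EFin \o f)).
Local Notation I f := (Rintegral mu setT f).

Lemma integrable_measurable (f : T -> R) :
  integrable f -> measurable_fun setT f.
Proof. by move=> /measurable_int /measurable_EFinP. Qed.

Lemma integrable_dominated (f g : T -> R) : measurable_fun setT f ->
  (forall x, `|f x| <= g x) -> integrable g -> integrable f.
Proof.
move=> mf fg ig; apply: le_integrable ig => //; first exact/measurable_EFinP.
by move=> x _ /=; rewrite lee_fin (le_trans (fg x))// ler_norm.
Qed.

Lemma integrableM_bounded (f k : T -> R) (B : R) : integrable f ->
  measurable_fun setT k -> (forall x, `|k x| <= B) ->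
  integrable (fun x => f x * k x).
Proof.
move=> fi mk kB.
apply: (@integrable_dominated _ (fun x => B * `|f x|)).
- by apply: measurable_funM => //; exact: integrable_measurable.
- by move=> x; rewrite normrM mulrC ler_wpM2r.
- have := integrableZl measurableT B (integrable_norm fi).
  by apply: eq_integrable.
Qed.

Lemma RintegrableZl (f : T -> R) (c : R) : integrable f ->
  integrable (fun x => c * f x).
Proof. by move=> fi; apply: eq_integrable (integrableZl measurableT c fi). Qed.

Lemma RintegrableD (f g : T -> R) : integrable f -> integrable g ->
  integrable (fun x => f x + g x).
Proof. by move=> fi gi; apply: eq_integrable (integrableD measurableT fi gi). Qed.

Lemma RintegrableB (f g : T -> R) : integrable f -> integrable g ->
  integrable (fun x => f x - g x).
Proof. by move=> fi gi; apply: eq_integrable (integrableB measurableT fi gi). Qed.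

Lemma Rintegral_EFin (f : T -> R) : integrable f ->
  (I f)%:E = (\int[mu]_x (f x)%:E)%E.
Proof. by move=> fi; rewrite fineK//; apply: integrable_fin_num. Qed.

Lemma ge0_integrable_lty (f : T -> R) : measurable_fun setT f ->
  (forall x, 0 <= f x) -> (\int[mu]_x (f x)%:E < +oo)%E -> integrable f.
Proof.
move=> mf f0 foo; apply/integrableP; split; first exact/measurable_EFinP.
by under eq_integral do rewrite /= ger0_norm//.
Qed.

End RealIntegration.

Section BoundedFubini.
Context d1 d2 (X : measurableType d1) (Y : measurableType d2) (R : realType).
Variable m1 : {sigma_finite_measure set X -> \bar R}.
Variable m2 : {sigma_finite_measure set Y -> \bar R}.

Lemma integrable_tensor (a : X -> R) (b : Y -> R) (k : X * Y -> R) (B : R) :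
  m1.-integrable setT (EFin \o a) -> m2.-integrable setT (EFin \o b) ->
  measurable_fun setT k -> (forall z, `|k z| <= B) ->
  (m1 \x m2)%E.-integrable setT (EFin \o (fun z => a z.1 * b z.2 * k z)).
Proof.
move=> ai bi mk kB.
have ma := integrable_measurable ai; have mb := integrable_measurable bi.
have mab : measurable_fun [set: X * Y] (fun z => a z.1 * b z.2).
  by apply: measurable_funM; exact: measurableT_comp.
apply: (@integrableM_bounded _ _ _ _ (fun z => a z.1 * b z.2) k B) => //.
apply/integrable12ltyP; first exact/measurable_EFinP.
under eq_integral => x _.
  under eq_integral do rewrite /= normrM EFinM.
  rewrite ge0_integralZl//; last first.
    by apply/measurable_EFinP; exact: measurableT_comp.
  over.
rewrite -[X in (X < _)%E]/(\int[m1]_x (`|a x|%:E * \int[m2]_y `|b y|%:E))%E.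
rewrite ge0_integralZr//; last 2 first.
- by apply/measurable_EFinP; exact: measurableT_comp.
- exact: integral_ge0.
move/integrableP : ai => [_ ai]; move/integrableP : bi => [_ bi].
by apply: lte_mul_pinfty => //; [exact: integral_ge0|rewrite ge0_fin_numE//; exact: integral_ge0].
Qed.

Lemma Rfubini (f : X * Y -> R) :
  (m1 \x m2)%E.-integrable setT (EFin \o f) ->
  (forall x, m2.-integrable setT (EFin \o (fun y => f (x, y)))) ->
  Rintegral m1 setT (fun x => Rintegral m2 setT (fun y => f (x, y))) =
  Rintegral (m1 \x m2)%E setT f.
Proof.
move=> fi f2i.
rewrite /Rintegral -[in RHS]integral12_prod_meas1//; congr fine.
by apply: eq_integral => x _; rewrite Rintegral_EFin.
Qed.

Lemma Rfubini_sym (f : X * Y -> R) :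
  (m1 \x m2)%E.-integrable setT (EFin \o f) ->
  (forall y, m1.-integrable setT (EFin \o (fun x => f (x, y)))) ->
  Rintegral m2 setT (fun y => Rintegral m1 setT (fun x => f (x, y))) =
  Rintegral (m1 \x m2)%E setT f.
Proof.
move=> fi f1i.
rewrite /Rintegral -[in RHS]integral21_prod_meas1//; congr fine.
by apply: eq_integral => x _; rewrite Rintegral_EFin.
Qed.

Lemma ge0_integrable_Rfubini_sym (f : X * Y -> R) : (forall z, 0 <= f z) ->
  (m1 \x m2)%E.-integrable setT (EFin \o f) ->
  (forall y, m1.-integrable setT (EFin \o (fun x => f (x, y)))) ->
  m2.-integrable setT
    (EFin \o (fun y => Rintegral m1 setT (fun x => f (x, y)))).
Proof.
move=> f0 fi f1i.
have E : (fun y => (Rintegral m1 setT (fun x => f (x, y)))%:E) =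
    fubini_G m1 (EFin \o f).
  by apply/funext => y; rewrite /fubini_G /= Rintegral_EFin.
apply: ge0_integrable_lty.
- by apply/measurable_EFinP; have := measurable_fubini_G fi; rewrite -E.
- by move=> y; exact: Rintegral_ge0.
- have := integral21_prod_meas1 fi; rewrite -E => ->.
  exact: integrable_lty fi.
Qed.

Lemma bilinear_integrable (a : X -> R) (b : Y -> R) (k : X * Y -> R) (B : R) :
  m1.-integrable setT (EFin \o a) -> m2.-integrable setT (EFin \o b) ->
  measurable_fun setT k -> (forall z, `|k z| <= B) ->
  m1.-integrable setT
    (EFin \o (fun x => a x * Rintegral m2 setT (fun y => b y * k (x, y)))).
Proof.
move=> ai bi mk kB; have abk := integrable_tensor ai bi mk kB.
have mk1 x : measurable_fun setT (fun y => k (x, y)) by exact: measurableT_comp.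
have i1 x : m2.-integrable setT (EFin \o (fun y => b y * k (x, y))).
  exact: (integrableM_bounded bi (mk1 x)).
apply: eq_integrable (integrable_fubini_F abk) => // x _.
rewrite /fubini_F /= -RintegralZl//.
have -> : Rintegral m2 setT (fun y => a x * (b y * k (x, y))) =
    Rintegral m2 setT (fun y => a x * b y * k (x, y)).
  by apply: eq_Rintegral => y _; rewrite mulrA.
rewrite Rintegral_EFin//.
by apply: eq_integrable (RintegrableZl (a x) (i1 x)) => // y _ /=; rewrite mulrA.
Qed.

(** The form of Fubini's theorem used throughout: a bounded kernel is
    integrated against two integrable densities. *)
Lemma bilinear_swap (a : X -> R) (b : Y -> R) (k : X * Y -> R) (B : R) :
  m1.-integrable setT (EFin \o a) -> m2.-integrable setT (EFin \o b) ->
  measurable_fun setT k -> (forall z, `|k z| <= B) ->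
  Rintegral m1 setT (fun x => a x * Rintegral m2 setT (fun y => b y * k (x, y)))
  = Rintegral m2 setT (fun y => b y * Rintegral m1 setT (fun x => a x * k (x, y))).
Proof.
move=> ai bi mk kB; have abk := integrable_tensor ai bi mk kB.
have mk1 x : measurable_fun setT (fun y => k (x, y)) by exact: measurableT_comp.
have mk2 y : measurable_fun setT (fun x => k (x, y)) by exact: measurableT_comp.
have i1 x : m2.-integrable setT (EFin \o (fun y => b y * k (x, y))).
  exact: (integrableM_bounded bi (mk1 x)).
have i2 y : m1.-integrable setT (EFin \o (fun x => a x * k (x, y))).
  exact: (integrableM_bounded ai (mk2 y)).
transitivity (Rintegral (m1 \x m2)%E setT (fun z => a z.1 * b z.2 * k z)).
  rewrite -Rfubini//=; last first.
    by move=> x; apply: eq_integrable (RintegrableZl (a x) (i1 x)) => //= y _;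
      rewrite mulrA.
  apply: eq_Rintegral => x _; rewrite -RintegralZl//.
  by apply: eq_Rintegral => y _; rewrite mulrA.
rewrite -Rfubini_sym//=; last first.
  by move=> y; apply: eq_integrable (RintegrableZl (b y) (i2 y)) => //= x _;
    rewrite mulrA [b y * _]mulrC.
apply: eq_Rintegral => y _; rewrite -RintegralZl//.
by apply: eq_Rintegral => x _; rewrite mulrA [b y * _]mulrC.
Qed.

End BoundedFubini.

(** * Measurability and changes of variables in the plane *)

Section PlaneMeasurability.
Variable R : realType.
Local Notation plane := (measurableTypeR R * measurableTypeR R)%type.

Lemma open_measurable_plane (U : set (R * R)) :
  open U -> measurable (U : set plane).
Proof.
move=> oU.
pose box (q : (rat * rat) * (rat * rat)) : set plane :=
  `]ratr q.1.1, ratr q.1.2[%classic `*` `]ratr q.2.1, ratr q.2.2[%classic.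
have -> : U = \bigcup_q (if `[< box q `<=` U >] then box q else set0).
  apply/seteqP; split => [x Ux|x [q _]]; last first.
    by case: asboolP => // qU; exact: qU.
  have /= := open_nbhs_nbhs (conj oU Ux).
  case=> -[A B] /= [/nbhs_ballP[e1 /= e10 A1] /nbhs_ballP[e2 /= e20 B2]] AB.
  have /rat_in_itvoo[p1] : x.1 - e1 < x.1 by rewrite ltrBlDr ltrDl.
  have /rat_in_itvoo[p2] : x.1 < x.1 + e1 by rewrite ltrDl.
  have /rat_in_itvoo[q1] : x.2 - e2 < x.2 by rewrite ltrBlDr ltrDl.
  have /rat_in_itvoo[q2] : x.2 < x.2 + e2 by rewrite ltrDl.
  rewrite !in_itv/= => /andP[q21 q22] /andP[q11 q12] /andP[p21 p22]
    /andP[p11 p12].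
  exists ((p1, p2), (q1, q2)) => //; case: asboolP => [_|].
    by split; rewrite /= in_itv/=; apply/andP; split.
  case=> -[a b] [] /=; rewrite !in_itv/= => /andP[a1 a2] /andP[b1 b2].
  apply: AB; split => /=; [apply: A1|apply: B2];
    rewrite /ball/= ltr_norml; apply/andP; split; lra.
apply: countable_bigcupT_measurable; first exact: countableP.
move=> q; case: ifP => _ //.
by apply: measurableX; exact: measurable_itv.
Qed.

Lemma continuous_measurable_plane (f : R * R -> R) : continuous f ->
  measurable_fun [set: plane] f.
Proof.
move=> /continuousP cf; apply: (measurability _ (RGenOInfty.measurableE R)) => //.
move=> _ [_ [r ->] <-]; rewrite setTI; apply: open_measurable_plane.
by apply: cf; exact: rray_open.
Qed.

End PlaneMeasurability.

Section MeasurePreserving.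
Context d (T : measurableType d) (R : realType).
Implicit Type mu : {measure set T -> \bar R}.

Definition measure_preserving mu (phi : T -> T) :=
  measurable_fun setT phi /\
  forall A, measurable A -> mu (phi @^-1` A) = mu A.

Lemma measure_preserving_comp mu phi1 phi2 : measure_preserving mu phi1 ->
  measure_preserving mu phi2 -> measure_preserving mu (phi1 \o phi2).
Proof.
move=> [m1 e1] [m2 e2]; split; first exact: measurableT_comp.
move=> A mA; rewrite -(e1 A)// -[RHS]e2//.
by rewrite -[X in measurable X]setTI; exact: m1.
Qed.

Lemma ge0_integral_measure_preserving mu phi (f : T -> \bar R) :
  measure_preserving mu phi -> measurable_fun setT f ->
  (forall x, (0 <= f x)%E) ->
  (\int[mu]_x f (phi x) = \int[mu]_x f x)%E.
Proof.
move=> [mphi e] mf f0.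
rewrite -[LHS]/(\int[mu]_(x in phi @^-1` setT) (f \o phi) x)%E.
rewrite -ge0_integral_pushforward//.
by apply: eq_measure_integral => //= A mA _; exact: e.
Qed.

Lemma integrable_measure_preserving mu phi (f : T -> R) :
  measure_preserving mu phi -> mu.-integrable setT (EFin \o f) ->
  mu.-integrable setT (EFin \o (f \o phi)).
Proof.
move=> mphi /integrableP[mf fi]; apply/integrableP; split.
  exact: (measurableT_comp mf (mphi.1)).
rewrite (ge0_integral_measure_preserving mphi (f := fun x => `|(f x)%:E|%E))//.
exact: measurableT_comp.
Qed.

Lemma Rintegral_measure_preserving mu phi (f : T -> R) :
  measure_preserving mu phi -> mu.-integrable setT (EFin \o f) ->
  Rintegral mu setT (f \o phi) = Rintegral mu setT f.
Proof.
move=> mphi fi; rewrite /Rintegral; congr fine.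
have fphi := integrable_measure_preserving mphi fi.
have mf := measurable_int _ fi.
rewrite integralE [in RHS]integralE; congr (_ - _)%E.
- rewrite -(ge0_integral_measure_preserving mphi (measurable_funepos mf))//.
  by apply: eq_integral => x _; rewrite !funeposE.
- rewrite -(ge0_integral_measure_preserving mphi (measurable_funeneg mf))//.
  by apply: eq_integral => x _; rewrite !funenegE.
Qed.

End MeasurePreserving.

Section LebesguePreserving.
Variable R : realType.
Local Notation plane := (measurableTypeR R * measurableTypeR R)%type.
Local Notation leb1 := (leb1 R).
Local Notation leb2 := (leb2 R).

Lemma measure_preserving_shift (c : R) :
  measure_preserving leb1 (fun x : measurableTypeR R => x + c : measurableTypeR R).
Proof.
have mc : measurable_fun [set: measurableTypeR R]
    (fun x : measurableTypeR R => x + c : measurableTypeR R).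
  by apply: (@measurable_funD _ (measurableTypeR R) R setT id (cst c)).
split=> // A mA.
have -> : leb1 ((fun x => x + c) @^-1` A) =
    pushforward leb1 (fun x : measurableTypeR R => x + c : measurableTypeR R) A by [].
apply/esym/lebesgue_measure_unique => //= _ [[a b]] _ <-.
rewrite /pushforward/=.
have -> : (fun x => x + c) @^-1` `]a, b]%classic = `]a - c, b - c]%classic.
  by apply/seteqP; split => x /=; rewrite !in_itv/= ltrBlDr lerBrDr.
rewrite /leb1/= !lebesgue_measure_itv/= !lte_fin ltrD2r.
by case: ifP => // _; rewrite -!EFinB; congr (_%:E); lra.
Qed.

Lemma measure_preserving_opp :
  measure_preserving leb1 (fun x : measurableTypeR R => - x : measurableTypeR R).
Proof.
split; first exact: (@oppr_measurable R setT).
move=> A mA; exact: (lebesgue_measureN mA).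
Qed.

(** Fibrewise: by Fubini, it is enough that each horizontal line is mapped
    into itself by a measure preserving map.  Translations and shears are of
    this form. *)
Lemma measure_preserving_fibre1 (tau : R -> R -> R) :
  measurable_fun [set: plane] (fun z : plane => tau z.2 z.1) ->
  (forall y, measure_preserving leb1 (tau y : measurableTypeR R -> measurableTypeR R)) ->
  measure_preserving leb2 (fun z : plane => (tau z.2 z.1, z.2) : plane).
Proof.
move=> mtau tauP.
have mp : measurable_fun setT (fun z : plane => (tau z.2 z.1, z.2) : plane).
  exact: measurable_fun_pair.
split=> // A mA.
have mA' : measurable ((fun z : plane => (tau z.2 z.1, z.2) : plane) @^-1` A).
  by rewrite -[X in measurable X]setTI; exact: mp.
have leb2E B : measurable B -> leb2 B = (\int[leb1]_y leb1 (ysection B y))%E.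
  move=> mB.
  have := @product_measure_unique _ _ _ _ _ (@lebesgue_measure R)
    (@lebesgue_measure R) (@lebesgue_measure R \x^ @lebesgue_measure R)%E.
  move=> /(_ _)/(_ B mB) H; rewrite /leb2/= H//.
  by move=> C D mC mD; rewrite /= product_measure2E.
rewrite !leb2E//; apply: eq_integral => y _.
rewrite -[RHS](tauP y).2; last exact: measurable_ysection.
congr (leb1 _); apply/seteqP; split => x /=; by rewrite /ysection/= !inE.
Qed.

Lemma measure_preserving_fibre2 (tau : R -> R -> R) :
  measurable_fun [set: plane] (fun z : plane => tau z.1 z.2) ->
  (forall y, measure_preserving leb1 (tau y : measurableTypeR R -> measurableTypeR R)) ->
  measure_preserving leb2 (fun z : plane => (z.1, tau z.1 z.2) : plane).
Proof.
move=> mtau tauP.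
have mp : measurable_fun setT (fun z : plane => (z.1, tau z.1 z.2) : plane).
  exact: measurable_fun_pair.
split=> // A mA.
have mA' : measurable ((fun z : plane => (z.1, tau z.1 z.2) : plane) @^-1` A).
  by rewrite -[X in measurable X]setTI; exact: mp.
rewrite /leb2/= /product_measure1; apply: eq_integral => x _ /=.
rewrite -[RHS](tauP x).2; last exact: measurable_xsection.
congr (leb1 _); apply/seteqP; split => y /=; by rewrite /xsection/= !inE.
Qed.

Lemma measure_preserving_shear1 (k : R) :
  measure_preserving leb2 (fun z : plane => (z.1 + k * z.2, z.2) : plane).
Proof.
apply: (@measure_preserving_fibre1 (fun y x => x + k * y)).
  by apply: measurable_funD => //; exact: measurable_funM.
by move=> y; exact: measure_preserving_shift.
Qed.

Lemma measure_preserving_shear2 (k : R) :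
  measure_preserving leb2 (fun z : plane => (z.1, z.2 + k * z.1) : plane).
Proof.
apply: (@measure_preserving_fibre2 (fun x y => y + k * x)).
  by apply: measurable_funD => //; exact: measurable_funM.
by move=> y; exact: measure_preserving_shift.
Qed.

Lemma measure_preserving_shift2 (c : R * R) :
  measure_preserving leb2 (fun z : plane => z + c : plane).
Proof.
apply: (@measure_preserving_comp _ _ _ _
  (fun z : plane => (z.1 + c.1, z.2) : plane) (fun z : plane => (z.1, z.2 + c.2) : plane)).
- apply: (@measure_preserving_fibre1 (fun _ x => x + c.1)).
    exact: measurable_funD.
  by move=> y; exact: measure_preserving_shift.
- apply: (@measure_preserving_fibre2 (fun _ y => y + c.2)).
    exact: measurable_funD.
  by move=> y; exact: measure_preserving_shift.
Qed.

(** A rotation by an angle other than a half turn is a product of three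
    shears; the half turn is the square of a quarter turn. *)
Lemma measure_preserving_rot (eta : R) : measure_preserving leb2 (Defs.rot eta).
Proof.
have shears (t : R) : cos t != -1 -> measure_preserving leb2 (Defs.rot t).
  move=> ct; have ct0 : 1 + cos t != 0 by apply: contra ct => /eqP H; apply/eqP; lra.
  (* The coefficient of the outer shears is the tangent of [t / 2]. *)
  pose k := sin t / (1 + cos t).
  have -> : Defs.rot t = (fun z : plane => (z.1 + k * z.2, z.2) : plane) \o
     (fun z : plane => (z.1, z.2 + (- sin t) * z.1) : plane) \o
     (fun z : plane => (z.1 + k * z.2, z.2) : plane).
    have cs := cos2Dsin2 t.
    have e1 : 1 - k * sin t = cos t.
      have -> : k * sin t = sin t ^+ 2 / (1 + cos t) by rewrite /k expr2; ring.
      have -> : sin t ^+ 2 = (1 - cos t) * (1 + cos t) by rewrite -[sin t ^+ 2](addKr (cos t ^+2)) cs; ring.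
      by rewrite mulfK//; ring.
    have e2 : k + k * cos t = sin t.
      by rewrite -[X in X + _]mulr1 -mulrDr /k divfK.
    clearbody k; apply/funext => -[x y]; rewrite /Defs.rot/=; congr (_, _).
      transitivity ((1 - k * sin t) * x + (k + k * (1 - k * sin t)) * y).
        by rewrite e1 e2.
      ring.
    transitivity (- sin t * x + (1 - k * sin t) * y); first by rewrite e1.
    ring.
  apply: measure_preserving_comp; last exact: measure_preserving_shear1.
  by apply: measure_preserving_comp;
    [exact: measure_preserving_shear1|exact: measure_preserving_shear2].
have [ct|] := eqVneq (cos eta) (-1); last exact: shears.
have st : sin eta = 0.
  have := cos2Dsin2 eta; rewrite ct sqrrN expr1n => /eqP.
  by rewrite -subr_eq0 [_ - _](_ : _ = sin eta ^+ 2) ?sqrf_eq0; [move/eqP|ring].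
have q : measure_preserving leb2 (Defs.rot (pi / 2 : R)).
  by apply: shears; rewrite cos_pihalf; apply/eqP; lra.
have -> : Defs.rot eta = Defs.rot (pi / 2) \o Defs.rot (pi / 2).
  apply/funext => -[x y]; rewrite /Defs.rot/= ct st cos_pihalf sin_pihalf.
  by congr (_, _); ring.
exact: measure_preserving_comp.
Qed.

End LebesguePreserving.

(** * The Abel-Poisson kernel *)

Section EvenFTC.
Variable R : realType.
Local Notation leb1 := (leb1 R).

Lemma is_derive_continuous (f f' : R -> R) :
  (forall x : R, is_derive x 1 f (f' x)) -> continuous f.
Proof.
move=> df x; apply: differentiable_continuous.
by apply/derivable1_diffP; case: (df x).
Qed.

Lemma continuous_abs_comp (f : R -> R) : continuous f ->
  continuous (fun x : R => f `|x|).
Proof.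
move=> cf x; apply: (@continuous_comp _ _ _ (fun x : R => `|x|) f).
  exact: norm_continuous.
exact: cf.
Qed.

Lemma ge0_integral_abs_FTC (f F : R -> R) (l : R) :
  (forall x : R, 0 <= f x) -> continuous f -> (forall x : R, is_derive x 1 F (f x)) ->
  F x @[x --> +oo] --> l ->
  (\int[leb1]_x (f `|x|)%:E = (2 * (l - F 0))%:E)%E.
Proof.
move=> f0 cf dF Fl.
rewrite /leb1/= (@ge0_symfun_integralT _ (fun x : R => f `|x|))//; last 2 first.
- exact: continuous_abs_comp.
- by move=> x /=; rewrite normrN.
rewrite -set_itvcy EFinM; congr (_ * _)%E.
transitivity (\int[leb1]_(x in `[0%R, +oo[) (f x)%:E)%E.
  apply: eq_integral => x; rewrite inE/= in_itv/= andbT => x0.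
  by rewrite ger0_norm.
have cF : continuous F := is_derive_continuous dF.
rewrite (@ge0_continuous_FTC2y _ f F 0 l)//.
- exact: continuous_subspaceT.
- by apply: cvg_at_right_filter; exact: cF.
- by move=> x _; rewrite derive1E; case: (dF x).
Qed.

End EvenFTC.

Section Poisson.
Variable R : realType.
Local Notation leb1 := (leb1 R).
Implicit Types e t x : R.

Definition abel e x : R := expR (- e * `|x|).

Definition poisson e t : R := e / (e ^+ 2 + t ^+ 2).

Lemma abel_ge0 e x : 0 <= abel e x. Proof. exact: expR_ge0. Qed.

Lemma abel_le1 e x : 0 <= e -> abel e x <= 1.
Proof. by move=> e0; rewrite -expR0 ler_expR mulNr oppr_le0 mulr_ge0. Qed.

Lemma poisson_den_gt0 e t : 0 < e -> 0 < e ^+ 2 + t ^+ 2.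
Proof. by move=> e0; rewrite ltr_pwDl ?exprn_gt0 ?sqr_ge0. Qed.

Lemma poisson_ge0 e t : 0 < e -> 0 <= poisson e t.
Proof. by move=> e0; rewrite divr_ge0 ?(ltW e0)// ltW ?poisson_den_gt0. Qed.

Lemma poisson_opp e t : poisson e (- t) = poisson e t.
Proof. by rewrite /poisson sqrrN. Qed.

Lemma poisson_norm e t : poisson e `|t| = poisson e t.
Proof. by rewrite /poisson real_normK// num_real. Qed.

Lemma continuous_poisson e : 0 < e -> continuous (poisson e).
Proof.
move=> e0 x; apply: cvgM; first exact: cvg_cst.
apply: cvgV; first by rewrite gt_eqF// poisson_den_gt0.
by apply: cvgD; [exact: cvg_cst|exact: exprn_continuous].
Qed.

Lemma is_derive_poisson_primitive e t : 0 < e ->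
  is_derive t 1 (fun x => atan (e^-1 * x)) (poisson e t).
Proof.
move=> e0; have e0' : e != 0 by rewrite gt_eqF.
apply: is_derive_eq.
rewrite /poisson scaler1 /GRing.scale/=; field.
by rewrite e0' gt_eqF ?poisson_den_gt0// addr_gt0// ?exprn_gt0// .
Qed.

Lemma cvg_poisson_primitive e : 0 < e ->
  (fun x => atan (e^-1 * x)) x @[x --> +oo] --> pi / 2.
Proof.
move=> e0; apply: (@cvg_comp _ _ _ (fun x => e^-1 * x) atan _ +oo).
  by apply: gt0_cvgMry; rewrite ?invr_gt0//; exact: cvg_id.
exact: cvgy_atan.
Qed.

Lemma integral_poisson e : 0 < e -> (\int[leb1]_x (poisson e x)%:E = pi%:E)%E.
Proof.
move=> e0.
have := @ge0_integral_abs_FTC R (poisson e) _ _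
  (fun x => poisson_ge0 x e0) (continuous_poisson e0)
  (fun x => is_derive_poisson_primitive x e0) (cvg_poisson_primitive e0).
under eq_integral do rewrite poisson_norm.
by rewrite mulr0 atan0 subr0 => ->; congr (_%:E); field.
Qed.

Lemma integrable_poisson e : 0 < e -> leb1.-integrable setT (EFin \o poisson e).
Proof.
move=> e0; apply: ge0_integrable_lty => //.
- by apply: continuous_measurable_fun; exact: continuous_poisson.
- by move=> x; exact: poisson_ge0.
- by rewrite integral_poisson// ltry.
Qed.

Lemma cvg_expR_neg e : 0 < e -> expR (- e * x) @[x --> +oo] --> (0 : R).
Proof.
move=> e0; under eq_fun do rewrite mulNr.
apply: (@cvg_comp _ _ _ (fun x => e * x) (fun x => expR (- x)) _ +oo).
  by apply: gt0_cvgMry => //; exact: cvg_id.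
exact: cvgr_expR.
Qed.

Lemma continuous_expM e : continuous (fun x : R => expR (- e * x)).
Proof.
move=> x; apply: (@continuous_comp _ _ _ (fun x : R => - e * x) expR).
  by apply: cvgM; [exact: cvg_cst|exact: cvg_id].
exact: continuous_expR.
Qed.

Lemma integral_abel e : 0 < e -> (\int[leb1]_x (abel e x)%:E = (2 / e)%:E)%E.
Proof.
move=> e0; have e0' : e != 0 by rewrite gt_eqF.
have dF (x : R) : is_derive x 1 (fun x => - e^-1 * expR (- e * x)) (expR (- e * x)).
  by apply: is_derive_eq; rewrite scaler1 /GRing.scale/=; field.
have cvF : - e^-1 * expR (- e * x) @[x --> +oo] --> (0 : R).
  rewrite -(mulr0 (- e^-1)); apply: cvgM; first exact: cvg_cst.
  exact: cvg_expR_neg.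
have := ge0_integral_abs_FTC (fun x => expR_ge0 (- e * x))
  (continuous_expM (e := e)) dF cvF.
by rewrite mulr0 expR0 mulr1 sub0r opprK.
Qed.

Lemma integrable_abel e : 0 < e -> leb1.-integrable setT (EFin \o abel e).
Proof.
move=> e0; apply: ge0_integrable_lty => //.
- apply: continuous_measurable_fun.
  by apply: (@continuous_abs_comp _ (fun x => expR (- e * x))); exact: continuous_expM.
- by move=> x; exact: abel_ge0.
- by rewrite integral_abel// ltry.
Qed.

(** Adding 1 to the cosine makes the integrand nonnegative, so that the
    fundamental theorem of calculus on a half-line applies. *)
Lemma integral_abel_1cos e t : 0 < e ->
  (\int[leb1]_x (abel e x * (1 + cos (t * x)))%:E =
     (2 / e + 2 * poisson e t)%:E)%E.
Proof.
move=> e0; have e0' : e != 0 by rewrite gt_eqF.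
have D0 : e ^+ 2 + t ^+ 2 != 0 by rewrite gt_eqF// poisson_den_gt0.
have cosabs (x : R) : cos (t * `|x|) = cos (t * x).
  by have [_|_] := ger0P x => //; rewrite mulrN cosN.
under eq_integral do rewrite /abel -cosabs.
pose F x := expR (- e * x) * (- e^-1 +
  (t * sin (t * x) - e * cos (t * x)) / (e ^+ 2 + t ^+ 2)).
have f0 (x : R) : 0 <= expR (- e * x) * (1 + cos (t * x)).
  apply: mulr_ge0; first exact: expR_ge0.
  by have := cos_geN1 (t * x); lra.
have cf : continuous (fun x : R => expR (- e * x) * (1 + cos (t * x))).
  move=> x; apply: cvgM; first exact: continuous_expM.
  apply: cvgD; first exact: cvg_cst.
  apply: (@continuous_comp _ _ _ (fun x : R => t * x) cos).
    by apply: cvgM; [exact: cvg_cst|exact: cvg_id].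
  exact: continuous_cos.
have dF (x : R) : is_derive x 1 F (expR (- e * x) * (1 + cos (t * x))).
  rewrite /F; apply: is_derive_eq.
  rewrite !scaler1 /GRing.scale/=; field.
  by rewrite e0' D0.
have cvF : F x @[x --> +oo] --> (0 : R).
  pose K := e^-1 + (`|t| + e) / (e ^+ 2 + t ^+ 2).
  have cvK : expR (- e * x) * K @[x --> +oo] --> (0 : R).
    rewrite -(mul0r K).
    by apply: cvgM; [exact: cvg_expR_neg|exact: cvg_cst].
  apply: (@squeeze_cvgr _ _ _ _ (fun x => - (expR (- e * x) * K))
     (fun x => expR (- e * x) * K)) => //.
  + near=> x; rewrite -ler_norml normrM ger0_norm ?expR_ge0//.
    rewrite ler_wpM2l ?expR_ge0// (le_trans (ler_normD _ _))//.
    rewrite normrN normfV (gtr0_norm e0) lerD2l normrM.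
    rewrite normfV (gtr0_norm (poisson_den_gt0 t e0)) ler_wpM2r//.
      by rewrite invr_ge0 ltW// poisson_den_gt0.
    rewrite (le_trans (ler_normB _ _))// !normrM (gtr0_norm e0) lerD//.
      by rewrite ler_piMr// sin_max.
    by rewrite ler_piMr ?(ltW e0)// cos_max.
  + by rewrite -oppr0; apply: cvgN.
have -> := ge0_integral_abs_FTC f0 cf dF cvF.
rewrite /F !mulr0 expR0 sin0 cos0 /poisson; congr (_%:E); field.
by rewrite e0' D0.
Unshelve. all: by end_near. Qed.

Lemma measurable_cosR : measurable_fun [set: R] (@cos R).
Proof. by apply: continuous_measurable_fun => x; exact: continuous_cos. Qed.

Lemma measurable_sinR : measurable_fun [set: R] (@sin R).
Proof. by apply: continuous_measurable_fun => x; exact: continuous_sin. Qed.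

Lemma measurable_cosM t : measurable_fun [set: R] (fun x => cos (t * x)).
Proof. by apply: (measurableT_comp measurable_cosR); exact: measurable_funM. Qed.

Lemma measurable_sinM t : measurable_fun [set: R] (fun x => sin (t * x)).
Proof. by apply: (measurableT_comp measurable_sinR); exact: measurable_funM. Qed.

Lemma integrable_abel_cos e t : 0 < e ->
  leb1.-integrable setT (EFin \o (fun x => abel e x * cos (t * x))).
Proof.
move=> e0; apply: (integrableM_bounded (integrable_abel e0) (measurable_cosM t)).
by move=> x; exact: cos_max.
Qed.

Lemma integrable_abel_sin e t : 0 < e ->
  leb1.-integrable setT (EFin \o (fun x => abel e x * sin (t * x))).
Proof.
move=> e0; apply: (integrableM_bounded (integrable_abel e0) (measurable_sinM t)).
by move=> x; exact: sin_max.
Qed.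

Lemma Rintegral_abel_cos e t : 0 < e ->
  Rintegral leb1 setT (fun x => abel e x * cos (t * x)) = 2 * poisson e t.
Proof.
move=> e0.
have D : Rintegral leb1 setT (fun x => abel e x * (1 + cos (t * x))) =
    2 / e + 2 * poisson e t.
  by rewrite /Rintegral integral_abel_1cos.
have E : Rintegral leb1 setT (abel e) = 2 / e.
  by rewrite /Rintegral integral_abel.
apply: (addrI (2 / e)); rewrite -D -E -RintegralD//.
- by apply: eq_Rintegral => x _; rewrite mulrDr mulr1.
- exact: integrable_abel.
- exact: integrable_abel_cos.
Qed.

Lemma Rintegral_abel_sin e t : 0 < e ->
  Rintegral leb1 setT (fun x => abel e x * sin (t * x)) = 0.
Proof.
move=> e0.
have := Rintegral_measure_preserving (measure_preserving_opp R)
  (integrable_abel_sin t e0).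
rewrite [X in X = _ -> _](_ : _ =
  - Rintegral leb1 setT (fun x => abel e x * sin (t * x))); first lra.
rewrite -mulN1r -RintegralZl//; last exact: integrable_abel_sin.
by apply: eq_Rintegral => x _ /=; rewrite /abel normrN mulrN sinN mulrN mulN1r.
Qed.

End Poisson.

(** * Cosine and sine transforms in the plane *)

(** A name for the product measure to which the structure of sigma-finite measure
    is attached, so that Fubini's theorem applies to the product of two planes. *)
Definition plane_lebesgue (R : realType) :
    set (measurableTypeR R * measurableTypeR R) -> \bar R :=
  (@lebesgue_measure R \x @lebesgue_measure R)%E.

HB.instance Definition _ (R : realType) :=
  Measure.copy (@plane_lebesgue R) (@lebesgue_measure R \x @lebesgue_measure R)%E.

Lemma sigma_finite_plane_lebesgue (R : realType) :
  sigma_finite setT (@plane_lebesgue R).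
Proof.
pose I (n : nat) : set (measurableTypeR R) := `[- n%:R, n%:R]%classic.
have mI n : measurable (I n) by exact: measurable_itv.
exists (fun n => I n `*` I n).
  apply/seteqP; split=> // -[x y] _.
  exists (maxn (Num.truncn `|x|).+1 (Num.truncn `|y|).+1) => //.
  have h (z : R) (n : nat) : ((Num.truncn `|z|).+1 <= n)%N -> I n z.
    move=> zn; rewrite /I/= in_itv/= -ler_norml.
    by rewrite (le_trans (ltW (truncnS_gt _)))// ler_nat.
  by split; apply: h; rewrite ?leq_maxl ?leq_maxr.
move=> n; split; first exact: measurableX.
rewrite /plane_lebesgue (@product_measure1E _ _ _ _ _ (@lebesgue_measure R)
  (@lebesgue_measure R))//=.
rewrite /I lebesgue_measure_itv/=; case: ifP => _; last by rewrite mul0e ltry.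
by rewrite -EFinB -EFinM ltry.
Qed.

HB.instance Definition _ (R : realType) := Measure_isSigmaFinite.Build _ _ _
  (@plane_lebesgue R) (@sigma_finite_plane_lebesgue R).

Section PlaneIntegration.
Variable R : realType.
Local Notation plane := (measurableTypeR R * measurableTypeR R)%type.
Local Notation leb1 := (leb1 R).
Local Notation leb2 := (leb2 R).
Let leb1s : {sigma_finite_measure set (measurableTypeR R) -> \bar R} :=
  @lebesgue_measure R.
Let leb2s : {sigma_finite_measure set plane -> \bar R} :=
  @plane_lebesgue R.
Local Notation integrable1 f := (leb1.-integrable setT (EFin \o f)).
Local Notation integrable2 f := (leb2.-integrable setT (EFin \o f)).

Lemma plane_swap (a b : plane -> R) (k : plane * plane -> R) (B : R) :
  integrable2 a -> integrable2 b ->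
  measurable_fun setT k -> (forall z, `|k z| <= B) ->
  Rintegral leb2 setT (fun x => a x * Rintegral leb2 setT (fun y => b y * k (x, y)))
  = Rintegral leb2 setT (fun y => b y * Rintegral leb2 setT (fun x => a x * k (x, y))).
Proof.
move=> ai bi mk kB.
exact (@bilinear_swap _ _ plane plane R leb2s leb2s a b k B ai bi mk kB).
Qed.

Lemma integrable_plane_tensor (a b : R -> R) : integrable1 a -> integrable1 b ->
  integrable2 (fun z : plane => a z.1 * b z.2).
Proof.
move=> ai bi.
have B1 z : `|@cst (measurableTypeR R * measurableTypeR R) R 1 z| <= 1.
  by rewrite normr1.
have m1 : measurable_fun [set: plane] (@cst plane R 1) by exact: measurable_cst.
have := @integrable_tensor _ _ _ _ _ leb1s leb1s a b (cst 1) 1 ai bi m1 B1.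
by apply: eq_integrable => // z _ /=; rewrite mulr1.
Qed.

Lemma Rintegral_plane_tensor (a b : R -> R) : integrable1 a -> integrable1 b ->
  Rintegral leb2 setT (fun z : plane => a z.1 * b z.2) =
  Rintegral leb1 setT a * Rintegral leb1 setT b.
Proof.
move=> ai bi.
rewrite -(@Rfubini _ _ _ _ _ leb1s leb1s (fun z : plane => a z.1 * b z.2)
  (integrable_plane_tensor ai bi)); last first.
  by move=> x; exact: (RintegrableZl (a x) bi).
rewrite -[RHS]RintegralZr//; apply: eq_Rintegral => x _.
by rewrite /= RintegralZl.
Qed.

Lemma dot_sub (x xi eta : R * R) : dot x (xi - eta) = dot x xi - dot x eta.
Proof. by rewrite /dot/=; ring. Qed.

Lemma measurable_dot : measurable_fun [set: plane * plane]
  (fun z : plane * plane => dot z.1 z.2).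
Proof.
by apply: measurable_funD; apply: measurable_funM; apply: measurableT_comp.
Qed.

Lemma measurable_cos_dot (x : R * R) :
  measurable_fun [set: plane] (fun xi : plane => cos (dot x xi)).
Proof.
apply: measurableT_comp; first exact: measurable_cosR.
by apply: measurable_funD; apply: measurable_funM.
Qed.

Lemma measurable_sin_dot (x : R * R) :
  measurable_fun [set: plane] (fun xi : plane => sin (dot x xi)).
Proof.
apply: measurableT_comp; first exact: measurable_sinR.
by apply: measurable_funD; apply: measurable_funM.
Qed.

Lemma integrable_cos_dot (g : R * R -> R) x : integrable2 g ->
  integrable2 (fun xi : plane => g xi * cos (dot x xi)).
Proof.
by move=> gi; apply: (integrableM_bounded gi (measurable_cos_dot x)) => z;
  exact: cos_max.
Qed.

Lemma integrable_sin_dot (g : R * R -> R) x : integrable2 g ->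
  integrable2 (fun xi : plane => g xi * sin (dot x xi)).
Proof.
by move=> gi; apply: (integrableM_bounded gi (measurable_sin_dot x)) => z;
  exact: sin_max.
Qed.

Definition cos_transform (g : R * R -> R) (x : R * R) : R :=
  Rintegral leb2 setT (fun xi : plane => g xi * cos (dot x xi)).

Definition sin_transform (g : R * R -> R) (x : R * R) : R :=
  Rintegral leb2 setT (fun xi : plane => g xi * sin (dot x xi)).

Lemma le_cos_transform g x : integrable2 g ->
  `|cos_transform g x| <= Rintegral leb2 setT (fun xi : plane => `|g xi|).
Proof.
move=> gi; have gci := integrable_cos_dot x gi.
apply: le_trans (le_normr_Rintegral measurableT gci) _.
apply: le_Rintegral => //.
- exact: integrable_norm gci.
- exact: integrable_norm gi.
- by move=> z _; rewrite normrM ler_piMr// cos_max.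
Qed.

Lemma le_sin_transform g x : integrable2 g ->
  `|sin_transform g x| <= Rintegral leb2 setT (fun xi : plane => `|g xi|).
Proof.
move=> gi; have gci := integrable_sin_dot x gi.
apply: le_trans (le_normr_Rintegral measurableT gci) _.
apply: le_Rintegral => //.
- exact: integrable_norm gci.
- exact: integrable_norm gi.
- by move=> z _; rewrite normrM ler_piMr// sin_max.
Qed.

Lemma plane_bilinear_integrable (a b : plane -> R) (k : plane * plane -> R) (B : R) :
  integrable2 a -> integrable2 b ->
  measurable_fun setT k -> (forall z, `|k z| <= B) ->
  integrable2 (fun x => a x * Rintegral leb2 setT (fun y => b y * k (x, y))).
Proof.
move=> ai bi mk kB.
exact (@bilinear_integrable _ _ plane plane R leb2s leb2s a b k B ai bi mk kB).
Qed.

Definition abel2 (e : R) (x : R * R) : R := abel e x.1 * abel e x.2.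

Definition poisson2 (e : R) (x : R * R) : R := poisson e x.1 * poisson e x.2.

Lemma abel2_ge0 e x : 0 <= abel2 e x.
Proof. by rewrite mulr_ge0// abel_ge0. Qed.

Lemma abel2_le1 e x : 0 <= e -> abel2 e x <= 1.
Proof. by move=> e0; rewrite -[leRHS]mulr1 ler_pM ?abel_ge0 ?abel_le1. Qed.

Lemma poisson2_ge0 e x : 0 < e -> 0 <= poisson2 e x.
Proof. by move=> e0; rewrite mulr_ge0// poisson_ge0. Qed.

Lemma poisson2_opp e x : poisson2 e (- x) = poisson2 e x.
Proof. by rewrite /poisson2/= !poisson_opp. Qed.

Lemma integrable_abel2 e : 0 < e -> integrable2 (abel2 e).
Proof. by move=> e0; apply: integrable_plane_tensor; exact: integrable_abel. Qed.

Lemma integrable_poisson2 e : 0 < e -> integrable2 (poisson2 e).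
Proof. by move=> e0; apply: integrable_plane_tensor; exact: integrable_poisson. Qed.

Lemma Rintegral_poisson2 e : 0 < e -> Rintegral leb2 setT (poisson2 e) = pi ^+ 2.
Proof.
move=> e0; rewrite Rintegral_plane_tensor; try exact: integrable_poisson.
by rewrite /Rintegral integral_poisson.
Qed.

Lemma Rintegral_abel2_cos e xi : 0 < e ->
  Rintegral leb2 setT (fun x : plane => abel2 e x * cos (dot x xi)) =
  4 * poisson2 e xi.
Proof.
move=> e0; pose c t x := abel e x * cos (t * x); pose s t x := abel e x * sin (t * x).
have ci t : integrable1 (c t) by exact: integrable_abel_cos.
have si t : integrable1 (s t) by exact: integrable_abel_sin.
transitivity (Rintegral leb2 setT (fun x : plane =>
    c xi.1 x.1 * c xi.2 x.2 - s xi.1 x.1 * s xi.2 x.2)).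
  apply: eq_Rintegral => x _; rewrite /abel2 /dot cosD /c /s.
  by rewrite ![xi.1 * _]mulrC ![xi.2 * _]mulrC; ring.
rewrite RintegralB//; try exact: integrable_plane_tensor.
rewrite !Rintegral_plane_tensor// /c /s !Rintegral_abel_cos// !Rintegral_abel_sin//.
by rewrite /poisson2; ring.
Qed.

End PlaneIntegration.

Section Bessel.
Variable R : realType.
Local Notation plane := (measurableTypeR R * measurableTypeR R)%type.
Local Notation leb1 := (leb1 R).
Local Notation leb2 := (leb2 R).
Local Notation integrable2 f := (leb2.-integrable setT (EFin \o f)).
Variable g : R * R -> R.
Hypothesis gi : integrable2 g.

Let B := Rintegral leb2 setT (fun xi : plane => `|g xi|).

(** Abel summation of a transform at the origin: by Fubini's theorem the Abel
    factor can be transformed instead, which replaces it by a Poisson kernel. *)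
Lemma abel2_cos_transform e : 0 < e ->
  Rintegral leb2 setT (fun x : plane => abel2 e x * cos_transform g x) =
  Rintegral leb2 setT (fun xi : plane => g xi * (4 * poisson2 e xi)).
Proof.
move=> e0.
rewrite (@plane_swap _ (abel2 e) g (fun z => cos (dot z.1 z.2)) 1)//=.
- by apply: eq_Rintegral => xi _; rewrite Rintegral_abel2_cos.
- exact: integrable_abel2.
- by apply: measurableT_comp; [exact: measurable_cosR|exact: measurable_dot].
- by move=> z; exact: cos_max.
Qed.

Lemma measurable_poisson2_sub e : 0 < e ->
  measurable_fun [set: plane * plane] (fun z : plane * plane => poisson2 e (z.1 - z.2)).
Proof.
move=> e0; have mP : measurable_fun [set: R] (poisson e).
  by apply: continuous_measurable_fun; exact: continuous_poisson.
by apply: measurable_funM; apply: (measurableT_comp mP); apply: measurable_funB;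
  apply: measurableT_comp.
Qed.

Hypothesis g2i : integrable2 (fun xi => g xi ^+ 2).
Hypothesis mcos : measurable_fun [set: plane] (cos_transform g).
Hypothesis msin : measurable_fun [set: plane] (sin_transform g).

Let D (z : plane * plane) : R :=
  cos (dot z.1 z.2) * cos_transform g z.1 + sin (dot z.1 z.2) * sin_transform g z.1.

Let mD : measurable_fun setT D.
Proof.
apply: measurable_funD; apply: measurable_funM; apply: measurableT_comp => //.
- exact: measurable_cosR.
- exact: measurable_dot.
- exact: measurable_sinR.
- exact: measurable_dot.
Qed.

Let D_bound z : `|D z| <= B + B.
Proof.
rewrite (le_trans (ler_normD _ _))// lerD// normrM.
- rewrite -[leRHS]mul1r ler_pM//; first exact: cos_max.
  exact: le_cos_transform.
- rewrite -[leRHS]mul1r ler_pM//; first exact: sin_max.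
  exact: le_sin_transform.
Qed.

Let D_cos_sub x xi : D (x, xi) =
  Rintegral leb2 setT (fun eta : plane => g eta * cos (dot x (xi - eta))).
Proof.
rewrite /D/= -RintegralZl//; last exact: integrable_cos_dot.
rewrite -[X in _ + X]RintegralZl//; last exact: integrable_sin_dot.
rewrite -RintegralD//.
- by apply: eq_Rintegral => eta _; rewrite dot_sub cosB; ring.
- by apply: RintegrableZl; exact: integrable_cos_dot.
- by apply: RintegrableZl; exact: integrable_sin_dot.
Qed.

Let sqr_transform x : cos_transform g x ^+ 2 + sin_transform g x ^+ 2 =
  Rintegral leb2 setT (fun xi : plane => g xi * D (x, xi)).
Proof.
rewrite !expr2 {1}/cos_transform {1}/sin_transform.
rewrite -RintegralZr//; last exact: integrable_cos_dot.
rewrite -[X in _ + X]RintegralZr//; last exact: integrable_sin_dot.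
rewrite -RintegralD//.
- by apply: eq_Rintegral => xi _; rewrite /D/=; ring.
- have := RintegrableZl (cos_transform g x) (integrable_cos_dot x gi).
  by apply: eq_integrable => // xi _ /=; rewrite mulrC.
- have := RintegrableZl (sin_transform g x) (integrable_sin_dot x gi).
  by apply: eq_integrable => // xi _ /=; rewrite mulrC.
Qed.

Let abel2_sqr e : 0 < e ->
  Rintegral leb2 setT (fun x : plane =>
    abel2 e x * (cos_transform g x ^+ 2 + sin_transform g x ^+ 2)) =
  Rintegral leb2 setT (fun xi : plane => g xi * Rintegral leb2 setT
    (fun eta : plane => g eta * (4 * poisson2 e (xi - eta)))).
Proof.
move=> e0; under eq_Rintegral do rewrite sqr_transform.
rewrite (plane_swap (integrable_abel2 e0) gi mD D_bound).
apply: eq_Rintegral => xi _; congr (_ * _).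
under eq_Rintegral do rewrite D_cos_sub.
rewrite (@plane_swap _ (abel2 e) g
  (fun z : plane * plane => cos (dot z.1 (xi - z.2))) 1)//=.
- by apply: eq_Rintegral => eta _; rewrite Rintegral_abel2_cos.
- exact: integrable_abel2.
- apply: measurableT_comp; first exact: measurable_cosR.
  under eq_fun do rewrite dot_sub.
  apply: measurable_funB; last exact: measurable_dot.
  by apply: measurable_funD; apply: measurable_funM => //; apply: measurableT_comp.
- by move=> z; exact: cos_max.
Qed.

Let poisson2_sub_preserving (eta : plane) :
  measure_preserving leb2 (fun xi : plane => xi - eta).
Proof. exact: measure_preserving_shift2. Qed.

Let Rintegral_poisson2_sub e eta : 0 < e ->
  Rintegral leb2 setT (fun xi : plane => poisson2 e (xi - eta)) = pi ^+ 2.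
Proof.
move=> e0; rewrite -(Rintegral_poisson2 e0).
exact: (Rintegral_measure_preserving (poisson2_sub_preserving eta)
  (integrable_poisson2 e0)).
Qed.

Let integrable_poisson2_sub e eta : 0 < e ->
  integrable2 (fun xi : plane => poisson2 e (xi - eta)).
Proof.
move=> e0; exact: (integrable_measure_preserving (poisson2_sub_preserving eta)
  (integrable_poisson2 e0)).
Qed.

Lemma poisson_le (e t : R) : 0 < e -> poisson e t <= e^-1.
Proof.
move=> e0; rewrite /poisson ler_pdivrMr ?poisson_den_gt0//.
by rewrite mulrDr expr2 mulKf ?gt_eqF// lerDl mulr_ge0 ?invr_ge0 ?(ltW e0)// sqr_ge0.
Qed.

Lemma norm_poisson2_le (e : R) (x : R * R) : 0 < e -> `|poisson2 e x| <= e^-1 * e^-1.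
Proof.
move=> e0; rewrite ger0_norm ?poisson2_ge0// /poisson2.
by rewrite ler_pM ?poisson_ge0 ?poisson_le.
Qed.

Let leb2s : {sigma_finite_measure set plane -> \bar R} := @plane_lebesgue R.

Let sqr_poisson2_integrable e : 0 < e ->
  (leb2s \x leb2s)%E.-integrable setT (EFin \o
    (fun z : plane * plane => g z.2 ^+ 2 * poisson2 e (z.1 - z.2))).
Proof.
move=> e0; have mg2 := integrable_measurable g2i.
apply/integrable21ltyP.
  apply/measurable_EFinP; apply: measurable_funM.
    exact: (measurableT_comp mg2).
  exact: measurable_poisson2_sub.
have E (eta : plane) : (\int[leb2s]_xi `|(g eta ^+ 2 * poisson2 e (xi - eta))%:E| =
    (pi ^+ 2 * g eta ^+ 2)%:E)%E.
  transitivity (\int[leb2]_xi (g eta ^+ 2 * poisson2 e (xi - eta))%:E)%E.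
    apply: eq_integral => xi _.
    by rewrite gee0_abs// lee_fin mulr_ge0 ?sqr_ge0 ?poisson2_ge0.
  rewrite -Rintegral_EFin; last by apply: RintegrableZl; exact: integrable_poisson2_sub.
  rewrite RintegralZl//; last exact: integrable_poisson2_sub.
  by rewrite Rintegral_poisson2_sub// mulrC.
under eq_integral do rewrite E.
exact: integrable_lty (RintegrableZl (pi ^+ 2) g2i).
Qed.

Let sqr_conv e xi :=
  Rintegral leb2 setT (fun eta : plane => g eta ^+ 2 * poisson2 e (xi - eta)).

Let integrable_sqr_poisson2 e xi : 0 < e ->
  integrable2 (fun eta : plane => g eta ^+ 2 * poisson2 e (xi - eta)).
Proof.
move=> e0.
apply: (integrableM_bounded g2i _ (fun eta => norm_poisson2_le (xi - eta) e0)).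
have := integrable_measurable (integrable_poisson2_sub xi e0).
by apply: eq_measurable_fun => eta _; rewrite -[xi - eta]opprB poisson2_opp.
Qed.

Let Rintegral_sqr_conv e : 0 < e -> integrable2 (sqr_conv e) /\
  Rintegral leb2 setT (sqr_conv e) =
  pi ^+ 2 * Rintegral leb2 setT (fun xi : plane => g xi ^+ 2).
Proof.
move=> e0; have gPi := sqr_poisson2_integrable e0; split.
  apply: eq_integrable (integrable_fubini_F gPi) => // xi _.
  by rewrite /fubini_F /sqr_conv /= Rintegral_EFin//; exact: integrable_sqr_poisson2.
rewrite (@Rfubini _ _ plane plane R leb2s leb2s _ gPi); last first.
  by move=> xi; exact: integrable_sqr_poisson2.
rewrite -(@Rfubini_sym _ _ plane plane R leb2s leb2s _ gPi); last first.
  by move=> eta; exact: (RintegrableZl (g eta ^+ 2) (integrable_poisson2_sub eta e0)).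
rewrite -[RHS]RintegralZl//; apply: eq_Rintegral => eta _ /=.
rewrite RintegralZl//; last exact: integrable_poisson2_sub.
by rewrite Rintegral_poisson2_sub// mulrC.
Qed.

(** Bessel's inequality, tempered by the Abel factor: the Poisson kernel is
    positive and has mass [pi ^+ 2], so its quadratic form is at most
    [pi ^+ 2] times the square of the L2 norm. *)
Lemma bessel_abel2 e : 0 < e ->
  Rintegral leb2 setT (fun x : plane =>
    abel2 e x * (cos_transform g x ^+ 2 + sin_transform g x ^+ 2)) <=
  4 * pi ^+ 2 * Rintegral leb2 setT (fun xi : plane => g xi ^+ 2).
Proof.
move=> e0; rewrite abel2_sqr//.
have [Hi HE] := Rintegral_sqr_conv e0.
have mP : measurable_fun setT
    (fun z : plane * plane => 4 * poisson2 e (z.1 - z.2)).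
  by apply: measurable_funM => //; exact: measurable_poisson2_sub.
have bP (z : plane * plane) : `|4 * poisson2 e (z.1 - z.2)| <= 4 * (e^-1 * e^-1).
  by rewrite normrM ger0_norm// ler_wpM2l// norm_poisson2_le.
have gGi := plane_bilinear_integrable gi gi mP bP.
have -> : 4 * pi ^+ 2 * Rintegral leb2 setT (fun xi : plane => g xi ^+ 2) =
    Rintegral leb2 setT (fun xi : plane => 2 * pi ^+ 2 * g xi ^+ 2 + 2 * sqr_conv e xi).
  rewrite RintegralD//; try exact: RintegrableZl.
  by rewrite !RintegralZl// HE; ring.
apply: le_Rintegral => //; first by apply: RintegrableD; exact: RintegrableZl.
move=> xi _ /=.
have Pi : integrable2 (fun eta : plane => poisson2 e (xi - eta)).
  by apply: eq_integrable (integrable_poisson2_sub xi e0) => // eta _ /=;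
    rewrite -[xi - eta]opprB poisson2_opp.
have gPi : integrable2 (fun eta : plane => g eta * (4 * poisson2 e (xi - eta))).
  apply: (integrableM_bounded gi) => [|eta]; last exact: (bP (xi, eta)).
  exact: (integrable_measurable (RintegrableZl 4 Pi)).
have PE : Rintegral leb2 setT (fun eta : plane => poisson2 e (xi - eta)) = pi ^+ 2.
  rewrite -(Rintegral_poisson2_sub xi e0); apply: eq_Rintegral => eta _.
  by rewrite -[xi - eta]opprB poisson2_opp.
rewrite -RintegralZl//.
have -> : 2 * pi ^+ 2 * g xi ^+ 2 + 2 * sqr_conv e xi =
   Rintegral leb2 setT (fun eta : plane => 2 * g xi ^+ 2 * poisson2 e (xi - eta) +
      2 * (g eta ^+ 2 * poisson2 e (xi - eta))).
  rewrite RintegralD//; last 2 first.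
  - exact: RintegrableZl.
  - by apply: RintegrableZl; exact: integrable_sqr_poisson2.
  rewrite !RintegralZl ?PE//; last exact: integrable_sqr_poisson2.
  by rewrite /sqr_conv; ring.
apply: le_Rintegral => //.
- exact: RintegrableZl.
- by apply: RintegrableD; apply: RintegrableZl => //; exact: integrable_sqr_poisson2.
- move=> eta _; have := poisson2_ge0 (xi - eta) e0.
  move: (poisson2 _ _) => p p0; rewrite -subr_ge0.
  rewrite [leRHS](_ : _ = 2 * p * (g xi - g eta) ^+ 2); last by ring.
  by rewrite mulr_ge0 ?sqr_ge0// mulr_ge0.
Qed.

End Bessel.

(** * Abel-Poisson summation *)

Section AbelPoisson.
Variable R : realType.
Local Notation plane := (measurableTypeR R * measurableTypeR R)%type.
Local Notation leb1 := (leb1 R).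
Local Notation leb2 := (leb2 R).
Local Notation integrable1 f := (leb1.-integrable setT (EFin \o f)).
Local Notation integrable2 f := (leb2.-integrable setT (EFin \o f)).

(** The mass of the Poisson kernel concentrates at the origin: away from it the
    kernel is of size [e] with respect to a fixed integrable function. *)
Lemma poisson_tail (e d t : R) : 0 < e -> 0 < d -> d <= `|t| ->
  poisson e t <= e * (1 + d ^- 2) * poisson 1 t.
Proof.
move=> e0 d0 dt.
have t2 : d ^+ 2 <= t ^+ 2 by rewrite -[leRHS]real_normK ?num_real// lerXn2r ?nnegrE ?(ltW d0).
have d20 : 0 < d ^+ 2 by rewrite exprn_gt0.
have t20 : 0 < t ^+ 2 by exact: lt_le_trans t2.
apply: (@le_trans _ _ (e / t ^+ 2)).
  rewrite /poisson ler_wpM2l ?(ltW e0)// lef_pV2 ?posrE ?poisson_den_gt0//.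
  by rewrite lerDr sqr_ge0.
rewrite /poisson expr1n -mulrA ler_wpM2l ?(ltW e0)//.
have D1 : 0 < 1 + t ^+ 2 by rewrite ltr_pwDl ?sqr_ge0.
rewrite mul1r ler_pdivlMr// mulrDr mulr1 mulVf ?gt_eqF// addrC lerD2l.
by rewrite lef_pV2 ?posrE.
Qed.

Definition plane_nbhs_box (x : R * R) (d : R) : set (R * R) :=
  [set y | `|y.1 - x.1| < d /\ `|y.2 - x.2| < d].

Lemma continuous_planeP (f : R * R -> R) (x : R * R) :
  {for x, continuous f} -> forall eps, 0 < eps ->
  exists2 d, 0 < d & forall y, plane_nbhs_box x d y -> `|f y - f x| <= eps.
Proof.
move=> /cvgrPdist_le cf eps eps0.
have /nbhs_ballP[d /= d0 dP] := cf _ eps0.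
exists d; first by [].
move=> y [y1 y2]; rewrite distrC; apply: dP.
by split; rewrite /ball/= distrC.
Qed.

Lemma poisson_approx_identity (f : R -> R) (M s0 eps : R) :
  continuous f -> (forall s, `|f s| <= M) -> 0 < eps ->
  exists2 e0, 0 < e0 & forall e, 0 < e -> e < e0 ->
  `|Rintegral leb1 setT (fun s => f s * poisson e (s - s0)) - pi * f s0| <= eps.
Proof.
move=> cf fM eps0; have pi0 := pi_gt0 R.
have M0 : 0 <= M by exact: le_trans (fM 0).
pose eps1 := eps / 2 / pi.
have eps10 : 0 < eps1 by rewrite !divr_gt0.
have /cvgrPdist_le/(_ _ eps10)/nbhs_ballP[d /= d0 dP] := cf s0.
have c0 : 0 <= 1 + d ^- 2 by rewrite addr_ge0// invr_ge0 sqr_ge0.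
(* The part of the integral over [d <= `|s - s0|] is at most [e * K]. *)
pose K := 2 * M * (1 + d ^- 2) * pi.
have K0 : 0 <= K by rewrite !mulr_ge0 ?(ltW pi0).
exists (eps / 2 / (K + 1)); first by rewrite !divr_gt0// ltr_wpDl.
move=> e e0 elt.
have mf : measurable_fun [set: R] f by exact: continuous_measurable_fun.
have Pi (a : R) : 0 < a -> integrable1 (fun s => poisson a (s - s0)).
  move=> a0; exact: (integrable_measure_preserving
    (measure_preserving_shift (- s0)) (integrable_poisson a0)).
have PE (a : R) : 0 < a -> Rintegral leb1 setT (fun s => poisson a (s - s0)) = pi.
  move=> a0.
  rewrite (Rintegral_measure_preserving (measure_preserving_shift (- s0))
    (integrable_poisson a0)).
  by rewrite /Rintegral integral_poisson.
have fPi : integrable1 (fun s => f s * poisson e (s - s0)).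
  have := integrableM_bounded (Pi _ e0) mf fM.
  by apply: eq_integrable => // s _ /=; rewrite mulrC.
have -> : pi * f s0 = Rintegral leb1 setT (fun s => f s0 * poisson e (s - s0)).
  by rewrite RintegralZl ?PE 1?mulrC//; exact: Pi.
have fs0i : integrable1 (fun s => f s0 * poisson e (s - s0)).
  by apply: RintegrableZl; exact: Pi.
rewrite -RintegralB//.
apply: (le_trans (le_normr_Rintegral measurableT (RintegrableB fPi fs0i))).
have Bi : integrable1 (fun s => eps1 * poisson e (s - s0) +
    2 * M * (e * (1 + d ^- 2)) * poisson 1 (s - s0)).
  by apply: RintegrableD; apply: RintegrableZl; exact: Pi.
apply: (@le_trans _ _ (Rintegral leb1 setT (fun s => eps1 * poisson e (s - s0) +
    2 * M * (e * (1 + d ^- 2)) * poisson 1 (s - s0)))).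
  apply: le_Rintegral => //.
    by apply: integrable_norm; exact: RintegrableB.
  move=> s _; rewrite -mulrBl normrM (ger0_norm (poisson_ge0 _ e0)).
  have P1 := poisson_ge0 (s - s0) (@ltr01 R).
  have Pe := poisson_ge0 (s - s0) e0.
  have [sd|sd] := ltP `|s - s0| d.
    rewrite -[leLHS]addr0 lerD//.
      rewrite ler_wpM2r// distrC; apply: dP.
      by rewrite /ball/= distrC.
    exact: (mulr_ge0 (mulr_ge0 (mulr_ge0 _ M0) (mulr_ge0 (ltW e0) c0)) P1).
  rewrite -[leLHS]add0r lerD//; first by rewrite mulr_ge0// ltW.
  rewrite [leRHS](_ : _ = (2 * M) * (e * (1 + d ^- 2) * poisson 1 (s - s0))); last by ring.
  rewrite ler_pM//; last exact: poisson_tail.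
  by rewrite (le_trans (ler_normB _ _))// mulr_natl mulr2n lerD.
rewrite RintegralD//; try by apply: RintegrableZl; exact: Pi.
rewrite RintegralZl ?PE//; try exact: Pi.
rewrite RintegralZl ?PE//; try exact: Pi.
have -> : eps1 * pi = eps / 2 by rewrite /eps1 divfK// gt_eqF.
have -> : 2 * M * (e * (1 + d ^- 2)) * pi = e * K by rewrite /K; ring.
rewrite [leRHS](splitr eps) lerD2l.
apply: (le_trans (ler_wpM2r K0 (ltW elt))).
rewrite mulrAC ler_pdivrMr ?ltr_wpDl// ler_wpM2l ?lerDl//.
by rewrite divr_ge0 ?(ltW eps0).
Qed.

(** Uniqueness for the Fourier transform on the line: summing the vanishing
    transform against the Abel factors gives the Poisson means of [f]. *)
Lemma fourier_uniqueness (f : R -> R) (M : R) :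
  continuous f -> (forall s, `|f s| <= M) -> integrable1 f ->
  (forall sigma, Rintegral leb1 setT (fun s => f s * cos (sigma * s)) = 0) ->
  (forall sigma, Rintegral leb1 setT (fun s => f s * sin (sigma * s)) = 0) ->
  forall s, f s = 0.
Proof.
move=> cf fM fi fcos fsin s0.
pose leb1s : {sigma_finite_measure set (measurableTypeR R) -> \bar R} :=
  @lebesgue_measure R.
have mean0 (e : R) : 0 < e ->
    Rintegral leb1 setT (fun s => f s * poisson e (s - s0)) = 0.
  move=> e0.
  pose k (z : measurableTypeR R * measurableTypeR R) : R := cos (z.1 * (z.2 - s0)).
  have mk : measurable_fun setT k.
    apply: measurableT_comp; first exact: measurable_cosR.
    by apply: measurable_funM => //; apply: measurable_funB.
  have swap := @bilinear_swap _ _ _ _ _ leb1s leb1s (abel e) f k 1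
    (integrable_abel e0) fi mk (fun z => cos_max _).
  have inner sigma : Rintegral leb1 setT (fun s => f s * k (sigma, s)) = 0.
    transitivity (Rintegral leb1 setT (fun s =>
        cos (sigma * s0) * (f s * cos (sigma * s)) +
        sin (sigma * s0) * (f s * sin (sigma * s)))).
      by apply: eq_Rintegral => s _; rewrite /k/= mulrBr cosB; ring.
    have ci : integrable1 (fun s => f s * cos (sigma * s)).
      by apply: (integrableM_bounded fi (measurable_cosM sigma)) => s; exact: cos_max.
    have si : integrable1 (fun s => f s * sin (sigma * s)).
      by apply: (integrableM_bounded fi (measurable_sinM sigma)) => s; exact: sin_max.
    rewrite RintegralD//; try exact: RintegrableZl.
    by rewrite !RintegralZl// fcos fsin !mulr0 addr0.
  have : Rintegral leb1 setT (fun s => f s * (2 * poisson e (s - s0))) = 0.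
    transitivity (Rintegral leb1s setT (fun y : measurableTypeR R => f y *
        Rintegral leb1s setT (fun x : measurableTypeR R => abel e x * k (x, y)))).
      apply: eq_Rintegral => s _; congr (_ * _).
      rewrite -Rintegral_abel_cos//; apply: eq_Rintegral => x _.
      by rewrite /k/= [x * _]mulrC.
    rewrite -swap; transitivity (Rintegral leb1s setT (fun _ : measurableTypeR R => 0 : R)).
      by apply: eq_Rintegral => x _; rewrite [X in _ * X]inner mulr0.
    by rewrite Rintegral_cst// mul0r.
  have fPi : integrable1 (fun s => f s * poisson e (s - s0)).
    have mf : measurable_fun [set: R] f by exact: continuous_measurable_fun.
    have Pi := integrable_measure_preserving
      (measure_preserving_shift (- s0)) (integrable_poisson e0).
    have := integrableM_bounded Pi mf fM.
    by apply: eq_integrable => // s _ /=; rewrite mulrC.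
  under eq_Rintegral do rewrite mulrCA.
  by rewrite RintegralZl// => /eqP; rewrite mulf_eq0 pnatr_eq0/= => /eqP.
have pi0 := pi_gt0 R.
apply/eqP; rewrite -normr_le0; apply/ler_addgt0Pl => eps eps0.
have [e0 e00 H] := poisson_approx_identity s0 cf fM (mulr_gt0 pi0 eps0).
have e20 : 0 < e0 / 2 by rewrite divr_gt0.
have e2 : e0 / 2 < e0 by lra.
have := H (e0 / 2) e20 e2.
by rewrite mean0// sub0r normrN normrM (gtr0_norm pi0) ler_pM2l// addr0.
Qed.

Lemma poisson2_approx_identity (g : R * R -> R) (M eps : R) :
  continuous g -> (forall x, `|g x| <= M) -> 0 < eps ->
  exists2 e0, 0 < e0 & forall e, 0 < e -> e < e0 ->
  `|Rintegral leb2 setT (fun x : plane => g x * poisson2 e x) - pi ^+ 2 * g 0| <= eps.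
Proof.
move=> cg gM eps0; have pi0 : 0 < pi ^+ 2 :> R by rewrite exprn_gt0// pi_gt0.
have M0 : 0 <= M by exact: le_trans (gM 0).
pose eps1 := eps / 2 / pi ^+ 2.
have eps10 : 0 < eps1 by rewrite !divr_gt0.
have [d d0 dP] := continuous_planeP (cg 0) eps10.
have d20 : 0 <= 1 + d ^- 2 by rewrite addr_ge0// invr_ge0 sqr_ge0.
pose K := 2 * M * (1 + d ^- 2) * (2 * pi ^+ 2).
have K0 : 0 <= K.
  exact: (mulr_ge0 (mulr_ge0 (mulr_ge0 _ M0) d20) (mulr_ge0 _ (ltW pi0))).
exists (eps / 2 / (K + 1)); first by rewrite !divr_gt0// ltr_wpDl.
move=> e e0 elt.
have mg : measurable_fun [set: plane] g by exact: continuous_measurable_plane.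
have Pi := integrable_poisson2 e0.
have PE := Rintegral_poisson2 e0.
(* Outside the square of half-side [d], one of the two factors of [poisson2 e]
   is small with [e]. *)
pose Q (x : R * R) := poisson 1 x.1 * poisson e x.2 + poisson e x.1 * poisson 1 x.2.
have i1 := integrable_poisson (@ltr01 R); have ie := integrable_poisson e0.
have Q1i := integrable_plane_tensor i1 ie.
have Q2i := integrable_plane_tensor ie i1.
have Qi : integrable2 Q by exact: RintegrableD.
have QE : Rintegral leb2 setT Q = 2 * pi ^+ 2.
  rewrite RintegralD// !Rintegral_plane_tensor//.
  by rewrite /Rintegral !integral_poisson//=; ring.
have gPi : integrable2 (fun x => g x * poisson2 e x).
  have := integrableM_bounded Pi mg gM.
  by apply: eq_integrable => // s _ /=; rewrite mulrC.
have -> : pi ^+ 2 * g 0 = Rintegral leb2 setT (fun x : plane => g 0 * poisson2 e x).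
  by rewrite RintegralZl ?PE 1?mulrC.
have g0i : integrable2 (fun x => g 0 * poisson2 e x) by exact: RintegrableZl.
rewrite -RintegralB//.
apply: (le_trans (le_normr_Rintegral measurableT (RintegrableB gPi g0i))).
have Bi : integrable2 (fun x => eps1 * poisson2 e x + 2 * M * (e * (1 + d ^- 2)) * Q x).
  by apply: RintegrableD; exact: RintegrableZl.
apply: (@le_trans _ _ (Rintegral leb2 setT (fun x : plane => eps1 * poisson2 e x +
    2 * M * (e * (1 + d ^- 2)) * Q x))).
  apply: le_Rintegral => //.
    by apply: integrable_norm; exact: RintegrableB.
  move=> x _; rewrite -mulrBl normrM (ger0_norm (poisson2_ge0 _ e0)).
  have P2 := poisson2_ge0 x e0.
  have c0 : 0 <= e * (1 + d ^- 2) by rewrite mulr_ge0 ?(ltW e0).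
  have Q0 : 0 <= Q x by rewrite addr_ge0// mulr_ge0// poisson_ge0.
  have [/andP[x1 x2]|xd] := boolP ((`|x.1| < d) && (`|x.2| < d)).
    rewrite -[leLHS]addr0 lerD//; last exact: (mulr_ge0 (mulr_ge0 (mulr_ge0 _ M0) c0) Q0).
    by rewrite ler_wpM2r//; apply: dP; rewrite /plane_nbhs_box/= !subr0.
  rewrite -[leLHS]add0r lerD//; first by rewrite mulr_ge0// ltW.
  rewrite -[leRHS]mulrA ler_pM//.
    by rewrite (le_trans (ler_normB _ _))// mulr_natl mulr2n lerD.
  move: xd; rewrite negb_and -!leNgt /poisson2 /Q mulrDr => /orP[xd|xd].
    rewrite -[leLHS]addr0 lerD//; last by rewrite mulr_ge0// mulr_ge0// poisson_ge0.
    by rewrite mulrA ler_wpM2r ?poisson_ge0// poisson_tail.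
  rewrite -[leLHS]add0r lerD//; first by rewrite mulr_ge0// mulr_ge0// poisson_ge0.
  by rewrite [leRHS]mulrCA ler_wpM2l ?poisson_ge0// poisson_tail.
rewrite RintegralD//; try exact: RintegrableZl.
rewrite RintegralZl ?PE// RintegralZl ?QE//.
have -> : eps1 * pi ^+ 2 = eps / 2 by rewrite /eps1 divfK// gt_eqF.
have -> : 2 * M * (e * (1 + d ^- 2)) * (2 * pi ^+ 2) = e * K by rewrite /K; ring.
rewrite [leRHS](splitr eps) lerD2l.
apply: (le_trans (ler_wpM2r K0 (ltW elt))).
rewrite mulrAC ler_pdivrMr ?ltr_wpDl// ler_wpM2l ?lerDl//.
by rewrite divr_ge0 ?(ltW eps0).
Qed.

(** Fourier inversion at the origin: the Abel means of the integral of the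
    transform converge to that integral, since the transform is integrable, and
    they are Poisson means of [g] at 0. *)
Lemma Rintegral_cos_transform_eq0 (g : R * R -> R) (M : R) :
  continuous g -> (forall x, `|g x| <= M) -> integrable2 g ->
  integrable2 (cos_transform g) ->
  Rintegral leb2 setT (cos_transform g) = 0 -> g 0 = 0.
Proof.
move=> cg gM gi cgi cg0; have pi0 : 0 < pi ^+ 2 :> R by rewrite exprn_gt0// pi_gt0.
pose e (n : nat) : R := n.+1%:R^-1.
have e0 n : 0 < e n by rewrite invr_gt0.
have mc := integrable_measurable cgi.
have lim0 : (\int[leb2]_x (abel2 (e n) x * cos_transform g x)%:E)%E @[n --> \oo]
    --> (\int[leb2]_x (cos_transform g x)%:E)%E.
  apply: (@dominated_cvg _ _ _ leb2 setT measurableT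
    (fun n x => (abel2 (e n) x * cos_transform g x)%:E)
    (fun x => (cos_transform g x)%:E) (fun x => `|cos_transform g x|%:E)) => //.
  - move=> n; apply/measurable_EFinP; apply: measurable_funM => //.
    exact: integrable_measurable (integrable_abel2 (e0 n)).
  - move=> x _; apply: cvg_EFin; first exact: nearW.
    rewrite -[X in _ --> X]mul1r; apply: cvgM; last exact: cvg_cst.
    rewrite -[X in _ --> X]mul1r; apply: cvgM.
    + rewrite -expR0 /abel; apply: (@cvg_comp _ _ _ (fun n => - e n * `|x.1|) expR _ (nbhs 0)).
        rewrite -(mul0r `|x.1|) -oppr0; apply: cvgM; last exact: cvg_cst.
        by apply: cvgN; exact: cvg_harmonic.
      exact: continuous_expR.
    + rewrite -expR0 /abel; apply: (@cvg_comp _ _ _ (fun n => - e n * `|x.2|) expR _ (nbhs 0)).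
        rewrite -(mul0r `|x.2|) -oppr0; apply: cvgM; last exact: cvg_cst.
        by apply: cvgN; exact: cvg_harmonic.
      exact: continuous_expR.
  - exact: integrable_norm cgi.
  - move=> n x _; rewrite lee_fin normrM ler_piMl//.
    by rewrite ger0_norm ?abel2_ge0// abel2_le1// ltW.
have lim1 : Rintegral leb2 setT (fun x : plane => g x * poisson2 (e n) x)
    @[n --> \oo] --> (0 : R).
  have : fine (\int[leb2]_x (abel2 (e n) x * cos_transform g x)%:E)%E @[n --> \oo] --> (0 : R).
    by rewrite -cg0; apply: fine_cvg; rewrite fineK//; exact: integrable_fin_num.
  have E n : fine (\int[leb2]_x (abel2 (e n) x * cos_transform g x)%:E)%E =
     4 * Rintegral leb2 setT (fun x : plane => g x * poisson2 (e n) x).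
    rewrite -[LHS]/(Rintegral leb2 setT (fun x : plane => abel2 (e n) x * cos_transform g x)).
    rewrite abel2_cos_transform//.
    under eq_Rintegral do rewrite mulrCA.
    rewrite RintegralZl//.
    have mg : measurable_fun [set: plane] g by exact: continuous_measurable_plane.
    have := integrableM_bounded (integrable_poisson2 (e0 n)) mg gM.
    by apply: eq_integrable => // s _ /=; rewrite mulrC.
  under eq_fun do rewrite E.
  have -> : (fun n => Rintegral leb2 setT (fun x : plane => g x * poisson2 (e n) x)) =
      (fun n => 4^-1 * (4 * Rintegral leb2 setT (fun x : plane => g x * poisson2 (e n) x))).
    by apply/funext => n; rewrite mulKf.
  by move=> H; rewrite -(mulr0 4^-1); apply: cvgM => //; exact: cvg_cst.
apply/eqP; rewrite -normr_le0; apply/ler_addgt0Pl => eps eps0; rewrite addr0.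
have eps2 : 0 < pi ^+ 2 * (eps / 2) by rewrite mulr_gt0// divr_gt0.
have [d d0 H] := poisson2_approx_identity cg gM eps2.
have /cvgrPdist_le/(_ _ eps2) := lim1.
have /cvgrPdist_lt/(_ _ d0) := @cvg_harmonic R.
move=> A B; near \oo => n.
have h1 : e n < d.
  have : `|0 - e n| < d by near: n.
  by rewrite sub0r normrN gtr0_norm.
have h2 : `|0 - Rintegral leb2 setT (fun x : plane => g x * poisson2 (e n) x)|
   <= pi ^+ 2 * (eps / 2) by near: n.
have h3 := H _ (e0 n) h1.
rewrite -(ler_pM2l pi0) -{1}(gtr0_norm pi0) -normrM.
move: h2 h3; rewrite !sub0r normrN; move: (Rintegral _ _ _) => I.
rewrite !ler_norml => /andP[? ?] /andP[? ?]; apply/andP; split; lra.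
Unshelve. all: by end_near. Qed.

End AbelPoisson.

(** * Second differences of a square root *)

Section SecondDifference.
Variable R : realType.
Local Notation leb1 := (leb1 R).
Implicit Types a b h x y z : R.

Lemma mean_value_bound (f f' : R -> R) (C : R) p q :
  (forall x, is_derive x 1 f (f' x)) ->
  (forall x, Num.min p q <= x <= Num.max p q -> `|f' x| <= C) ->
  `|f p - f q| <= C * `|p - q|.
Proof.
move=> df; wlog pq : p q / p <= q => [H|].
  have /orP[/H//|qp fC] := le_total p q.
  rewrite distrC [`|p - q|]distrC; apply: H => // x.
  by rewrite minC maxC; exact: fC.
rewrite (min_idPl pq) (max_idPr pq) => fC.
have cf : {within `[p, q], continuous f}.
  by apply: continuous_subspaceT; exact: is_derive_continuous df.
have [c cpq E] := MVT_segment pq (fun x _ => df x) cf.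
by rewrite distrC E normrM [`|p - q|]distrC ler_wpM2r// fC.
Qed.

Variables (w w1 w2 : R -> R) (M C1 C2 : R).
Hypothesis dw : forall x, is_derive x 1 w (w1 x).
Hypothesis dw1 : forall x, is_derive x 1 w1 (w2 x).
Hypothesis cw2 : continuous w2.
Hypothesis w1C : forall x, `|w1 x| <= C1.
Hypothesis w2C : forall x, `|w2 x| <= C2.
Hypothesis w0 : forall x, M <= `|x| -> w x = 0.
Hypothesis M0 : 0 <= M.

Let C10 : 0 <= C1. Proof. exact: le_trans (w1C 0). Qed.
Let C20 : 0 <= C2. Proof. exact: le_trans (w2C 0). Qed.

Lemma second_difference_le a h : 0 <= h ->
  `|w (a + h) - 2 * w a + w (a - h)| <= 2 * C2 * h ^+ 2.
Proof.
move=> h0; pose u t := w (a + t) + w (a - t).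
have du (t : R) : is_derive t 1 u (w1 (a + t) - w1 (a - t)).
  rewrite /u; apply: is_derive_eq.
  rewrite ?scaler1 /GRing.scale/=; ring.
have -> : w (a + h) - 2 * w a + w (a - h) = u h - u 0.
  by rewrite /u addr0 subr0; ring.
rewrite (_ : 2 * C2 * h ^+ 2 = 2 * C2 * h * `|h - 0|); last first.
  by rewrite subr0 ger0_norm//; ring.
apply: (mean_value_bound du) => t; rewrite (max_idPl h0) (min_idPr h0) => /andP[t0 th].
apply: (@le_trans _ _ (C2 * `|(a + t) - (a - t)|)).
  by apply: (mean_value_bound dw1) => x _; exact: w2C.
rewrite (_ : a + t - (a - t) = 2 * t); last by ring.
rewrite ger0_norm ?mulr_ge0// mulrA [C2 * 2]mulrC.
by rewrite ler_wpM2l// mulr_ge0.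
Qed.

(** Integration by parts: the integrand is the product of [w1] and of the
    derivative of [h * atan (w / h)], a function bounded by [h * pi / 2].  This
    is how the set where [w] is of size [h], on which its square roots can have
    corners, is seen to be small where [w1] is not. *)
Lemma integral_sublevel_le (L h : R) : M <= L -> 0 < L -> 0 < h ->
  Rintegral leb1 `[- L, L] (fun a => w1 a ^+ 2 / (1 + (w a / h) ^+ 2)) <=
  h * pi * C2 * (2 * L).
Proof.
move=> ML L0 h0; have h0' : h != 0 by rewrite gt_eqF.
pose F a := h * atan (w a / h) * w1 a.
pose E a := w1 a ^+ 2 / (1 + (w a / h) ^+ 2).
pose G a := h * atan (w a / h) * w2 a.
have D0 a : 0 < 1 + (w a / h) ^+ 2 by rewrite ltr_pwDl// sqr_ge0.
have dF a : is_derive a 1 F (E a + G a).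
  have dwh : is_derive a 1 (fun x => w x / h) (w1 a / h).
    apply: is_derive_eq; rewrite ?scaler0 ?addr0 /GRing.scale/=; ring.
  have dat : is_derive a 1 (fun x => atan (w x / h))
      ((1 + (w a / h) ^+ 2)^-1 * (w1 a / h)).
    exact: (@is_derive1_comp _ atan (fun x => w x / h)).
  rewrite /F; apply: is_derive_eq.
  rewrite /E /G /GRing.scale/=; move: ((1 + (w a / h) ^+ 2)^-1) => u; field.
  exact: h0'.
have cw : continuous w by exact: is_derive_continuous dw.
have cw1 : continuous w1 by exact: is_derive_continuous dw1.
have cwh : continuous (fun a => w a / h).
  by move=> a; apply: cvgM; [exact: cw|exact: cvg_cst].
have cE : continuous E.
  move=> a; apply: cvgM; first by apply: cvgM; exact: cw1.
  apply: cvgV; first by rewrite gt_eqF.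
  by apply: cvgD; [exact: cvg_cst|apply: cvgM; exact: cwh].
have cG : continuous G.
  move=> a; apply: cvgM; last exact: cw2.
  apply: cvgM; first exact: cvg_cst.
  apply: (@continuous_comp _ _ _ (fun a => w a / h) atan); first exact: cwh.
  exact: continuous_atan.
have cF : continuous F by exact: is_derive_continuous dF.
have LL : - L < L by lra.
have segi (f : R -> R) : continuous f -> leb1.-integrable `[- L, L] (EFin \o f).
  move=> cf; apply: continuous_compact_integrable; first exact: segment_compact.
  exact: continuous_subspaceT.
have EG : Rintegral leb1 `[- L, L] (fun a => E a + G a) = 0.
  rewrite /Rintegral (@continuous_FTC2 _ _ F)//.
  - rewrite /F !w0 ?normrN ?(gtr0_norm L0)//.
    by rewrite mul0r atan0 mulr0 !mul0r subee.
  - by apply: continuous_subspaceT => a; apply: cvgD; [exact: cE|exact: cG].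
  - split.
    + by move=> x _; case: (dF x).
    + by apply: cvg_at_right_filter; exact: cF.
    + by apply: cvg_at_left_filter; exact: cF.
  - by move=> x _; rewrite derive1E; case: (dF x).
have mI : measurable (`[- L, L] : set (measurableTypeR R)) by exact: measurable_itv.
have muI : leb1 `[- L, L]%classic = (2 * L)%:E.
  by rewrite /leb1/= lebesgue_measure_itv/= lte_fin LL -EFinB; congr (_%:E); ring.
have -> : Rintegral leb1 `[- L, L] (fun a => w1 a ^+ 2 / (1 + (w a / h) ^+ 2)) =
    - Rintegral leb1 `[- L, L] G.
  apply/eqP; rewrite -subr_eq0 opprK -RintegralD; [exact/eqP|exact: mI|exact: segi|exact: segi].
apply: (le_trans (ler_norm _)); rewrite normrN.
apply: (le_trans (le_normr_Rintegral mI (segi _ cG))).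
have -> : h * pi * C2 * (2 * L) = Rintegral leb1 `[- L, L] (fun=> h * pi * C2).
  by rewrite Rintegral_cst// muI.
apply: le_Rintegral => //.
- by apply: integrable_norm; exact: segi.
- by apply: segi => a; exact: cvg_cst.
- move=> a _; rewrite /G normrM ler_pM// normrM (gtr0_norm h0) ler_wpM2l ?(ltW h0)//.
  have := atan_ltpi2 (w a / h); have := atan_gtNpi2 (w a / h).
  by have := pi_gt0 R; rewrite ler_norml => ? ? ?; apply/andP; split; lra.
Qed.

Variable f : R -> R.
Hypothesis cf : continuous f.
Hypothesis fw : forall x, f x ^+ 2 = w x ^+ 2.

Let norm_fw x : `|f x| = `|w x|.
Proof. by apply/eqP; rewrite -(@eqrXn2 _ 2)// -!normrX fw. Qed.

(** By the intermediate value theorem [f * w], which equals [w ^+ 2] up to sign,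
    keeps its sign as long as it does not vanish. *)
Let sign_constant a h : 0 <= h ->
  (forall z, a - h <= z <= a + h -> w z != 0) ->
  exists2 s, s ^+ 2 = 1 & forall z, a - h <= z <= a + h -> f z = s * w z.
Proof.
move=> h0 wn0.
have a_in : a - h <= a <= a + h by apply/andP; split; lra.
have sw z : a - h <= z <= a + h -> f z = w z \/ f z = - w z.
  by move=> zah; have /eqP := fw z; rewrite eqf_sqr => /orP[]/eqP; [left|right].
pose u z := f z * w z.
have cu : continuous u.
  by move=> z; apply: cvgM; [exact: cf|exact: (is_derive_continuous dw)].
have un0 z : a - h <= z <= a + h -> u z != 0.
  move=> zah; rewrite mulf_neq0 ?wn0//.
  by rewrite -normr_eq0 norm_fw normr_eq0 wn0.
have same y z : a - h <= y <= a + h -> a - h <= z <= a + h -> u y < 0 -> u z < 0.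
  move=> yah zah uy; rewrite ltNge; apply/negP => uz.
  have /orP[yz|zy] := le_total y z.
    have [||c] := @IVT _ u y z 0 yz.
    - exact: continuous_subspaceT.
    - by rewrite ge_min (ltW uy) le_max uz orbT.
    rewrite in_itv/= => /andP[yc cz] uc; suff : u c != 0 by rewrite uc eqxx.
    by apply: un0; move: yah zah => /andP[? ?] /andP[? ?]; apply/andP; split; lra.
  have [||c] := @IVT _ u z y 0 zy.
  - exact: continuous_subspaceT.
  - by rewrite ge_min (ltW uy) le_max uz orbT.
  rewrite in_itv/= => /andP[yc cz] uc; suff : u c != 0 by rewrite uc eqxx.
  by apply: un0; move: yah zah => /andP[? ?] /andP[? ?]; apply/andP; split; lra.
have [fa|fa] := sw _ a_in.
  exists 1; first by rewrite expr1n.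
  move=> z zah; rewrite mul1r; case: (sw _ zah) => // fz; exfalso.
  have : u z < 0 by rewrite /u fz mulNr oppr_lt0 -expr2 exprn_even_gt0//= wn0.
  move=> /(same _ _ zah a_in); rewrite /u fa -expr2 ltNge sqr_ge0//.
exists (-1); first by rewrite sqrrN expr1n.
move=> z zah; rewrite mulN1r; case: (sw _ zah) => // fz; exfalso.
have : u a < 0 by rewrite /u fa mulNr oppr_lt0 -expr2 exprn_even_gt0//= wn0.
by move=> /(same _ _ a_in zah); rewrite /u fz -expr2 ltNge sqr_ge0.
Qed.

(** If [w] has no zero within distance [h] of [a], then [f] is there a constant
    sign times [w], and the second difference is of size [C2 * h ^+ 2].
    Otherwise every term of it is of size [h * (`|w1 a| + C2 * h)], and
    [`|w a| <= C1 * h], so that the denominator is bounded. *)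
Lemma sqrt_second_difference_le a h : 0 < h ->
  (f (a + h) - 2 * f a + f (a - h)) ^+ 2 <=
  128 * h ^+ 2 * (1 + C1 ^+ 2) * (w1 a ^+ 2 / (1 + (w a / h) ^+ 2)) +
  132 * C2 ^+ 2 * h ^+ 4.
Proof.
move=> h0; have h0' : h != 0 by rewrite gt_eqF.
have D0 : 0 < 1 + (w a / h) ^+ 2 by rewrite ltr_pwDl// sqr_ge0.
pose E := w1 a ^+ 2 / (1 + (w a / h) ^+ 2).
have E0 : 0 <= E by rewrite divr_ge0 ?sqr_ge0// ltW.
have h2 : 0 <= h ^+ 2 := sqr_ge0 h.
have h4 : 0 <= C2 ^+ 2 * h ^+ 4 by rewrite mulr_ge0 ?exprn_even_ge0.
have [[z zah wz]|nz] := pselect (exists2 z, a - h <= z <= a + h & w z = 0).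
  have wle p : a - h <= p <= a + h -> `|f p| <= 2 * h * (`|w1 a| + C2 * h).
    move=> pah; rewrite norm_fw -[w p]subr0 -wz.
    apply: (@le_trans _ _ ((`|w1 a| + C2 * h) * `|p - z|)).
      apply: (mean_value_bound dw) => x xpz.
      rewrite -[w1 x](subrK (w1 a)) addrC (le_trans (ler_normD _ _))// lerD2l.
      apply: (@le_trans _ _ (C2 * `|x - a|)).
        by apply: (mean_value_bound dw1) => t _; exact: w2C.
      rewrite ler_wpM2l// ler_norml; apply/andP.
      move: xpz pah zah; rewrite ge_min le_max => /andP[/orP H1 /orP H2].
      move=> /andP[? ?] /andP[? ?].
      by split; case: H1; case: H2; lra.
    rewrite mulrC ler_wpM2r//.
      by rewrite addr_ge0// mulr_ge0// ltW.
    rewrite ler_norml; move: pah zah => /andP[? ?] /andP[? ?].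
    by apply/andP; split; lra.
  have wa : `|w a| <= C1 * h.
    rewrite -[w a]subr0 -wz.
    apply: (@le_trans _ _ (C1 * `|a - z|)).
      by apply: (mean_value_bound dw) => t _; exact: w1C.
    rewrite ler_wpM2l// ler_norml; move: zah => /andP[? ?].
    by apply/andP; split; lra.
  have fD : `|f (a + h) - 2 * f a + f (a - h)| <= 8 * h * (`|w1 a| + C2 * h).
    rewrite (le_trans (ler_normD _ _))//.
    have := ler_normB (f (a + h)) (2 * f a); rewrite normrM (ger0_norm (ler0n _ 2)).
    have := wle (a + h); have := wle a; have := wle (a - h).
    move=> /(_ _)/wrap[|H1]; first by apply/andP; split; lra.
    move=> /(_ _)/wrap[|H2]; first by apply/andP; split; lra.
    move=> /(_ _)/wrap[|H3]; first by apply/andP; split; lra.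
    lra.
  have K0 : 0 <= 8 * h * (`|w1 a| + C2 * h) by exact: le_trans fD.
  have : (f (a + h) - 2 * f a + f (a - h)) ^+ 2 <= (8 * h * (`|w1 a| + C2 * h)) ^+ 2.
    by rewrite -[leLHS]real_normK ?num_real// lerXn2r// nnegrE.
  move/le_trans; apply.
  have w1E : w1 a ^+ 2 <= (1 + C1 ^+ 2) * E.
    rewrite /E mulrA ler_pdivlMr// mulrC ler_wpM2r ?sqr_ge0// lerD2l.
    rewrite -[leLHS]real_normK ?num_real// lerXn2r ?nnegrE//.
    by rewrite normrM normfV (gtr0_norm h0) ler_pdivrMr.
  rewrite exprMn.
  have -> : (8 * h) ^+ 2 = 64 * h ^+ 2 by ring.
  have sq : (`|w1 a| + C2 * h) ^+ 2 <= 2 * (w1 a ^+ 2 + C2 ^+ 2 * h ^+ 2).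
    have := sqr_ge0 (`|w1 a| - C2 * h).
    have := real_normK (num_real (w1 a)).
    by move: `|w1 a| => t ?; nra.
  apply: (@le_trans _ _ (64 * h ^+ 2 * (2 * ((1 + C1 ^+ 2) * E + C2 ^+ 2 * h ^+ 2)))).
    have h64 : 0 <= 64 * h ^+ 2 by rewrite mulr_ge0.
    apply: (ler_wpM2l h64); apply: (le_trans sq).
    by rewrite ler_wpM2l// lerD2r.
  rewrite -/E -subr_ge0 [leRHS](_ : _ = 4 * (C2 ^+ 2 * h ^+ 4)); last by ring.
  by rewrite mulr_ge0.
have wn0 z : a - h <= z <= a + h -> w z != 0.
  by move=> zah; apply/eqP => wz; apply: nz; exists z.
have [s s2 fs] := sign_constant (ltW h0) wn0.
rewrite !fs; try by apply/andP; split; lra.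
rewrite [leLHS](_ : _ = (w (a + h) - 2 * w a + w (a - h)) ^+ 2); last first.
  rewrite (_ : _ + _ = s * (w (a + h) - 2 * w a + w (a - h))); last by ring.
  by rewrite exprMn s2 mul1r.
apply: (@le_trans _ _ ((2 * C2 * h ^+ 2) ^+ 2)).
  rewrite -[leLHS]real_normK ?num_real// lerXn2r ?nnegrE//.
    exact: (mulr_ge0 (mulr_ge0 _ C20) h2).
  by apply: second_difference_le; exact: ltW.
rewrite -/E -subr_ge0.
rewrite [leRHS](_ : _ = 128 * h ^+ 2 * (1 + C1 ^+ 2) * E + 128 * (C2 ^+ 2 * h ^+ 4)); last by ring.
have C12 : 0 <= 1 + C1 ^+ 2 by rewrite addr_ge0// sqr_ge0.
rewrite addr_ge0//; last exact: mulr_ge0.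
exact: (mulr_ge0 (mulr_ge0 (mulr_ge0 _ h2) C12) E0).
Qed.

Definition second_difference_const : R :=
  (128 * (1 + C1 ^+ 2) * (pi * C2) + 132 * C2 ^+ 2) * (2 * (M + 1)).

(** The first term of [sqrt_second_difference_le] contributes [h ^+ 2] times the
    integral bounded in [integral_sublevel_le], which is of size [h].  The
    exponent 3 is optimal: it is already that of a single corner. *)
Lemma integral_sqr_second_difference h : 0 < h -> h <= 1 ->
  leb1.-integrable setT
    (EFin \o (fun a => (f (a + h) - 2 * f a + f (a - h)) ^+ 2)) /\
  Rintegral leb1 setT (fun a => (f (a + h) - 2 * f a + f (a - h)) ^+ 2) <=
  second_difference_const * h ^+ 3.
Proof.
move=> h0 h1; pose L := M + 1; have L0 : 0 < L by rewrite /L ltr_wpDl.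
pose D a := (f (a + h) - 2 * f a + f (a - h)) ^+ 2.
have f0 x : M <= `|x| -> f x = 0.
  by move=> /w0 wx; apply/eqP; rewrite -normr_eq0 norm_fw wx normr0.
have D0 a : a \notin `[- L, L] -> D a = 0.
  rewrite in_itv/= -ler_norml -ltNge /L => aL.
  have aM x : `|x - a| <= h -> f x = 0.
    move=> xa; apply: f0.
    have := ler_distD x a 0; rewrite !subr0 distrC.
    move: `|a| `|x| `|x - a| xa aL => ? ? ?; lra.
  rewrite /D !aM ?mulr0 ?subr0 ?addr0 ?expr0n//.
  - by rewrite addrAC subrr sub0r normrN gtr0_norm.
  - by rewrite subrr normr0 ltW.
  - by rewrite addrAC subrr add0r gtr0_norm.
have cD : continuous D.
  have cc : continuous (fun a => f (a + h) - 2 * f a + f (a - h)).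
    move=> a; apply: cvgD.
      apply: cvgB; last by apply: cvgM; [exact: cvg_cst|exact: cf].
      apply: (@continuous_comp _ _ _ (fun a => a + h) f); last exact: cf.
      by apply: cvgD; [exact: cvg_id|exact: cvg_cst].
    apply: (@continuous_comp _ _ _ (fun a => a - h) f); last exact: cf.
    by apply: cvgB; [exact: cvg_id|exact: cvg_cst].
  by move=> a; apply: cvgM; exact: cc.
have mI : measurable (`[- L, L] : set (measurableTypeR R)) by exact: measurable_itv.
have LL : - L < L by lra.
have muI : leb1 `[- L, L]%classic = (2 * L)%:E.
  by rewrite /leb1/= lebesgue_measure_itv/= lte_fin LL -EFinB; congr (_%:E); ring.
have segi (g : R -> R) : continuous g -> leb1.-integrable `[- L, L] (EFin \o g).
  move=> cg; apply: continuous_compact_integrable; first exact: segment_compact.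
  exact: continuous_subspaceT.
have DE : D \_ `[- L, L] = D.
  apply/funext => a; rewrite patchE; case: ifPn => // aL.
  by rewrite D0//; apply/negP => aL'; move/negP : aL; apply; rewrite inE.
split.
  have := segi _ cD; rewrite (integrable_mkcond _ mI).
  by rewrite restrict_EFin DE.
rewrite -[X in Rintegral _ _ X]/D -DE -Rintegral_mkcond.
pose E a := w1 a ^+ 2 / (1 + (w a / h) ^+ 2).
have cw : continuous w by exact: is_derive_continuous dw.
have cw1 : continuous w1 by exact: is_derive_continuous dw1.
have cwh : continuous (fun a => w a / h).
  by move=> a; apply: cvgM; [exact: cw|exact: cvg_cst].
have cE : continuous E.
  move=> a; apply: cvgM; first by apply: cvgM; exact: cw1.
  apply: cvgV; first by rewrite gt_eqF// ltr_pwDl// sqr_ge0.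
  by apply: cvgD; [exact: cvg_cst|apply: cvgM; exact: cwh].
have i1 : leb1.-integrable `[- L, L]
    (EFin \o (fun a => 128 * h ^+ 2 * (1 + C1 ^+ 2) * E a)).
  by apply: segi => a; apply: cvgM; [exact: cvg_cst|exact: cE].
have i2 : leb1.-integrable `[- L, L] (EFin \o (fun=> 132 * C2 ^+ 2 * h ^+ 4)).
  by apply: segi => a; exact: cvg_cst.
apply: (@le_trans _ _ (Rintegral leb1 `[- L, L] (fun a =>
    128 * h ^+ 2 * (1 + C1 ^+ 2) * E a + 132 * C2 ^+ 2 * h ^+ 4))).
  apply: le_Rintegral => //; first exact: segi.
    by apply: segi => a; apply: cvgD; [apply: cvgM; [exact: cvg_cst|exact: cE]|exact: cvg_cst].
  by move=> a _; exact: sqrt_second_difference_le.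
rewrite RintegralD// Rintegral_cst// muI RintegralZl//; last exact: segi.
have ML : M <= L by rewrite /L lerDl.
have IE := integral_sublevel_le ML L0 h0.
have K0 : 0 <= 128 * h ^+ 2 * (1 + C1 ^+ 2).
  by rewrite mulr_ge0 ?addr_ge0 ?sqr_ge0// mulr_ge0 ?sqr_ge0.
apply: (le_trans (lerD (ler_wpM2l K0 IE) (lexx _))).
rewrite /second_difference_const -/L [fine _]/=.
rewrite -subr_ge0 [leRHS](_ : _ = 132 * C2 ^+ 2 * (2 * L) * h ^+ 3 * (1 - h)); last by ring.
rewrite mulr_ge0 ?subr_ge0// mulr_ge0 ?exprn_ge0 ?(ltW h0)// mulr_ge0//.
- by rewrite mulr_ge0 ?sqr_ge0.
- by rewrite mulr_ge0 ?(ltW L0).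
Qed.

End SecondDifference.

(** * Integrability and decay of transforms *)

Section SupportedTransforms.
Variable R : realType.
Local Notation plane := (measurableTypeR R * measurableTypeR R)%type.
Local Notation leb1 := (leb1 R).
Local Notation leb2 := (leb2 R).
Local Notation integrable1 f := (leb1.-integrable setT (EFin \o f)).
Local Notation integrable2 f := (leb2.-integrable setT (EFin \o f)).
Implicit Types (g : R * R -> R) (L B : R) (x v : R * R).

Definition box_indic L x : R := \1_(`[- L, L] : set R) x.1 * \1_(`[- L, L] : set R) x.2.

Lemma box_indicE L x : box_indic L x = ((`|x.1| <= L) && (`|x.2| <= L))%:R.
Proof.
rewrite /box_indic !indicE -natrM mulnb; congr (nat_of_bool _)%:R.
by congr andb; apply/idP/idP; rewrite inE/= in_itv/= -ler_norml.
Qed.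

Lemma box_indic_ge0 L x : 0 <= box_indic L x.
Proof. by rewrite box_indicE ler0n. Qed.

Lemma integrable_itv_indic L : integrable1 (\1_(`[- L, L] : set R)).
Proof. exact: integrable_indic_itv. Qed.

Lemma Rintegral_itv_indic L : 0 <= L ->
  Rintegral leb1 setT (\1_(`[- L, L] : set R)) = 2 * L.
Proof.
move=> L0; rewrite /Rintegral integral_indic//.
rewrite setIT /leb1/= lebesgue_measure_itv/= lte_fin.
case: ltP => LL; first by rewrite -EFinB/=; ring.
by rewrite /=; lra.
Qed.

Lemma integrable_box_indic L : integrable2 (box_indic L).
Proof. by apply: integrable_plane_tensor; exact: integrable_itv_indic. Qed.

Lemma Rintegral_box_indic L : 0 <= L ->
  Rintegral leb2 setT (box_indic L) = (2 * L) ^+ 2.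
Proof.
move=> L0; rewrite Rintegral_plane_tensor; try exact: integrable_itv_indic.
by rewrite Rintegral_itv_indic// expr2.
Qed.

Definition supported L g := forall x, (L <= `|x.1|) || (L <= `|x.2|) -> g x = 0.

Lemma supported_le L g B x : supported L g -> (forall x, `|g x| <= B) ->
  `|g x| <= B * box_indic L x.
Proof.
move=> gL gB; rewrite box_indicE.
have [_|] := boolP ((`|x.1| <= L) && (`|x.2| <= L)); first by rewrite mulr1.
rewrite negb_and -!ltNge mulr0 => xL; have -> : g x = 0; last by rewrite normr0.
by apply: gL; apply/orP; move: xL => /orP[/ltW ?|/ltW ?]; [left|right].
Qed.

Lemma supported_integrable L g B : measurable_fun [set: plane] g ->
  supported L g -> (forall x, `|g x| <= B) -> integrable2 g.
Proof.
move=> mg gL gB.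
apply: (integrable_dominated mg (fun x => supported_le x gL gB)).
by apply: RintegrableZl; exact: integrable_box_indic.
Qed.

Lemma supported_Rintegral_le L g B : 0 <= L -> measurable_fun [set: plane] g ->
  supported L g -> (forall x, `|g x| <= B) ->
  Rintegral leb2 setT (fun x : plane => `|g x|) <= B * (2 * L) ^+ 2.
Proof.
move=> L0 mg gL gB; rewrite -Rintegral_box_indic// -RintegralZl//; last exact: integrable_box_indic.
apply: le_Rintegral => //.
- by apply: integrable_norm; exact: (supported_integrable mg gL gB).
- by apply: RintegrableZl; exact: integrable_box_indic.
- by move=> x _; exact: supported_le.
Qed.

Lemma norm_cosB_le (a b : R) : `|cos a - cos b| <= `|a - b|.
Proof.
rewrite -[leRHS]mul1r; apply: (mean_value_bound (@is_derive_cos R)) => x _.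
by rewrite normrN sin_max.
Qed.

Lemma norm_sinB_le (a b : R) : `|sin a - sin b| <= `|a - b|.
Proof.
rewrite -[leRHS]mul1r; apply: (mean_value_bound (@is_derive_sin R)) => x _.
exact: cos_max.
Qed.

Lemma norm_dotB_le L x y (xi : R * R) : `|xi.1| <= L -> `|xi.2| <= L ->
  `|dot x xi - dot y xi| <= L * (`|x.1 - y.1| + `|x.2 - y.2|).
Proof.
move=> x1 x2; rewrite (_ : _ - _ = (x.1 - y.1) * xi.1 + (x.2 - y.2) * xi.2); last first.
  by rewrite /dot; ring.
rewrite (le_trans (ler_normD _ _))// mulrDr lerD// normrM mulrC ler_wpM2r//.
Qed.

Section Lipschitz.
Variables (g : R * R -> R) (L : R).
Hypotheses (gi : integrable2 g) (gL : supported L g).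

Let lipschitz_kernel (k : R -> R) (x y : R * R) :
  (forall a b, `|k a - k b| <= `|a - b|) ->
  measurable_fun [set: R] k -> (forall a, `|k a| <= 1) ->
  `|Rintegral leb2 setT (fun xi : plane => g xi * k (dot x xi)) -
    Rintegral leb2 setT (fun xi : plane => g xi * k (dot y xi))| <=
  L * Rintegral leb2 setT (fun xi : plane => `|g xi|) *
    (`|x.1 - y.1| + `|x.2 - y.2|).
Proof.
move=> kl mk k1.
have ki z : integrable2 (fun xi : plane => g xi * k (dot z xi)).
  apply: (integrableM_bounded gi _ (fun xi => k1 (dot z xi))).
  apply: (measurableT_comp mk).
  by apply: measurable_funD; apply: measurable_funM.
rewrite -RintegralB//.
apply: (le_trans (le_normr_Rintegral measurableT (RintegrableB (ki x) (ki y)))).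
rewrite mulrAC -RintegralZl//; last exact: integrable_norm gi.
apply: le_Rintegral => //.
- by apply: integrable_norm; exact: RintegrableB.
- by apply: RintegrableZl; exact: integrable_norm gi.
move=> xi _; rewrite -mulrBr normrM mulrC.
have [/orP xiL|] := boolP ((L <= `|xi.1|) || (L <= `|xi.2|)).
  by rewrite gL ?normr0 ?mulr0//; apply/orP.
rewrite negb_or -!ltNge => /andP[/ltW x1 /ltW x2].
by rewrite ler_wpM2r// (le_trans (kl _ _))// norm_dotB_le.
Qed.

Lemma cos_transform_lipschitz x y : `|cos_transform g x - cos_transform g y| <=
  L * Rintegral leb2 setT (fun xi : plane => `|g xi|) *
    (`|x.1 - y.1| + `|x.2 - y.2|).
Proof.
apply: lipschitz_kernel; [exact: norm_cosB_le|exact: measurable_cosR|].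
exact: cos_max.
Qed.

Lemma sin_transform_lipschitz x y : `|sin_transform g x - sin_transform g y| <=
  L * Rintegral leb2 setT (fun xi : plane => `|g xi|) *
    (`|x.1 - y.1| + `|x.2 - y.2|).
Proof.
apply: lipschitz_kernel; [exact: norm_sinB_le|exact: measurable_sinR|].
exact: sin_max.
Qed.

Lemma lipschitz_continuous_plane (f : R * R -> R) (K : R) :
  (forall x y, `|f x - f y| <= K * (`|x.1 - y.1| + `|x.2 - y.2|)) -> continuous f.
Proof.
move=> fK x; apply/cvgrPdist_le => eps eps0.
have K0 : 0 < `|K| + 1 by rewrite ltr_wpDl.
pose d := eps / (2 * (`|K| + 1)).
have d0 : 0 < d by rewrite divr_gt0// mulr_gt0.
exists (ball x.1 d, ball x.2 d); first by split; exact: nbhsx_ballx.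
move=> y [] /=; rewrite /ball/= => /ltW y1 /ltW y2.
apply: (le_trans (fK _ _)).
have S0 : 0 <= `|x.1 - y.1| + `|x.2 - y.2| by rewrite addr_ge0.
apply: (@le_trans _ _ ((`|K| + 1) * (`|x.1 - y.1| + `|x.2 - y.2|))).
  by rewrite ler_wpM2r// (le_trans (ler_norm _))// lerDl.
apply: (@le_trans _ _ ((`|K| + 1) * (d + d))).
  by rewrite ler_wpM2l ?(ltW K0)// lerD.
rewrite /d le_eqVlt; apply/orP; left; apply/eqP; field.
by rewrite gt_eqF.
Qed.

Lemma continuous_cos_transform : continuous (cos_transform g).
Proof. exact: lipschitz_continuous_plane cos_transform_lipschitz. Qed.

Lemma continuous_sin_transform : continuous (sin_transform g).
Proof. exact: lipschitz_continuous_plane sin_transform_lipschitz. Qed.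

End Lipschitz.

Definition diff2 v g x : R := g (x + v) - 2 * g x + g (x - v).

Lemma continuous_shift_plane g v : continuous g -> continuous (fun x => g (x + v)).
Proof.
move=> cg x; apply: (@continuous_comp _ _ _ (fun x : R * R => x + v) g); last exact: cg.
by apply: cvgD; [exact: cvg_id|exact: cvg_cst].
Qed.

Lemma continuous_diff2 g v : continuous g -> continuous (diff2 v g).
Proof.
move=> cg x; apply: cvgD; last exact: continuous_shift_plane.
apply: cvgB; first exact: continuous_shift_plane.
by apply: cvgM; [exact: cvg_cst|exact: cg].
Qed.

Lemma supported_diff2 L H v g : supported L g -> `|v.1| <= H -> `|v.2| <= H ->
  supported (L + H) (diff2 v g).
Proof.
move=> gL v1 v2 x xL.
have far (a b : R) : `|b| <= H -> L + H <= `|a| -> L <= `|a + b|.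
  move=> bH aL; have := ler_normB (a + b) b; rewrite addrK => ?; lra.
have H0 : 0 <= H by exact: le_trans v1.
have near0 (u : R * R) : `|u.1| <= H -> `|u.2| <= H -> g (x + u) = 0.
  move=> u1 u2; apply: gL; apply/orP; move: xL => /orP[xL|xL]; [left|right];
  exact: far.
rewrite /diff2 !near0 ?normrN//; rewrite -[x]addr0 near0/= ?normr0//; ring.
Qed.

Lemma norm_diff2_le B v g x : (forall x, `|g x| <= B) -> `|diff2 v g x| <= 4 * B.
Proof.
move=> gB; rewrite /diff2 (le_trans (ler_normD _ _))//.
have := ler_normB (g (x + v)) (2 * g x); rewrite normrM (ger0_norm (ler0n _ 2)).
have := gB (x + v); have := gB x; have := gB (x - v); lra.
Qed.

Section ShiftTransform.
Variables (g : R * R -> R).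
Hypothesis gi : integrable2 g.

Let shifti v : integrable2 (fun xi => g (xi + v)).
Proof. exact: (integrable_measure_preserving (measure_preserving_shift2 v) gi). Qed.

Lemma dot_add x (xi eta : R * R) : dot x (xi + eta) = dot x xi + dot x eta.
Proof. by rewrite /dot/=; ring. Qed.

Lemma cos_transform_shift v x : cos_transform (fun xi => g (xi + v)) x =
  cos (dot x v) * cos_transform g x + sin (dot x v) * sin_transform g x.
Proof.
have ci := integrable_cos_dot x gi; have si := integrable_sin_dot x gi.
have csi : integrable2 (fun xi => cos (dot x v) * (g xi * cos (dot x xi)) +
    sin (dot x v) * (g xi * sin (dot x xi))).
  by apply: RintegrableD; exact: RintegrableZl.
transitivity (Rintegral leb2 setT (fun xi : plane =>
    cos (dot x v) * (g xi * cos (dot x xi)) +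
    sin (dot x v) * (g xi * sin (dot x xi)))).
  rewrite -(Rintegral_measure_preserving (measure_preserving_shift2 v) csi).
  apply: eq_Rintegral => xi _ /=.
  have -> : dot x xi = dot x (xi + v) - dot x v by rewrite dot_add addrK.
  by rewrite cosB; ring.
rewrite RintegralD//; try exact: RintegrableZl.
by rewrite RintegralZl// RintegralZl.
Qed.

Lemma sin_transform_shift v x : sin_transform (fun xi => g (xi + v)) x =
  cos (dot x v) * sin_transform g x - sin (dot x v) * cos_transform g x.
Proof.
have ci := integrable_cos_dot x gi; have si := integrable_sin_dot x gi.
have csi : integrable2 (fun xi => cos (dot x v) * (g xi * sin (dot x xi)) -
    sin (dot x v) * (g xi * cos (dot x xi))).
  by apply: RintegrableB; exact: RintegrableZl.
transitivity (Rintegral leb2 setT (fun xi : plane =>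
    cos (dot x v) * (g xi * sin (dot x xi)) -
    sin (dot x v) * (g xi * cos (dot x xi)))).
  rewrite -(Rintegral_measure_preserving (measure_preserving_shift2 v) csi).
  apply: eq_Rintegral => xi _ /=.
  have -> : dot x xi = dot x (xi + v) - dot x v by rewrite dot_add addrK.
  by rewrite sinB; ring.
rewrite RintegralB//; try exact: RintegrableZl.
by rewrite RintegralZl// RintegralZl.
Qed.

Lemma dotN x v : dot x (- v) = - dot x v.
Proof. by rewrite /dot/=; ring. Qed.

(** A translation of [g] rotates the pair of its transforms, and the two opposite
    translations do so by opposite angles, so that the sine terms cancel. *)
Lemma cos_transform_diff2 v x :
  cos_transform (diff2 v g) x = (2 * cos (dot x v) - 2) * cos_transform g x.
Proof.
have i1 := integrable_cos_dot x (shifti v).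
have i2 := integrable_cos_dot x (shifti (- v)).
have i0 := RintegrableZl 2 (integrable_cos_dot x gi).
have := cos_transform_shift v x; have := cos_transform_shift (- v) x.
rewrite dotN cosN sinN => E2 E1.
transitivity (cos_transform (fun xi => g (xi + v)) x - 2 * cos_transform g x
   + cos_transform (fun xi => g (xi - v)) x); last by rewrite E1 E2; ring.
rewrite /cos_transform -RintegralZl//; last exact: integrable_cos_dot.
rewrite -RintegralB// -RintegralD//; last exact: RintegrableB.
by apply: eq_Rintegral => xi _; rewrite /diff2; ring.
Qed.

Lemma sin_transform_diff2 v x :
  sin_transform (diff2 v g) x = (2 * cos (dot x v) - 2) * sin_transform g x.
Proof.
have i1 := integrable_sin_dot x (shifti v).
have i2 := integrable_sin_dot x (shifti (- v)).
have i0 := RintegrableZl 2 (integrable_sin_dot x gi).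
have := sin_transform_shift v x; have := sin_transform_shift (- v) x.
rewrite dotN cosN sinN => E2 E1.
transitivity (sin_transform (fun xi => g (xi + v)) x - 2 * sin_transform g x
   + sin_transform (fun xi => g (xi - v)) x); last by rewrite E1 E2; ring.
rewrite /sin_transform -RintegralZl//; last exact: integrable_sin_dot.
rewrite -RintegralB// -RintegralD//; last exact: RintegrableB.
by apply: eq_Rintegral => xi _; rewrite /diff2; ring.
Qed.

End ShiftTransform.

End SupportedTransforms.

Section SumOfMajorants.
Context d (T : measurableType d) (R : realType).
Variable mu : {measure set T -> \bar R}.

(** At each point one of the majorants is enough, hence so is their sum, whose
    integral is at most the sum of a geometric series. *)
Lemma integrable_majorants (F : T -> R) (G : nat -> T -> R) (A : R) :
  measurable_fun setT F ->
  (forall m, mu.-integrable setT (EFin \o G m)) ->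
  (forall m x, 0 <= G m x) ->
  (forall m, Rintegral mu setT (G m) <= A / (2 ^ m.+1)%:R) ->
  (forall x, exists m, `|F x| <= G m x) ->
  mu.-integrable setT (EFin \o F).
Proof.
move=> mF Gi G0 GA FG.
have A0 : 0 <= A.
  have : 0 <= Rintegral mu setT (G 0%N) by apply: Rintegral_ge0.
  move=> /le_trans/(_ (GA 0%N)).
  by rewrite pmulr_lge0// invr_gt0 ltr0n expn_gt0.
apply/integrableP; split; first exact/measurable_EFinP.
apply: (@le_lt_trans _ _ A%:E); last by rewrite ltry.
have mG m : measurable_fun setT (EFin \o G m) := measurable_int _ (Gi m).
apply: (@le_trans _ _ (\int[mu]_x \sum_(m <oo) (G m x)%:E)%E).
  apply: ge0_le_integral => //.
  - by apply/measurable_EFinP; exact: measurableT_comp.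
  - apply: (@ge0_emeasurable_sum _ _ _ setT (fun m x => (G m x)%:E) xpredT).
      by move=> k x _ _; rewrite lee_fin.
    by move=> k _; exact: mG.
  - move=> x _; have [m FGm] := FG x.
    rewrite (@nneseriesD1 _ _ m)//; last by move=> k _; rewrite lee_fin.
    rewrite -[leLHS]adde0; apply: leeD; first by rewrite lee_fin.
    by apply: nneseries_ge0 => k _ _; rewrite lee_fin.
rewrite integral_nneseries//; last by move=> m x _; rewrite lee_fin.
apply: le_trans (epsilon_trick0 xpredT A0); apply: lee_nneseries.
  by move=> m _ _; apply: integral_ge0 => x _; rewrite lee_fin.
by move=> m _; rewrite -Rintegral_EFin// lee_fin.
Qed.

End SumOfMajorants.

Section SmoothTransforms.
Variable R : realType.
Local Notation plane := (measurableTypeR R * measurableTypeR R)%type.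
Local Notation leb1 := (leb1 R).
Local Notation leb2 := (leb2 R).
Local Notation integrable1 f := (leb1.-integrable setT (EFin \o f)).
Local Notation integrable2 f := (leb2.-integrable setT (EFin \o f)).
Implicit Types (g w : R * R -> R) (M : R).

Definition C2_line (M C1 C2 : R) (w : R -> R) : Prop :=
  exists w1 w2 : R -> R,
  [/\ forall x : R, is_derive x 1 w (w1 x),
      forall x : R, is_derive x 1 w1 (w2 x),
      continuous w2,
      (forall x, `|w1 x| <= C1) /\ (forall x, `|w2 x| <= C2) &
      forall x, M <= `|x| -> w x = 0].

Lemma diff2_fst h g a b :
  diff2 (h, 0) g (a, b) = g (a + h, b) - 2 * g (a, b) + g (a - h, b).
Proof.
by rewrite /diff2; congr (g _ - _ + g _); congr pair; rewrite /= ?oppr0 addr0.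
Qed.

Lemma diff2_snd h g a b :
  diff2 (0, h) g (a, b) = g (a, b + h) - 2 * g (a, b) + g (a, b - h).
Proof.
by rewrite /diff2; congr (g _ - _ + g _); congr pair; rewrite /= ?oppr0 addr0.
Qed.

(** Second differences parallel to the axes only see the pure second
    derivatives, whence a condition on the restrictions to these lines. *)
Definition C2_plane (M C1 C2 : R) w : Prop :=
  (forall b, C2_line M C1 C2 (fun a => w (a, b))) /\
  (forall a, C2_line M C1 C2 (fun b => w (a, b))).

Lemma C2_plane_supported M C1 C2 w : C2_plane M C1 C2 w -> supported M w.
Proof.
move=> [h1 h2] -[a b] /orP[aM|bM].
  by have [w1 [w2 [_ _ _ _]]] := h1 b; apply.
by have [w1 [w2 [_ _ _ _]]] := h2 a; apply.
Qed.

Lemma C2_plane_bounded M C1 C2 w : 0 <= M -> C2_plane M C1 C2 w ->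
  forall x, `|w x| <= C1 * (2 * M).
Proof.
move=> M0 cw [a b].
have C10 : 0 <= C1.
  by have [w1 [w2 [_ _ _ [w1C _] _]]] := cw.1 b; exact: le_trans (w1C 0).
have [aM|aM] := leP M `|a|.
  by rewrite (C2_plane_supported cw) ?aM// normr0 !mulr_ge0.
have [w1 [w2 [dw _ _ [w1C _] w0]]] := cw.1 b.
rewrite -[w (a, b)]subr0 -(w0 M); last by rewrite ger0_norm.
apply: (le_trans (mean_value_bound (C := C1) dw _)); first by move=> x _.
rewrite ler_wpM2l// (le_trans (ler_normB _ _))// (ger0_norm M0).
by move: aM; lra.
Qed.

Lemma sqr_eq_norm g w x : g x ^+ 2 = w x ^+ 2 -> `|g x| = `|w x|.
Proof. by move=> gw; apply/eqP; rewrite -(@eqrXn2 _ 2)// -!normrX gw. Qed.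

Lemma continuous_pairl (b : R) : continuous (fun a : R => (a, b)).
Proof.
move=> a; exact: (@cvg_pair _ _ _ (nbhs a) (nbhs a) (nbhs b) _ _ _ idfun
  (cst b) cvg_id (cvg_cst b)).
Qed.

Lemma continuous_pairr (a : R) : continuous (fun b : R => (a, b)).
Proof.
move=> b; exact: (@cvg_pair _ _ _ (nbhs b) (nbhs a) (nbhs b) _ _ _ (cst a)
  idfun (cvg_cst a) cvg_id).
Qed.

Section SquareRoot.
Variables (g w : R * R -> R) (M C1 C2 : R).
Hypotheses (M0 : 0 <= M) (cw : C2_plane M C1 C2 w) (cg : continuous g).
Hypothesis gw : forall x, g x ^+ 2 = w x ^+ 2.

Lemma sqrt_supported : supported M g.
Proof.
move=> x xM; apply/eqP; rewrite -normr_eq0 (sqr_eq_norm (gw x)).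
by rewrite (C2_plane_supported cw xM) normr0.
Qed.

Lemma sqrt_bounded x : `|g x| <= C1 * (2 * M).
Proof. by rewrite (sqr_eq_norm (gw x)); exact: C2_plane_bounded cw x. Qed.

Let gi : integrable2 g.
Proof.
exact: supported_integrable (continuous_measurable_plane cg) sqrt_supported sqrt_bounded.
Qed.

Let diff2_sqr_integrable v : `|v.1| <= 1 -> `|v.2| <= 1 ->
  integrable2 (diff2 v g) /\ integrable2 (fun x => diff2 v g x ^+ 2).
Proof.
move=> v1 v2.
have mD := continuous_measurable_plane (continuous_diff2 (v := v) cg).
have sD := supported_diff2 sqrt_supported v1 v2.
have bD x := norm_diff2_le v x sqrt_bounded.
split; first exact: supported_integrable mD sD bD.
apply: (@supported_integrable _ (M + 1) _ ((4 * (C1 * (2 * M))) ^+ 2)).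
- exact: measurable_funX.
- by move=> x xM; rewrite sD// expr0n.
- by move=> x; rewrite normrX lerXn2r ?nnegrE// (le_trans _ (bD x)).
Qed.

Definition square_root_const : R :=
  second_difference_const M C1 C2 * (2 * M).

Let leb1s : {sigma_finite_measure set (measurableTypeR R) -> \bar R} :=
  @lebesgue_measure R.

Let line_bound (F : R -> R) K : integrable1 F ->
  (forall b, F b <= K) -> (forall b, M <= `|b| -> F b = 0) ->
  Rintegral leb1 setT F <= K * (2 * M).
Proof.
move=> Fi FK F0.
have Ii : integrable1 (\1_(`[- M, M] : set R)) by exact: integrable_itv_indic.
rewrite -Rintegral_itv_indic// -RintegralZl//.
apply: le_Rintegral => //; first exact: RintegrableZl.
move=> b _ /=.
have [bM|bM] := boolP (b \in (`[- M, M]%classic : set R)); first by rewrite mulr1.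
rewrite mulr0 F0//; move: bM; rewrite notin_setE/= in_itv/= -ler_norml => /negP.
by rewrite -ltNge => /ltW.
Qed.

Let diff2_sqr1 h : 0 < h -> h <= 1 ->
  Rintegral leb2 setT (fun x : plane => diff2 (h, 0) g x ^+ 2) <=
  square_root_const * h ^+ 3.
Proof.
move=> h0 h1.
have [_ D2i] : integrable2 (diff2 (h, 0) g) /\
    integrable2 (fun x => diff2 (h, 0) g x ^+ 2).
  by apply: diff2_sqr_integrable; rewrite /= ?normr0// gtr0_norm.
have line b : leb1.-integrable setT
    (EFin \o (fun a => diff2 (h, 0) g (a, b) ^+ 2)) /\
  Rintegral leb1 setT (fun a => diff2 (h, 0) g (a, b) ^+ 2) <=
  second_difference_const M C1 C2 * h ^+ 3.
  have [w1 [w2 [dw dw1 cw2 [w1C w2C] w0]]] := cw.1 b.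
  have cgb : continuous (fun a => g (a, b)).
    move=> a; apply: (@continuous_comp _ _ _ (fun a => (a, b)) g); last exact: cg.
    exact: continuous_pairl.
  have [] := integral_sqr_second_difference dw dw1 cw2 w1C w2C w0 M0 cgb
    (fun a => gw (a, b)) h0 h1.
  have E : (fun a => (g (a + h, b) - 2 * g (a, b) + g (a - h, b)) ^+ 2) =
      (fun a => diff2 (h, 0) g (a, b) ^+ 2).
    by apply/funext => a; rewrite diff2_fst.
  by rewrite E.
rewrite -(@Rfubini_sym _ _ _ _ _ leb1s leb1s _ D2i); last by move=> b; exact: (line b).1.
rewrite /square_root_const mulrAC; apply: line_bound.
- apply: (@ge0_integrable_Rfubini_sym _ _ _ _ _ leb1s leb1s _ _ D2i).
    by move=> z; exact: sqr_ge0.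
  by move=> b; exact: (line b).1.
- by move=> b; exact: (line b).2.
- move=> b bM; transitivity (Rintegral leb1 setT (fun _ : measurableTypeR R => 0 : R)).
    apply: eq_Rintegral => a _; rewrite diff2_fst !sqrt_supported/= ?bM ?orbT//.
    by rewrite mulr0 subrr addr0 expr0n.
  by rewrite Rintegral_cst// mul0r.
Qed.

Let diff2_sqr2 h : 0 < h -> h <= 1 ->
  Rintegral leb2 setT (fun x : plane => diff2 (0, h) g x ^+ 2) <=
  square_root_const * h ^+ 3.
Proof.
move=> h0 h1.
have [_ D2i] : integrable2 (diff2 (0, h) g) /\
    integrable2 (fun x => diff2 (0, h) g x ^+ 2).
  by apply: diff2_sqr_integrable; rewrite /= ?normr0// gtr0_norm.
have line a : leb1.-integrable setT
    (EFin \o (fun b => diff2 (0, h) g (a, b) ^+ 2)) /\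
  Rintegral leb1 setT (fun b => diff2 (0, h) g (a, b) ^+ 2) <=
  second_difference_const M C1 C2 * h ^+ 3.
  have [w1 [w2 [dw dw1 cw2 [w1C w2C] w0]]] := cw.2 a.
  have cgb : continuous (fun b => g (a, b)).
    move=> b; apply: (@continuous_comp _ _ _ (fun b => (a, b)) g); last exact: cg.
    exact: continuous_pairr.
  have [] := integral_sqr_second_difference dw dw1 cw2 w1C w2C w0 M0 cgb
    (fun b => gw (a, b)) h0 h1.
  have E : (fun b => (g (a, b + h) - 2 * g (a, b) + g (a, b - h)) ^+ 2) =
      (fun b => diff2 (0, h) g (a, b) ^+ 2).
    by apply/funext => b; rewrite diff2_snd.
  by rewrite E.
rewrite -(@Rfubini _ _ _ _ _ leb1s leb1s _ D2i); last by move=> a; exact: (line a).1.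
rewrite /square_root_const mulrAC; apply: line_bound.
- apply: eq_integrable (integrable_fubini_F (m1 := leb1s) (m2 := leb1s) D2i) => // a _.
  by rewrite /fubini_F /= Rintegral_EFin//; exact: (line a).1.
- by move=> a; exact: (line a).2.
- move=> a aM; transitivity (Rintegral leb1 setT (fun _ : measurableTypeR R => 0 : R)).
    apply: eq_Rintegral => b _; rewrite diff2_snd !sqrt_supported/= ?aM//.
    by rewrite mulr0 subrr addr0 expr0n.
  by rewrite Rintegral_cst// mul0r.
Qed.

Definition energy (x : R * R) : R := cos_transform g x ^+ 2 + sin_transform g x ^+ 2.

Let cC : continuous (cos_transform g) := continuous_cos_transform gi sqrt_supported.
Let cS : continuous (sin_transform g) := continuous_sin_transform gi sqrt_supported.

Let energy_weighted v e : 0 < e -> `|v.1| <= 1 -> `|v.2| <= 1 ->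
  integrable2 (fun x => abel2 e x * ((2 * cos (dot x v) - 2) ^+ 2 * energy x)) /\
  Rintegral leb2 setT (fun x : plane =>
    abel2 e x * ((2 * cos (dot x v) - 2) ^+ 2 * energy x)) <=
  4 * pi ^+ 2 * Rintegral leb2 setT (fun x : plane => diff2 v g x ^+ 2).
Proof.
move=> e0 v1 v2; have [Di D2i] := diff2_sqr_integrable v1 v2.
have sD := supported_diff2 sqrt_supported v1 v2.
have mC := continuous_measurable_plane (continuous_cos_transform Di sD).
have mS := continuous_measurable_plane (continuous_sin_transform Di sD).
have E x : cos_transform (diff2 v g) x ^+ 2 + sin_transform (diff2 v g) x ^+ 2 =
    (2 * cos (dot x v) - 2) ^+ 2 * energy x.
  by rewrite cos_transform_diff2// sin_transform_diff2// /energy; ring.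
have EF : (fun x : R * R => abel2 e x * (cos_transform (diff2 v g) x ^+ 2 +
    sin_transform (diff2 v g) x ^+ 2)) =
    (fun x : R * R => abel2 e x * ((2 * cos (dot x v) - 2) ^+ 2 * energy x)).
  by apply/funext => x; rewrite E.
split; last by have := bessel_abel2 Di D2i mC mS e0; rewrite EF.
rewrite -EF.
pose B := Rintegral leb2 setT (fun xi : plane => `|diff2 v g xi|).
apply: (@integrableM_bounded _ _ _ _ _ _ (B ^+ 2 + B ^+ 2) (integrable_abel2 e0)).
  by apply: measurable_funD; exact: measurable_funX.
move=> x; rewrite (le_trans (ler_normD _ _))// !normrX lerD// lerXn2r ?nnegrE//.
- by rewrite (le_trans _ (le_cos_transform x Di)).
- exact: le_cos_transform.
- by rewrite (le_trans _ (le_sin_transform x Di)).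
- exact: le_sin_transform.
Qed.

Lemma dyadic_scale (t : R) : 1 <= t -> exists m : nat, 4 ^+ m <= t < 4 ^+ m.+1.
Proof.
move=> t1; have ex : exists n : nat, t < 4 ^+ n.
  exists (Num.truncn t).+1; apply: (lt_le_trans (truncnS_gt _)).
  by rewrite -natrX ler_nat ltnW// ltn_expl.
case: (ex_minnP ex) => -[|n] tn min.
  by move: tn; rewrite expr0 ltNge t1.
exists n; rewrite tn andbT leNgt; apply/negP => /min.
by rewrite ltnn.
Qed.

(* When [4 ^+ m <= `|t| < 4 ^+ m.+1] the product [`|t| * step m] lies in the
   interval from 1/2 to 2, where the cosine stays away from 1. *)
Let step (m : nat) : R := 4^-1 ^+ m / 2.

Let step_gt0 m : 0 < step m.
Proof. by rewrite divr_gt0// exprn_gt0// invr_gt0. Qed.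

Let step_le1 m : step m <= 1.
Proof.
have : 4^-1 ^+ m <= 1 :> R by rewrite exprn_ile1// ?invr_ge0// invf_le1// ler1n.
by rewrite /step; lra.
Qed.

Let c0 : R := 2 - 2 * cos 2^-1.

Let c0_gt0 : 0 < c0.
Proof.
have pi2 := pi_ge2 R.
have : cos 2^-1 < cos 0 :> R.
  by rewrite ltr_cos ?in_itv/= ?lexx ?pi_ge0//; apply/andP; split; lra.
by rewrite cos0 /c0; lra.
Qed.

Let weight_ge (m : nat) (t : R) : 4 ^+ m <= `|t| < 4 ^+ m.+1 ->
  c0 ^+ 2 <= (2 * cos (t * step m) - 2) ^+ 2.
Proof.
move=> /andP[tm tm1]; have pi2 := pi_ge2 R.
have -> : cos (t * step m) = cos (`|t| * step m).
  by have [_|_] := ger0P t => //; rewrite mulNr cosN.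
have K : 4 ^+ m * 4^-1 ^+ m = 1 :> R by rewrite -exprMn divff// expr1n.
have q0 : 0 <= 4^-1 ^+ m :> R by rewrite exprn_ge0// invr_ge0.
have a1 : 2^-1 <= `|t| * step m.
  have := ler_wpM2r q0 tm; rewrite K /step mulrA; lra.
have a2 : `|t| * step m <= 2.
  have := ler_wpM2r q0 (ltW tm1); rewrite exprS -mulrA K /step mulrA; lra.
have : cos (`|t| * step m) <= cos 2^-1.
  rewrite le_eqVlt; move: a1; rewrite le_eqVlt => /orP[/eqP->|a1].
    by rewrite eqxx.
  rewrite ltr_cos ?a1 ?orbT// in_itv/=; apply/andP; split; lra.
move: (cos _) => c cle; rewrite -[leRHS]sqrrN lerXn2r ?nnegrE ?(ltW c0_gt0)//.
  by have := c0_gt0; rewrite /c0; lra.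
by rewrite /c0; lra.
Qed.

Let abel2_ge (m : nat) (x : R * R) : `|x.1| <= 4 ^+ m.+1 -> `|x.2| <= 4 ^+ m.+1 ->
  expR (- 8) <= abel2 (4^-1 ^+ m) x.
Proof.
move=> x1 x2; have K : 4^-1 ^+ m * 4 ^+ m.+1 = 4 :> R.
  by rewrite exprS mulrCA -exprMn mulVf// expr1n mulr1.
have q0 : 0 <= 4^-1 ^+ m :> R by rewrite exprn_ge0// invr_ge0.
rewrite /abel2 /abel -expRD ler_expR.
have := ler_wpM2l q0 x1; have := ler_wpM2l q0 x2; rewrite K !mulNr; lra.
Qed.

(* On the annulus of index [m] the Abel factor is at least [expR (- 8)] and the
   weight of one of the two second differences at least [c0 ^+ 2]. *)
Let kappa : R := expR 8 / c0 ^+ 2.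

Let kappa_ge0 : 0 <= kappa.
Proof. by rewrite divr_ge0 ?expR_ge0 ?sqr_ge0. Qed.

Let majorant B (m : nat) (x : R * R) : R :=
  32 ^+ m * kappa * (abel2 (4^-1 ^+ m) x * ((2 * cos (dot x (step m, 0)) - 2) ^+ 2 * energy x) +
                     abel2 (4^-1 ^+ m) x * ((2 * cos (dot x (0, step m)) - 2) ^+ 2 * energy x)) +
  32^-1 ^+ m * (1 + B) * box_indic (4 ^+ m.+1) x.

Let energy_ge0 x : 0 <= energy x.
Proof. by rewrite addr_ge0 ?sqr_ge0. Qed.

Let majorant_ge0 B m x : 0 <= B -> 0 <= majorant B m x.
Proof.
move=> B0; have t0 v : 0 <= abel2 (4^-1 ^+ m) x * ((2 * cos (dot x v) - 2) ^+ 2 * energy x).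
  exact: (mulr_ge0 (abel2_ge0 _ _) (mulr_ge0 (sqr_ge0 _) (energy_ge0 x))).
have p1 : 0 <= 32 ^+ m * kappa by rewrite mulr_ge0// exprn_ge0.
have p2 : 0 <= 32^-1 ^+ m * (1 + B) :> R.
  by rewrite mulr_ge0 ?addr_ge0// exprn_ge0// invr_ge0.
exact: (addr_ge0 (mulr_ge0 p1 (addr_ge0 (t0 _) (t0 _))) (mulr_ge0 p2 (box_indic_ge0 _ _))).
Qed.

Let norm_le_majorant B f x : 0 <= B -> f ^+ 2 <= energy x -> `|f| <= B ->
  exists m, `|f| <= majorant B m x.
Proof.
move=> B0 fE fB.
have t0 m v : 0 <= abel2 (4^-1 ^+ m) x * ((2 * cos (dot x v) - 2) ^+ 2 * energy x).
  exact: (mulr_ge0 (abel2_ge0 _ _) (mulr_ge0 (sqr_ge0 _) (energy_ge0 x))).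
have p1 m : 0 <= 32 ^+ m * kappa by rewrite mulr_ge0// exprn_ge0.
have [lt1|ge1] := ltP (Num.max `|x.1| `|x.2|) 1.
  exists 0%N; rewrite /majorant.
  have -> : box_indic (4 ^+ 1) x = 1.
    move: lt1; rewrite gt_max box_indicE expr1 => /andP[? ?].
    suff -> : (`|x.1| <= 4) && (`|x.2| <= 4) by [].
    by apply/andP; split; lra.
  rewrite [32^-1 ^+ 0]expr0 mul1r mulr1.
  have := mulr_ge0 (p1 0%N) (addr_ge0 (t0 0%N (step 0, 0)) (t0 0%N (0, step 0))).
  by move: (_ * (_ + _)) => ?; lra.
have [m /andP[ma mb]] := dyadic_scale ge1; exists m.
move: (mb); rewrite gt_max => /andP[/ltW x1 /ltW x2].
have A := abel2_ge x1 x2.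
rewrite /majorant; have -> : box_indic (4 ^+ m.+1) x = 1 by rewrite box_indicE x1 x2.
rewrite mulr1 /dot/= !mulr0 addr0 add0r.
have key : energy x <= kappa *
    (abel2 (4^-1 ^+ m) x * ((2 * cos (x.1 * step m) - 2) ^+ 2 * energy x) +
     abel2 (4^-1 ^+ m) x * ((2 * cos (x.2 * step m) - 2) ^+ 2 * energy x)).
  have wc : c0 ^+ 2 <= (2 * cos (x.1 * step m) - 2) ^+ 2 + (2 * cos (x.2 * step m) - 2) ^+ 2.
    have [E|E] : `|x.1| = Num.max `|x.1| `|x.2| \/ `|x.2| = Num.max `|x.1| `|x.2|.
      by have /orP[le|le] := le_total `|x.1| `|x.2|;
        [right; rewrite (max_idPr le)|left; rewrite (max_idPl le)].
    - by rewrite (le_trans (weight_ge (m := m) (t := x.1) _)) ?lerDl ?sqr_ge0// E ma mb.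
    - by rewrite (le_trans (weight_ge (m := m) (t := x.2) _)) ?lerDr ?sqr_ge0// E ma mb.
  have k1 : kappa * (expR (- 8) * c0 ^+ 2) = 1.
    rewrite /kappa expRN; field.
    by rewrite expR_eq0 gt_eqF.
  rewrite -mulrDr -mulrDl mulrA mulrA -[leLHS]mul1r ler_wpM2r// -[leLHS]k1.
  by rewrite -mulrA ler_wpM2l// ler_pM ?expR_ge0 ?sqr_ge0.
have L0 : 0 < 32 ^+ m :> R by rewrite exprn_gt0.
have -> : 32^-1 ^+ m = (32 ^+ m)^-1 :> R by rewrite exprVn.
rewrite -mulrA.
apply: (@le_trans _ _ (32 ^+ m * energy x + (32 ^+ m)^-1 * (1 + B))); last first.
  by rewrite lerD2r ler_wpM2l// ltW.
apply: (@le_trans _ _ (32 ^+ m * f ^+ 2 + (32 ^+ m)^-1)); last first.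
  rewrite lerD ?ler_wpM2l ?(ltW L0)//.
  by rewrite ler_peMr ?invr_ge0 ?(ltW L0)// lerDl.
rewrite -[f ^+ 2]real_normK ?num_real//.
move: (32 ^+ m) L0 => l l0; move: `|f| (normr_ge0 f) => t t0'.
rewrite -(ler_pM2l l0) mulrDr mulfV ?gt_eqF//.
have := sqr_ge0 (l * t - 1); have := mulr_ge0 (ltW l0) t0'; nra.
Qed.

Let Rintegral_majorant B m : 0 <= B -> integrable2 (majorant B m) /\
  Rintegral leb2 setT (majorant B m) <=
  (kappa * (2 * (4 * pi ^+ 2 * square_root_const)) + 128 * (1 + B)) / (2 ^ m.+1)%:R.
Proof.
move=> B0.
have e0 : 0 < 4^-1 ^+ m :> R by rewrite exprn_gt0// invr_gt0.
have s0 := step_gt0 m; have s1 := step_le1 m.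
have ns : `|step m| <= 1 by rewrite gtr0_norm.
have n0 : `|0 : R| <= 1 by rewrite normr0.
have [i1 le1] := @energy_weighted (step m, 0) _ e0 ns n0.
have [i2 le2] := @energy_weighted (0, step m) _ e0 n0 ns.
have ib := integrable_box_indic (4 ^+ m.+1 : R).
have isum := RintegrableD i1 i2.
have i12 := RintegrableZl (32 ^+ m * kappa) isum.
have i3 := RintegrableZl (32^-1 ^+ m * (1 + B)) ib.
split; first exact: (RintegrableD i12 i3).
rewrite RintegralD// RintegralZl// RintegralD// RintegralZl//.
rewrite Rintegral_box_indic ?exprn_ge0//.
have K0 : 0 <= 4 * pi ^+ 2 :> R by rewrite mulr_ge0// exprn_ge0// pi_ge0.
have h1 := le_trans le1 (ler_wpM2l K0 (diff2_sqr1 s0 s1)).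
have h2 := le_trans le2 (ler_wpM2l K0 (diff2_sqr2 s0 s1)).
have p1 : 0 <= 32 ^+ m * kappa by rewrite mulr_ge0// exprn_ge0.
apply: (le_trans (lerD (ler_wpM2l p1 (lerD h1 h2)) (lexx _))).
have E3 : (2 ^ m.+1)%:R = 2 ^+ m * 2 :> R by rewrite natrX exprSr.
have E1 : 32 ^+ m * step m ^+ 3 = (2 ^+ m)^-1 / 8 :> R.
  rewrite /step expr_div_n exprAC mulrA -exprMn.
  by rewrite (_ : 32 * 4^-1 ^+ 3 = 2^-1 :> R) ?exprVn; [congr (_ / _); ring|field].
have E2 : 32^-1 ^+ m * (2 * 4 ^+ m.+1) ^+ 2 = 64 * (2 ^+ m)^-1 :> R.
  have -> : (2 * 4 ^+ m.+1) ^+ 2 = 64 * (4 ^+ 2) ^+ m :> R.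
    by rewrite [4 ^+ m.+1]exprS [(4 ^+ 2) ^+ m]exprAC; ring.
  rewrite mulrCA -exprMn (_ : 32^-1 * 4 ^+ 2 = 2^-1 :> R); last by field.
  by rewrite exprVn.
rewrite [leLHS](_ : _ = kappa * (2 * (4 * pi ^+ 2 * square_root_const)) *
    (32 ^+ m * step m ^+ 3) + (1 + B) * (32^-1 ^+ m * (2 * 4 ^+ m.+1) ^+ 2)); last by ring.
rewrite E1 E2 E3 invfM -subr_ge0.
have u0 : 0 <= (2 ^+ m)^-1 :> R by rewrite invr_ge0 exprn_ge0.
rewrite [leRHS](_ : _ = kappa * (2 * (4 * pi ^+ 2 * square_root_const)) *
    (2 ^+ m)^-1 * (3 / 8)); last by field; rewrite expf_neq0.
apply: mulr_ge0; last by rewrite divr_ge0.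
apply: mulr_ge0 => //; apply: mulr_ge0 => //.
have h10 : 0 <= 4 * pi ^+ 2 * (square_root_const * step m ^+ 3).
  apply: le_trans h1; apply: Rintegral_ge0 => x _.
  exact: (mulr_ge0 (abel2_ge0 _ _) (mulr_ge0 (sqr_ge0 _) (energy_ge0 x))).
move: h10; rewrite mulrA pmulr_lge0 ?exprn_gt0// => h10.
exact: mulr_ge0.
Qed.

Let transform_bound := Rintegral leb2 setT (fun xi : plane => `|g xi|).

Let transform_bound_ge0 : 0 <= transform_bound.
Proof. by apply: Rintegral_ge0. Qed.

(** The transforms of a continuous square root of [w ^+ 2] are integrable.  On
    the square annulus of size [4 ^+ m], the factor [2 - 2 cos] of a second
    difference with step of size [4 ^- m] is bounded below, so that Bessel's
    inequality bounds the energy there by a multiple of [64 ^- m]; since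
    [`|t| <= 32 ^+ m * t ^+ 2 + 32 ^- m] and the annulus has area of size
    [16 ^+ m], the integrals over the annuli decay like [2 ^- m]. *)
Lemma integrable_cos_transform_sqrt : integrable2 (cos_transform g).
Proof.
apply: (integrable_majorants (continuous_measurable_plane cC)
  (fun m => (Rintegral_majorant m transform_bound_ge0).1)
  (fun m x => majorant_ge0 m x transform_bound_ge0)
  (fun m => (Rintegral_majorant m transform_bound_ge0).2)).
move=> x; apply: norm_le_majorant => //; last exact: le_cos_transform.
by rewrite /energy lerDl sqr_ge0.
Qed.

Lemma integrable_sin_transform_sqrt : integrable2 (sin_transform g).
Proof.
apply: (integrable_majorants (continuous_measurable_plane cS)
  (fun m => (Rintegral_majorant m transform_bound_ge0).1)
  (fun m x => majorant_ge0 m x transform_bound_ge0)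
  (fun m => (Rintegral_majorant m transform_bound_ge0).2)).
move=> x; apply: norm_le_majorant => //; last exact: le_sin_transform.
by rewrite /energy lerDr sqr_ge0.
Qed.

End SquareRoot.

End SmoothTransforms.

Section Decay.
Variable R : realType.
Local Notation plane := (measurableTypeR R * measurableTypeR R)%type.
Local Notation leb1 := (leb1 R).
Local Notation leb2 := (leb2 R).
Local Notation integrable2 f := (leb2.-integrable setT (EFin \o f)).
Variables (w : R * R -> R) (M C1 C2 : R).
Hypotheses (M0 : 0 <= M) (cw : C2_plane M C1 C2 w) (wc : continuous w).

Let wi : integrable2 w.
Proof.
exact: supported_integrable (continuous_measurable_plane wc)
  (C2_plane_supported cw) (C2_plane_bounded M0 cw).
Qed.

Let B := Rintegral leb2 setT (fun xi : plane => `|w xi|).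

Let B0 : 0 <= B. Proof. exact: Rintegral_ge0. Qed.

Let C20 : 0 <= C2.
Proof.
by have [w1 [w2 [_ _ _ [_ w2C] _]]] := cw.1 0; exact: le_trans (w2C 0).
Qed.

Let diff2_fst_le h x : 0 <= h -> `|diff2 (h, 0) w x| <= 2 * C2 * h ^+ 2.
Proof.
case: x => a b h0; have [w1 [w2 [dw dw1 _ [_ w2C] _]]] := cw.1 b.
by rewrite diff2_fst; exact: (second_difference_le dw dw1 w2C a h0).
Qed.

Let diff2_snd_le h x : 0 <= h -> `|diff2 (0, h) w x| <= 2 * C2 * h ^+ 2.
Proof.
case: x => a b h0; have [w1 [w2 [dw dw1 _ [_ w2C] _]]] := cw.2 a.
by rewrite diff2_snd; exact: (second_difference_le dw dw1 w2C b h0).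
Qed.

Let K1 : R := C2 * pi ^+ 2 * (2 * (M + pi)) ^+ 2 + B.

Let norm_diff2_Rintegral v h : 0 <= h -> `|v.1| <= h -> `|v.2| <= h ->
  (forall x, `|diff2 v w x| <= 2 * C2 * h ^+ 2) ->
  Rintegral leb2 setT (fun xi : plane => `|diff2 v w xi|) <=
  2 * C2 * h ^+ 2 * (2 * (M + h)) ^+ 2.
Proof.
move=> h0 v1 v2 vh; apply: supported_Rintegral_le => //.
- exact: addr_ge0.
- exact: continuous_measurable_plane (continuous_diff2 wc).
- exact: supported_diff2 (C2_plane_supported cw) v1 v2.
Qed.

(** For [h = pi / `|t|] the factor [2 * cos (t * h) - 2] equals [-4]. *)
Let coordinate_decay (t f : R) (v : R -> R * R) :
  (forall h, 0 <= h -> `|(v h).1| <= h /\ `|(v h).2| <= h) ->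
  (forall h x, 0 <= h -> `|diff2 (v h) w x| <= 2 * C2 * h ^+ 2) ->
  (forall h, `|(2 * cos (t * h) - 2) * f| <=
     Rintegral leb2 setT (fun xi : plane => `|diff2 (v h) w xi|)) ->
  `|f| <= B ->
  t ^+ 2 * `|f| <= K1.
Proof.
move=> vh vw vf fB; have pi0 := pi_gt0 R.
have A0 : 0 <= C2 * pi ^+ 2 * (2 * (M + pi)) ^+ 2.
  exact: (mulr_ge0 (mulr_ge0 C20 (sqr_ge0 _)) (sqr_ge0 _)).
have [t1|t1] := ltP `|t| 1.
  apply: (@le_trans _ _ B); last by rewrite /K1 lerDr.
  apply: (le_trans _ fB); rewrite ler_piMl// -real_normK ?num_real//.
  by rewrite exprn_ile1// ltW.
have t0 : 0 < `|t| by exact: lt_le_trans t1.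
pose h := pi / `|t|.
have h0 : 0 <= h by rewrite divr_ge0// ltW.
have hpi : h <= pi by rewrite /h ler_pdivrMr// ler_peMr// ltW.
have [v1 v2] := vh h h0.
have := le_trans (vf h) (norm_diff2_Rintegral h0 v1 v2 (fun x => vw h x h0)).
have -> : cos (t * h) = -1.
  rewrite /h mulrC -mulrA; have [tp|tn] := ger0P t.
    by rewrite mulVf ?mulr1 ?cospi// -normr_gt0.
  by rewrite invrN mulNr mulVf ?mulrN ?mulr1 ?cosN ?cospi// lt_eqF.
rewrite (_ : 2 * -1 - 2 = - 4 :> R); last by ring.
rewrite normrM normrN (ger0_norm (ler0n _ 4)) => H.
have h2 : t ^+ 2 * h ^+ 2 = pi ^+ 2.
  by rewrite -[t ^+ 2]real_normK ?num_real// -exprMn /h mulrCA mulfV ?mulr1// gt_eqF.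
have t20 : 0 <= t ^+ 2 := sqr_ge0 t.
have := ler_wpM2l t20 H.
rewrite [leRHS](_ : _ = 2 * C2 * pi ^+ 2 * (2 * (M + h)) ^+ 2); last first.
  by rewrite -h2; ring.
have Mh : (2 * (M + h)) ^+ 2 <= (2 * (M + pi)) ^+ 2.
  have a0 : 0 <= 2 * (M + h) by rewrite mulr_ge0// addr_ge0.
  have b0 : 0 <= 2 * (M + pi) by rewrite mulr_ge0// addr_ge0// ltW.
  by rewrite lerXn2r ?nnegrE// ler_wpM2l// lerD2l.
have P0 : 0 <= 2 * C2 * pi ^+ 2 by exact: (mulr_ge0 (mulr_ge0 _ C20) (sqr_ge0 _)).
move=> H1; have H2 := le_trans H1 (ler_wpM2l P0 Mh).
have {H1 H2} : 4 * (t ^+ 2 * `|f|) <= 2 * (C2 * pi ^+ 2 * (2 * (M + pi)) ^+ 2).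
  rewrite (_ : 4 * _ = t ^+ 2 * (4 * `|f|)); last by ring.
  by rewrite (_ : 2 * _ = 2 * C2 * pi ^+ 2 * (2 * (M + pi)) ^+ 2); last by ring.
rewrite /K1; have := B0; move: A0; move: (C2 * _ * _) (t ^+ 2 * _) => X Y ? ? ?; lra.
Qed.

(** Second differences of [w] play the part of second derivatives: those with
    step [h] are of size [h ^+ 2], and their transforms are those of [w] times
    [2 * cos (x.v) - 2]. *)
Lemma transform_decay : exists2 K, 0 <= K & forall x,
  `|cos_transform w x| <= K / (1 + x.1 ^+ 2 + x.2 ^+ 2) /\
  `|sin_transform w x| <= K / (1 + x.1 ^+ 2 + x.2 ^+ 2).
Proof.
have A0 : 0 <= C2 * pi ^+ 2 * (2 * (M + pi)) ^+ 2.
  exact: (mulr_ge0 (mulr_ge0 C20 (sqr_ge0 _)) (sqr_ge0 _)).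
have Di v : integrable2 (diff2 v w).
  pose L := Num.max `|v.1| `|v.2|.
  have v1 : `|v.1| <= L by rewrite /L le_max lexx.
  have v2 : `|v.2| <= L by rewrite /L le_max lexx orbT.
  exact: supported_integrable (continuous_measurable_plane (continuous_diff2 wc))
    (supported_diff2 (C2_plane_supported cw) v1 v2)
    (fun x => norm_diff2_le v x (C2_plane_bounded M0 cw)).
have v1h h : 0 <= h -> `|(h, 0 : R).1| <= h /\ `|(h, 0 : R).2| <= h.
  by move=> h0; rewrite /= normr0 ger0_norm.
have v2h h : 0 <= h -> `|(0 : R, h).1| <= h /\ `|(0 : R, h).2| <= h.
  by move=> h0; rewrite /= normr0 ger0_norm.
have dot1 x h : dot x (h, 0) = x.1 * h by rewrite /dot/= mulr0 addr0.
have dot2 x h : dot x (0, h) = x.2 * h by rewrite /dot/= mulr0 add0r.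
have final (x : R * R) f : `|f| <= B -> x.1 ^+ 2 * `|f| <= K1 -> x.2 ^+ 2 * `|f| <= K1 ->
    `|f| <= (B + 2 * K1) / (1 + x.1 ^+ 2 + x.2 ^+ 2).
  move=> f0 f1 f2; rewrite ler_pdivlMr; last by rewrite -addrA ltr_pwDl ?addr_ge0 ?sqr_ge0.
  by rewrite mulrC !mulrDl mul1r; lra.
exists (B + 2 * K1); first by rewrite addr_ge0// mulr_ge0// addr_ge0.
move=> x; split; apply: final.
- exact: le_cos_transform.
- apply: (coordinate_decay v1h diff2_fst_le) => [h|]; last exact: le_cos_transform.
  by rewrite -dot1 -cos_transform_diff2//; exact: le_cos_transform.
- apply: (coordinate_decay v2h diff2_snd_le) => [h|]; last exact: le_cos_transform.
  by rewrite -dot2 -cos_transform_diff2//; exact: le_cos_transform.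
- exact: le_sin_transform.
- apply: (coordinate_decay v1h diff2_fst_le) => [h|]; last exact: le_sin_transform.
  by rewrite -dot1 -sin_transform_diff2//; exact: le_sin_transform.
- apply: (coordinate_decay v2h diff2_snd_le) => [h|]; last exact: le_sin_transform.
  by rewrite -dot2 -sin_transform_diff2//; exact: le_sin_transform.
Qed.

End Decay.

(** * Differentiability in two variables *)

Section Ck.
Variable R : realType.
Implicit Types (D : set (R * R)) (f g : R * R -> R) (k : nat).

Definition partials D f f1 f2 := forall a b : R, D (a, b) ->
  is_derive a 1 (fun t : R => f (t, b)) (f1 (a, b)) /\
  is_derive b 1 (fun t : R => f (a, t)) (f2 (a, b)).

(** For an open set [D] these are the functions of class C^k on [D]; continuity
    refers to the whole plane. *)
Fixpoint Ck k D f : Prop :=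
  (forall x, D x -> {for x, continuous f}) /\
  if k is k'.+1 then
    exists f1 f2 : R * R -> R, [/\ partials D f f1 f2, Ck k' D f1 & Ck k' D f2]
  else True.

Lemma Ck_continuous k D f x : Ck k D f -> D x -> {for x, continuous f}.
Proof. by case: k => [|k] [cf _]; exact: cf. Qed.

Lemma CkW k D f : Ck k.+1 D f -> Ck k D f.
Proof.
elim: k f => [|k IH] f [cf [f1 [f2 [pf k1 k2]]]]; first by split.
by split=> //; exists f1, f2; split=> //; exact: IH.
Qed.

Lemma open_line1 D a b : open D -> D (a, b) -> \forall t \near a, D (t, b).
Proof.
move=> oD Dab; have : nbhs (a, b) D by exact: open_nbhs_nbhs.
exact: (@continuous_pairl _ b a).
Qed.

Lemma open_line2 D a b : open D -> D (a, b) -> \forall t \near b, D (a, t).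
Proof.
move=> oD Dab; have : nbhs (a, b) D by exact: open_nbhs_nbhs.
exact: (@continuous_pairr _ a b).
Qed.

Lemma eq_Ck k D f g : open D -> (forall x, D x -> f x = g x) ->
  Ck k D f -> Ck k D g.
Proof.
move=> oD fg.
have cfg : (forall x, D x -> {for x, continuous f}) ->
    forall x, D x -> {for x, continuous g}.
  move=> cf x Dx; have nx : nbhs x D by exact: open_nbhs_nbhs.
  rewrite /prop_for /continuous_at -(fg _ Dx).
  apply: cvg_trans (cf _ Dx); apply: near_eq_cvg.
  by apply: filterS nx => y; exact: fg.
case: k => [|k] [cf H]; split=> //; try exact: cfg.
have [f1 [f2 [pf k1 k2]]] := H; exists f1, f2; split=> // a b Dab.
have [d1 d2] := pf _ _ Dab; split.
- apply: near_eq_is_derive d1.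
  by apply: filterS (open_line1 oD Dab) => t; exact: fg.
- apply: near_eq_is_derive d2.
  by apply: filterS (open_line2 oD Dab) => t; exact: fg.
Qed.

(** Differentiability is local: partial derivatives on two open sets agree on
    the overlap and can be glued. *)
Lemma Ck_setU k D1 D2 f : open D1 -> open D2 ->
  Ck k D1 f -> Ck k D2 f -> Ck k (D1 `|` D2) f.
Proof.
move=> o1 o2; elim: k f => [|k IH] f [c1 H1] [c2 H2]; split=> //;
  try by move=> x [/c1|/c2].
have [f1 [f2 [pf kf1 kf2]]] := H1; have [g1 [g2 [pg kg1 kg2]]] := H2.
pose h1 x := if `[< D1 x >] then f1 x else g1 x.
pose h2 x := if `[< D1 x >] then f2 x else g2 x.
have fh1 x : D1 x -> f1 x = h1 x by move=> Dx; rewrite /h1; case: asboolP.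
have fh2 x : D1 x -> f2 x = h2 x by move=> Dx; rewrite /h2; case: asboolP.
have gh1 x : D2 x -> g1 x = h1 x.
  move=> Dx; rewrite /h1; case: asboolP => // D1x.
  case: x Dx D1x => a b Dx D1x.
  by have [[_ <-] _] := pf _ _ D1x; have [[_ <-] _] := pg _ _ Dx.
have gh2 x : D2 x -> g2 x = h2 x.
  move=> Dx; rewrite /h2; case: asboolP => // D1x.
  case: x Dx D1x => a b Dx D1x.
  by have [_ [_ <-]] := pf _ _ D1x; have [_ [_ <-]] := pg _ _ Dx.
exists h1, h2; split.
- move=> a b [Dab|Dab].
    by rewrite -fh1// -fh2//; exact: pf.
  by rewrite -gh1// -gh2//; exact: pg.
- by apply: IH; [exact: eq_Ck kf1|exact: eq_Ck kg1].
- by apply: IH; [exact: eq_Ck kf2|exact: eq_Ck kg2].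
Qed.

Lemma Ck_cst k D (c : R) : Ck k D (fun=> c).
Proof.
elim: k c => [|k IH] c; split=> //; try by move=> x _; exact: cvg_cst.
by exists (fun=> 0), (fun=> 0); split=> // a b _; split; exact: is_derive_cst.
Qed.

Lemma Ck_fst k D : Ck k D (fun x => x.1).
Proof.
case: k => [|k]; (split; first by move=> x _; exact: cvg_fst) => //.
exists (fun=> 1), (fun=> 0); split; try exact: Ck_cst.
by move=> a b _; split=> /=; [exact: is_derive_id|exact: is_derive_cst].
Qed.

Lemma Ck_snd k D : Ck k D (fun x => x.2).
Proof.
case: k => [|k]; (split; first by move=> x _; exact: cvg_snd) => //.
exists (fun=> 0), (fun=> 1); split; try exact: Ck_cst.
by move=> a b _; split=> /=; [exact: is_derive_cst|exact: is_derive_id].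
Qed.

Lemma CkD k D f g : Ck k D f -> Ck k D g -> Ck k D (fun x => f x + g x).
Proof.
elim: k f g => [|k IH] f g [cf Hf] [cg Hg]; split=> //;
  try by move=> x Dx; apply: cvgD; [exact: cf|exact: cg].
have [f1 [f2 [pf kf1 kf2]]] := Hf; have [g1 [g2 [pg kg1 kg2]]] := Hg.
exists (fun x => f1 x + g1 x), (fun x => f2 x + g2 x); split; try exact: IH.
move=> a b Dab; have [df1 df2] := pf _ _ Dab; have [dg1 dg2] := pg _ _ Dab.
by split; [exact: is_deriveD df1 dg1|exact: is_deriveD df2 dg2].
Qed.

Lemma CkM k D f g : Ck k D f -> Ck k D g -> Ck k D (fun x => f x * g x).
Proof.
elim: k f g => [|k IH] f g kf kg.
  by split=> // x Dx; apply: cvgM; [exact: kf.1|exact: kg.1].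
have [cf [f1 [f2 [pf kf1 kf2]]]] := kf; have [cg [g1 [g2 [pg kg1 kg2]]]] := kg.
split; first by move=> x Dx; apply: cvgM; [exact: cf|exact: cg].
exists (fun x => f x * g1 x + g x * f1 x), (fun x => f x * g2 x + g x * f2 x); split.
- move=> a b Dab; have [df1 df2] := pf _ _ Dab; have [dg1 dg2] := pg _ _ Dab.
  by split; [exact: is_deriveM df1 dg1|exact: is_deriveM df2 dg2].
- by apply: CkD; apply: IH => //; exact: CkW.
- by apply: CkD; apply: IH => //; exact: CkW.
Qed.

(** All the derivatives of the outer function are carried along, because the
    induction on [k] replaces [phi n] by [phi n.+1]. *)
Lemma Ck_comp k D f (phi : nat -> R -> R) n :
  (forall n (x : R), is_derive x 1 (phi n) (phi n.+1 x)) ->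
  Ck k D f -> Ck k D (fun x => phi n (f x)).
Proof.
move=> dphi; elim: k n f => [|k IH] n f kf.
  split=> // x Dx; apply: (@continuous_comp _ _ _ f (phi n)); first exact: kf.1.
  exact: (is_derive_continuous (dphi n)).
have [cf [f1 [f2 [pf kf1 kf2]]]] := kf.
split.
  move=> x Dx; apply: (@continuous_comp _ _ _ f (phi n)); first exact: cf.
  exact: (is_derive_continuous (dphi n)).
exists (fun x => phi n.+1 (f x) * f1 x), (fun x => phi n.+1 (f x) * f2 x); split.
- move=> a b Dab; have [df1 df2] := pf _ _ Dab; split.
    exact: (@is_derive1_comp _ (phi n) (fun t => f (t, b))).
  exact: (@is_derive1_comp _ (phi n) (fun t => f (a, t))).
- by apply: CkM => //; apply: IH; exact: CkW.
- by apply: CkM => //; apply: IH; exact: CkW.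
Qed.

(** The derivative of the inverse involves the inverse itself, whence the
    induction on [k]; the same holds for the square root below. *)
Lemma Ck_inv k D f : (forall x, D x -> f x != 0) -> Ck k D f ->
  Ck k D (fun x => (f x)^-1).
Proof.
move=> f0; elim: k f f0 => [|k IH] f f0 kf.
  by split=> // x Dx; apply: cvgV; [exact: f0|exact: kf.1].
have [cf [f1 [f2 [pf kf1 kf2]]]] := kf.
split; first by move=> x Dx; apply: cvgV; [exact: f0|exact: cf].
have kV : Ck k D (fun x => (f x)^-1) by apply: IH => //; exact: CkW.
exists (fun x => -1 * ((f x)^-1 * (f x)^-1) * f1 x),
  (fun x => -1 * ((f x)^-1 * (f x)^-1) * f2 x); split.
- move=> a b Dab; have [df1 df2] := pf _ _ Dab.
  split.
    apply: is_derive_eq; first exact (@is_deriveV _ (fun t => f (t, b)) a _ _ (f0 _ Dab) df1).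
    by rewrite /GRing.scale/= expr2 invfM; ring.
  apply: is_derive_eq; first exact (@is_deriveV _ (fun t => f (a, t)) b _ _ (f0 _ Dab) df2).
  by rewrite /GRing.scale/= expr2 invfM; ring.
- by apply: CkM => //; apply: CkM; [exact: Ck_cst|exact: CkM].
- by apply: CkM => //; apply: CkM; [exact: Ck_cst|exact: CkM].
Qed.

Lemma Ck_sqrt k D f : (forall x, D x -> 0 < f x) -> Ck k D f ->
  Ck k D (fun x => Num.sqrt (f x)).
Proof.
move=> f0; elim: k f f0 => [|k IH] f f0 kf.
  split=> // x Dx; apply: (@continuous_comp _ _ _ f Num.sqrt); first exact: kf.1.
  exact: sqrt_continuous.
have [cf [f1 [f2 [pf kf1 kf2]]]] := kf.
split.
  move=> x Dx; apply: (@continuous_comp _ _ _ f Num.sqrt); first exact: cf.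
  exact: sqrt_continuous.
have kV : Ck k D (fun x => (2 * Num.sqrt (f x))^-1).
  apply: Ck_inv; first by move=> x Dx; rewrite mulf_neq0// gt_eqF// sqrtr_gt0 f0.
  by apply: CkM; [exact: Ck_cst|apply: IH => //; exact: CkW].
exists (fun x => (2 * Num.sqrt (f x))^-1 * f1 x),
  (fun x => (2 * Num.sqrt (f x))^-1 * f2 x); split; try exact: CkM.
move=> a b Dab; have [df1 df2] := pf _ _ Dab; have ds := is_derive1_sqrt (f0 _ Dab).
split.
  exact: (@is_derive1_comp _ Num.sqrt (fun t => f (t, b))).
exact: (@is_derive1_comp _ Num.sqrt (fun t => f (a, t))).
Qed.

Lemma Ck_atan k D f : Ck k D f -> Ck k D (fun x => atan (f x)).
Proof.
case: k => [|k] kf.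
  split=> // x Dx; apply: (@continuous_comp _ _ _ f atan); first exact: kf.1.
  exact: continuous_atan.
have [cf [f1 [f2 [pf kf1 kf2]]]] := kf.
split.
  move=> x Dx; apply: (@continuous_comp _ _ _ f atan); first exact: cf.
  exact: continuous_atan.
have kV : Ck k D (fun x => (1 + f x * f x)^-1).
  apply: Ck_inv; first by move=> x Dx; rewrite gt_eqF// ltr_pwDl// -expr2 sqr_ge0.
  by apply: CkD; [exact: Ck_cst|apply: CkM; exact: CkW].
exists (fun x => (1 + f x * f x)^-1 * f1 x), (fun x => (1 + f x * f x)^-1 * f2 x).
split; try exact: CkM.
move=> a b Dab; have [df1 df2] := pf _ _ Dab; have ds := is_derive1_atan (f (a, b)).
split.
  exact: (@is_derive1_comp _ atan (fun t => f (t, b))).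
exact: (@is_derive1_comp _ atan (fun t => f (a, t))).
Qed.

Lemma continuous_supported_bounded (M : R) f : continuous f ->
  (forall x, (M < `|x.1|) || (M < `|x.2|) -> f x = 0) ->
  exists C, forall x, `|f x| <= C.
Proof.
move=> cf f0; pose box : set (R * R) := `[- M, M]%classic `*` `[- M, M]%classic.
have cbox : compact box by apply: compact_setX; exact: segment_compact.
have cfbox : compact (f @` box).
  by apply: continuous_compact => //; exact: continuous_subspaceT.
have [C [_ HC]] := compact_bounded cfbox.
exists (Num.max 0 (C + 1)) => x.
have [xM|] := boolP ((M < `|x.1|) || (M < `|x.2|)).
  by rewrite f0// normr0 le_max lexx.
rewrite negb_or -!leNgt => /andP[x1 x2].
rewrite le_max; apply/orP; right.
apply: (HC (C + 1)); first by rewrite ltrDl.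
by exists x => //; split; rewrite /= in_itv/= -ler_norml.
Qed.

(** The derivatives are continuous, and vanish with [f] outside a compact square. *)
Lemma Ck2_C2_plane (M : R) f : Ck 2 setT f -> supported M f ->
  exists C1 C2 : R, C2_plane M C1 C2 f.
Proof.
move=> [_ [f1 [f2 [pf [c1 [f11 [f12 [pf1 [c11 _] _]]]] [c2 [f21 [f22 [pf2 _ [c22 _]]]]]]]]] fM.
have cc (h : R * R -> R) : (forall x, setT x -> {for x, continuous h}) -> continuous h.
  by move=> H x; exact: H.
have far1 : open [set x : R * R | M < `|x.1|].
  apply: (@open_comp _ _ (fun x : R * R => `|x.1|) [set t | M < t]); last exact: open_gt.
  move=> x _; apply: (@continuous_comp _ _ _ fst (fun t : R => `|t|)).
    exact: cvg_fst.
  exact: norm_continuous.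
have far2 : open [set x : R * R | M < `|x.2|].
  apply: (@open_comp _ _ (fun x : R * R => `|x.2|) [set t | M < t]); last exact: open_gt.
  move=> x _; apply: (@continuous_comp _ _ _ snd (fun t : R => `|t|)).
    exact: cvg_snd.
  exact: norm_continuous.
have ofar : open ([set x : R * R | M < `|x.1|] `|` [set x : R * R | M < `|x.2|]) by exact: openU.
have farP x : (M < `|x.1|) || (M < `|x.2|) ->
    ([set x : R * R | M < `|x.1|] `|` [set x : R * R | M < `|x.2|]) x.
  by move=> /orP.
have f0 x : ([set x : R * R | M < `|x.1|] `|` [set x : R * R | M < `|x.2|]) x -> f x = 0.
  by move=> [/ltW xM|/ltW xM]; apply: fM; rewrite xM ?orbT.
have zero (h h1 h2 : R * R -> R) : partials setT h h1 h2 ->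
    (forall x, (M < `|x.1|) || (M < `|x.2|) -> h x = 0) ->
    forall x, (M < `|x.1|) || (M < `|x.2|) -> h1 x = 0 /\ h2 x = 0.
  move=> ph h0 [a b] /farP xM.
  have [d1 d2] := ph a b Logic.I.
  have z1 : is_derive a 1 (fun t : R => h (t, b)) 0.
    apply: near_eq_is_derive (is_derive_cst 0 a 1).
    by apply: filterS (open_line1 ofar xM) => t /= tM; rewrite h0//; apply/orP.
  have z2 : is_derive b 1 (fun t : R => h (a, t)) 0.
    apply: near_eq_is_derive (is_derive_cst 0 b 1).
    by apply: filterS (open_line2 ofar xM) => t /= tM; rewrite h0//; apply/orP.
  split.
    by have [_ <-] := d1; have [_ ->] := z1.
  by have [_ <-] := d2; have [_ ->] := z2.
have z x : (M < `|x.1|) || (M < `|x.2|) -> f x = 0 by move=> /farP; exact: f0.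
have z1 := zero _ _ _ pf z.
have z11 := zero _ _ _ pf1 (fun x xM => (z1 x xM).1).
have z22 := zero _ _ _ pf2 (fun x xM => (z1 x xM).2).
have [B1 HB1] := continuous_supported_bounded (cc _ c1) (fun x xM => (z1 x xM).1).
have [B2 HB2] := continuous_supported_bounded (cc _ c2) (fun x xM => (z1 x xM).2).
have [B11 HB11] := continuous_supported_bounded (cc _ c11) (fun x xM => (z11 x xM).1).
have [B22 HB22] := continuous_supported_bounded (cc _ c22) (fun x xM => (z22 x xM).2).
exists (Num.max B1 B2), (Num.max B11 B22); split=> [b|a].
  exists (fun a => f1 (a, b)), (fun a => f11 (a, b)); split.
  - by move=> a; have [] := pf a b Logic.I.
  - by move=> a; have [] := pf1 a b Logic.I.
  - move=> a; apply: (@continuous_comp _ _ _ (fun a => (a, b)) f11); last exact: c11.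
    exact: continuous_pairl.
  - by split=> a; rewrite le_max ?HB1 ?HB11.
  - by move=> a aM; apply: fM; rewrite aM.
exists (fun b => f2 (a, b)), (fun b => f22 (a, b)); split.
- by move=> b; have [] := pf a b Logic.I.
- by move=> b; have [] := pf2 a b Logic.I.
- move=> b; apply: (@continuous_comp _ _ _ (fun b => (a, b)) f22); last exact: c22.
  exact: continuous_pairr.
- by split=> b; rewrite le_max ?HB2 ?HB22 orbT.
- by move=> b bM; apply: fM; rewrite bM orbT.
Qed.

End Ck.

(** * The windows *)

Section Windows.
Variable R : realType.
Implicit Types (r t : R) (xi : R * R).

Lemma smooth_is_derive (f : R -> R) : smooth f -> forall n (x : R),
  is_derive x 1 (derive1n n f) (derive1n n.+1 f x).
Proof.
by move=> fs n x; rewrite derive1nS derive1E; apply: DeriveDef => //; exact: fs.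
Qed.

(** The support is closed, hence at a positive distance from both ends. *)
Lemma window_gap (f : R -> R) (a b : R) :
  closure [set r | f r != 0] `<=` `]a, b[ ->
  exists2 eta, 0 < eta & forall r, f r != 0 -> a + eta <= r <= b - eta.
Proof.
move=> fab; have cl := @closed_closure _ [set r | f r != 0].
have far c : ~ (`]a, b[%classic : set R) c -> exists2 eta, 0 < eta &
    forall r, f r != 0 -> eta <= `|c - r|.
  move=> cab; have nc : (~` closure [set r | f r != 0]) c by move=> /fab.
  have : nbhs c (~` closure [set r | f r != 0]).
    by apply: open_nbhs_nbhs; split=> //; exact: closed_openC.
  move=> /nbhs_ballP[e /= e0 eP]; exists e => // r fr.
  rewrite leNgt; apply/negP => cr.
  have : (~` closure [set r | f r != 0]) r by apply: eP.
  by apply; exact: subset_closure.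
have [|ea ea0 Ha] := far a; first by rewrite /= in_itv/= ltxx.
have [|eb eb0 Hb] := far b; first by rewrite /= in_itv/= ltxx andbF.
exists (Num.min ea eb); first by rewrite lt_min ea0.
move=> r fr; have : (`]a, b[%classic : set R) r by apply: fab; exact: subset_closure.
rewrite /= in_itv/= => /andP[ar rb].
have := Ha _ fr; have := Hb _ fr; rewrite gtr0_norm ?subr_gt0// distrC gtr0_norm ?subr_gt0//.
have := ge_min ea ea eb; rewrite lexx /=.
have := ge_min eb ea eb; rewrite lexx orbT/=.
move=> m1 m2 h1 h2; apply/andP; split; lra.
Qed.

Lemma enorm_ge0 xi : 0 <= enorm xi. Proof. exact: sqrtr_ge0. Qed.

Lemma enormE xi : enorm xi = Num.sqrt (xi.1 * xi.1 + xi.2 * xi.2).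
Proof. by rewrite /enorm !expr2. Qed.

Lemma sqr_enorm xi : enorm xi ^+ 2 = xi.1 ^+ 2 + xi.2 ^+ 2.
Proof. by rewrite sqr_sqrtr// addr_ge0 ?sqr_ge0. Qed.

Lemma norm1_le_enorm xi : `|xi.1| <= enorm xi.
Proof. by rewrite -sqrtr_sqr ler_wsqrtr// lerDl sqr_ge0. Qed.

Lemma norm2_le_enorm xi : `|xi.2| <= enorm xi.
Proof. by rewrite -sqrtr_sqr ler_wsqrtr// lerDr sqr_ge0. Qed.

Lemma continuous_enorm : continuous (@enorm R).
Proof.
move=> x; apply: (@continuous_comp _ _ _ (fun x : R * R => x.1 ^+ 2 + x.2 ^+ 2) Num.sqrt);
  last exact: sqrt_continuous.
apply: cvgD.
- by apply: (@continuous_comp _ _ _ fst (fun t : R => t ^+ 2));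
    [exact: cvg_fst|exact: exprn_continuous].
- by apply: (@continuous_comp _ _ _ snd (fun t : R => t ^+ 2));
    [exact: cvg_snd|exact: exprn_continuous].
Qed.

Lemma open_enorm_lt r : open [set xi : R * R | enorm xi < r].
Proof.
apply: (@open_comp _ _ (@enorm R) [set t | t < r]); last exact: open_lt.
by move=> x _; exact: continuous_enorm.
Qed.

Lemma open_enorm_gt r : open [set xi : R * R | r < enorm xi].
Proof.
apply: (@open_comp _ _ (@enorm R) [set t | r < t]); last exact: open_gt.
by move=> x _; exact: continuous_enorm.
Qed.

Lemma Ck_enorm k D : (forall xi, D xi -> 0 < enorm xi) -> Ck k D (@enorm R).
Proof.
move=> D0; have -> : @enorm R = (fun xi => Num.sqrt (xi.1 * xi.1 + xi.2 * xi.2)).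
  by apply/funext => xi; rewrite enormE.
apply: Ck_sqrt; first by move=> xi /D0; rewrite enormE sqrtr_gt0.
by apply: CkD; apply: CkM; try exact: Ck_fst; exact: Ck_snd.
Qed.

Lemma polar_angle_atan xi : 0 < xi.1 -> polar_angle xi = atan (xi.2 / xi.1).
Proof.
move=> x0; have pi0 := pi_gt0 R.
pose a := atan (xi.2 / xi.1).
have a1 := atan_gtNpi2 (xi.2 / xi.1); have a2 := atan_ltpi2 (xi.2 / xi.1).
have r0 : 0 < enorm xi by apply: lt_le_trans (norm1_le_enorm xi); rewrite gtr0_norm.
have cosa : xi.1 / enorm xi = cos a.
  rewrite /a cos_atan.
  have -> : 1 + (xi.2 / xi.1) ^+ 2 = (enorm xi / xi.1) ^+ 2.
    by rewrite !expr_div_n sqr_enorm; field; rewrite gt_eqF.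
  by rewrite sqrtr_sqr gtr0_norm ?divr_gt0// invf_div.
rewrite /polar_angle cosa; case: ifPn => x2.
  rewrite cosK// in_itv/=; apply/andP; split; last by rewrite /a; lra.
  by rewrite /a -(@atan0 R) le_atan// divr_ge0 ?(ltW x0)// ltW.
rewrite cosKN ?opprK//; apply/andP; split; first by rewrite /a; lra.
rewrite /a -(@atan0 R) le_atan// mulr_le0_ge0 ?invr_ge0 ?(ltW x0)//.
by rewrite leNgt.
Qed.

(** In both half-planes the absolute value of the polar angle is the arccosine,
    a decreasing function, of [xi.1 / enorm xi]. *)
Lemma norm_polar_angle_gt xi t : 0 <= t -> t <= pi -> 0 < enorm xi ->
  xi.1 < cos t * enorm xi -> t < `|polar_angle xi|.
Proof.
move=> t0 tpi r0 xt; pose u := xi.1 / enorm xi.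
have u1 : -1 <= u <= 1.
  by rewrite -ler_norml /u normf_div (gtr0_norm r0) ler_pdivrMr// mul1r norm1_le_enorm.
have ut : u < cos t by rewrite /u ltr_pdivrMr.
have -> : `|polar_angle xi| = acos u.
  by rewrite /polar_angle -/u; case: ifP => _; rewrite ?normrN ger0_norm// acos_ge0.
rewrite ltNge; apply/negP => ac.
have : cos t <= cos (acos u).
  have a0 := acos_ge0 u1; have a1 := acos_lepi u1.
  move: ac; rewrite le_eqVlt => /orP[/eqP->//|ac].
  by rewrite ltW// ltr_cos// in_itv/= ?t0 ?a0.
by rewrite acosK ?in_itv//= leNgt ut.
Qed.

Section CurveletWindow.
Variables (W V : R -> R) (j : nat).
Hypotheses (hW : radial_window W) (hV : angular_window V).

Definition curvelet_symbol xi : R :=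
  (2 : R) `^ (- (3 * j%:R / 4)) * W (2 ^- j * enorm xi) *
   V (2 ^+ (uphalf j).+1 / pi * polar_angle xi).

Lemma radial_window0 r : r <= 1 / 2 \/ 2 <= r -> W r = 0.
Proof.
have [_ sW _] := hW; have [eta eta0 H] := window_gap sW.
move=> rr; apply/eqP/negPn/negP => /H /andP[? ?]; case: rr => ?; lra.
Qed.

Lemma curvelet_symbol_supported : supported (2 ^+ j.+1) curvelet_symbol.
Proof.
move=> xi xj; have r : 2 ^+ j.+1 <= enorm xi.
  by move: xj => /orP[xj|xj]; apply: (le_trans xj);
    [exact: norm1_le_enorm|exact: norm2_le_enorm].
rewrite /curvelet_symbol [W _]radial_window0 ?mulr0 ?mul0r//; right.
rewrite mulrC ler_pdivlMr ?exprn_gt0//; apply: le_trans r.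
by rewrite exprS.
Qed.

(** Three open sets cover the plane: the right half-plane, where the polar angle
    is an arctangent and the norm is smooth; the complement of a cone around the
    positive first axis, where the angular window vanishes; and a disk around
    the origin, where the radial window vanishes. *)
Lemma curvelet_symbol_Ck : Ck 2 setT curvelet_symbol.
Proof.
have [sW W2 _] := hW; have [sV V1 _] := hV; have pi0 := pi_gt0 R.
have [eta eta0 HV] := window_gap V1.
pose kappa : R := 2 ^+ (uphalf j).+1 / pi.
have kappa2 : 2 / pi <= kappa.
  rewrite /kappa ler_wpM2r ?invr_ge0 ?(ltW pi0)// exprS ler_peMr//.
  by rewrite exprn_ege1// ler1n.
have kappa0 : 0 < kappa by apply: lt_le_trans kappa2; rewrite divr_gt0.
pose eps : R := Num.min eta 2^-1.
have eps0 : 0 < eps by rewrite lt_min eta0/= invr_gt0.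
have eps1 : eps <= 2^-1 by rewrite ge_min lexx orbT.
have epseta : eps <= eta by rewrite ge_min lexx.
(* Half the opening of the cone: the angular window is supported in polar
   angles of absolute value at most [t], and [t < pi / 2] because
   [kappa >= 2 / pi]. *)
pose t := (1 - eps) / kappa.
have t0 : 0 <= t by rewrite divr_ge0 ?(ltW kappa0)//; lra.
have tpi : t < pi / 2.
  rewrite /t ltr_pdivrMr//.
  have : 1 <= pi / 2 * kappa.
    have pi20 : 0 <= pi / 2 :> R by rewrite divr_ge0// ltW.
    have E : pi / 2 * (2 / pi) = 1 :> R by rewrite mulrA divfK// mulfV// gt_eqF.
    by rewrite -[leLHS]E ler_wpM2l.
  lra.
have ct0 : 0 < cos t by apply: cos_gt0_pihalf; apply/andP; split; lra.
pose U : set (R * R) := [set xi | 0 < xi.1].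
pose E1 : set (R * R) := [set xi | xi.1 < cos t * enorm xi].
pose E2 : set (R * R) := [set xi | enorm xi < 2^-1 * 2 ^+ j].
have oU : open U.
  apply: (@open_comp _ _ (fun x : R * R => x.1) [set t | 0 < t]); last exact: open_gt.
  by move=> x _; exact: cvg_fst.
have oE1 : open E1.
  have -> : E1 = (fun xi : R * R => cos t * enorm xi - xi.1) @^-1` [set t | 0 < t].
    by apply/seteqP; split=> xi; rewrite /E1/= subr_gt0.
  apply: open_comp; last exact: open_gt.
  move=> x _; apply: cvgB; last exact: cvg_fst.
  by apply: cvgM; [exact: cvg_cst|exact: continuous_enorm].
have oE2 : open E2 by exact: open_enorm_lt.
have UE : setT = U `|` (E1 `|` E2).
  apply/seteqP; split=> // xi _.
  have [x1|x1] := ltP 0 xi.1; first by left.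
  right; have [r0|r0] := ltP 0 (enorm xi).
    by left; rewrite /E1/=; apply: (le_lt_trans x1); rewrite mulr_gt0.
  by right; rewrite /E2/=; apply: (le_lt_trans r0); rewrite mulr_gt0 ?exprn_gt0// invr_gt0.
have oE : open (E1 `|` E2) by exact: openU.
rewrite UE; apply: Ck_setU => //.
  apply: (@eq_Ck _ _ _ (fun xi => (2 : R) `^ (- (3 * j%:R / 4)) *
      derive1n 0 W (2 ^- j * enorm xi) *
      derive1n 0 V (kappa * atan (xi.2 * xi.1^-1)))) => //.
    by move=> xi x0; rewrite /curvelet_symbol polar_angle_atan.
  apply: CkM.
    apply: CkM; first exact: Ck_cst.
    apply: (@Ck_comp _ _ _ (fun xi => 2 ^- j * enorm xi) (fun n => derive1n n W)).
      exact: smooth_is_derive.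
    apply: CkM; first exact: Ck_cst.
    apply: Ck_enorm => xi x0; apply: lt_le_trans (norm1_le_enorm xi).
    by rewrite gtr0_norm.
  apply: (@Ck_comp _ _ _ (fun xi => kappa * atan (xi.2 * xi.1^-1)) (fun n => derive1n n V)).
    exact: smooth_is_derive.
  apply: CkM; first exact: Ck_cst.
  apply: Ck_atan; apply: CkM; first exact: Ck_snd.
  by apply: Ck_inv; [move=> xi x0; rewrite gt_eqF|exact: Ck_fst].
apply: (@eq_Ck _ _ _ (fun=> 0)) => //; last exact: Ck_cst.
move=> xi xE; apply/esym; rewrite /curvelet_symbol.
have [r0|r0] := ltP (enorm xi) (2^-1 * 2 ^+ j).
  rewrite [W _]radial_window0 ?mulr0 ?mul0r//; left.
  by rewrite mulrC ler_pdivrMr ?exprn_gt0// ltW// mul1r.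
have {}xE : E1 xi by case: xE => //; rewrite /E2/= ltNge r0.
have r1 : 0 < enorm xi by apply: lt_le_trans r0; rewrite mulr_gt0 ?exprn_gt0// invr_gt0.
have tpi' : t <= pi by lra.
have at_ := norm_polar_angle_gt t0 tpi' r1 xE.
rewrite [V _](_ : _ = 0) ?mulr0//.
apply/eqP/negPn/negP => /HV; rewrite -/kappa => /andP[v1 v2].
have : `|kappa * polar_angle xi| <= 1 - eps by rewrite ler_norml; apply/andP; split; lra.
rewrite normrM (gtr0_norm kappa0) leNgt => /negP; apply.
by move: at_; rewrite /t ltr_pdivrMr// mulrC.
Qed.

End CurveletWindow.

Section LowpassWindow.
Variables (W W0 : R -> R).
Hypotheses (hW : radial_window W) (hW0 : lowpass_window W W0).

Lemma radial_window_continuous : continuous W.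
Proof.
have [sW _ _] := hW; exact: (is_derive_continuous (smooth_is_derive sW 0)).
Qed.

Let W2_ge0 (x : R) : (0 <= (W x ^+ 2)%:E)%E.
Proof. by rewrite lee_fin sqr_ge0. Qed.

(** Rescaled to [2 ^ - m * r], the dyadic partition of unity splits into the
    terms of index at most [m], whose sum is [1 - W0 r ^+ 2], the term of index
    [m + 1], which is [W (2 * r) ^+ 2], and terms that vanish. *)
Lemma lowpass_sqr_dyadic (r : R) (m : int) : 1 / 2 <= r ->
  3 / 4 < (2 : R) ^ (- m) * r < 3 / 2 -> W0 r ^+ 2 = W (2 * r) ^+ 2.
Proof.
move=> r12 rm; have [_ _ Wsum] := hW; have [_ W0sum] := hW0.
have two0 : (2 : R) != 0 by [].
have scale (i : int) : (2 : R) ^ i * ((2 : R) ^ (- m) * r) = (2 : R) ^ (i - m) * r.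
  by rewrite mulrA -expfzDr.
have := Wsum _ rm; rewrite (esumID [set i : int | i <= m])//.
have -> : [set: int] `&` [set i : int | i <= m] = (fun j : nat => m - j%:Z) @` [set: nat].
  apply/seteqP; split=> [i [_ /= im]|_ [j _ <-]]; last by split=> //=; lia.
  by exists `|m - i|%N => //; lia.
rewrite esum_image; last by move=> i j _ _ /= ij; lia.
rewrite (eq_esum (b := fun j : nat => (W (2 ^- j * r) ^+ 2)%:E)); last first.
  move=> j _; rewrite scale; congr ((W (_ * _) ^+ 2)%:E).
  by rewrite addrAC subrr add0r exprnN.
rewrite (esumID [set m + 1])//.
have -> : ([set: int] `&` ~` [set i : int | i <= m]) `&` [set m + 1] = [set m + 1].
  by apply/seteqP; split=> [i []//|i /= ->]; split=> //; split=> //=; lia.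
rewrite esum_set1// [X in (_ + (_ + X))%E](_ : _ = 0%E) ?adde0; last first.
  apply: esum1 => i [[_ /= im] /= im1]; rewrite scale.
  suff -> : W ((2 : R) ^ (i - m) * r) = 0 by rewrite expr0n.
  apply: (radial_window0 hW); right.
  have [n ->] : exists n : nat, i - m = n.+2%:Z by exists (absz (i - m - 2)%R); lia.
  rewrite -exprnP !exprS mulrA -mulrA.
  have n1 : 1 <= 2 ^+ n :> R by rewrite exprn_ege1// ler1n.
  have r0 : 0 <= r by lra.
  by have := ler_peMl r0 n1; lra.
have -> : (2 : R) ^ (m + 1) * ((2 : R) ^ (- m) * r) = 2 * r.
  by rewrite scale; congr (_ * _); rewrite addrAC subrr add0r expr1z.
have := W0sum r (le_trans (divr_ge0 ler01 (ler0n _ 2)) r12).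
case: (\esum_(j in _) _)%E => [S| |] //= [E1] [E2]; lra.
Qed.

Lemma dyadic_index (r : R) : 1 / 2 <= r -> exists m : int,
  3 / 4 <= (2 : R) ^ (- m) * r < 3 / 2.
Proof.
move=> r12; have two0 : (2 : R) != 0 by [].
have ex : exists n : nat, r < 3 / 4 * 2 ^+ n.
  exists (Num.truncn (2 * r)).+1.
  have h1 := truncnS_gt (2 * r).
  have h2 : (Num.truncn (2 * r)).+1%:R <= 2 ^+ (Num.truncn (2 * r)).+1 :> R.
    by rewrite -natrX ler_nat ltnW// ltn_expl.
  lra.
case: (ex_minnP ex) => n rn min; exists (n%:Z - 1).
have -> : (2 : R) ^ (- (n%:Z - 1)) = 2 * (2 ^+ n)^-1.
  by rewrite opprB expfzDr// expr1z -exprnN.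
have n0 : 0 < 2 ^+ n :> R by rewrite exprn_gt0.
rewrite -mulrA mulrCA ltr_pdivrMl// ler_pdivlMl//.
have lo : 3 / 8 * 2 ^+ n <= r.
  case: n rn min n0 => [|n] rn min n0; first by rewrite expr0; lra.
  rewrite leNgt; apply/negP => rn'.
  have : r < 3 / 4 * 2 ^+ n by move: rn'; rewrite exprS; lra.
  by move=> /min; rewrite ltnn.
by apply/andP; split; lra.
Qed.

(** Each [r] is the limit from the right of points to which the partition of
    unity applies, and both sides are continuous. *)
Lemma lowpass_sqr (r : R) : 1 / 2 <= r -> W0 r ^+ 2 = W (2 * r) ^+ 2.
Proof.
move=> r12; have [m /andP[m1 m2]] := dyadic_index r12.
have p0 : 0 < (2 : R) ^ (- m) by rewrite exprz_gt0.
pose d x := W0 x ^+ 2 - W (2 * x) ^+ 2.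
have cd : continuous d.
  move=> x; apply: cvgB.
    by apply: cvgM; exact: hW0.1.
  have cW2 : {for x, continuous (fun x : R => W (2 * x))}.
    apply: (@continuous_comp _ _ _ (fun x : R => 2 * x) W); last exact: radial_window_continuous.
    by apply: cvgM; [exact: cvg_cst|exact: cvg_id].
  by apply: cvgM; exact: cW2.
have e1 : d x @[x --> r^'+] --> d r by apply: cvg_at_right_filter; exact: cd.
have e2 : d x @[x --> r^'+] --> (0 : R).
  apply: cvg_near_cst; near=> x.
  have rx : r < x by near: x; exact: nbhs_right_gt.
  have xr : x < 3 / 2 / (2 : R) ^ (- m).
    by near: x; apply: nbhs_right_lt; rewrite ltr_pdivlMr// mulrC.
  apply/eqP; rewrite subr_eq0; apply/eqP; apply: (@lowpass_sqr_dyadic _ m); first by lra.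
  move: xr; rewrite ltr_pdivlMr// mulrC => ->; rewrite andbT.
  by apply: (le_lt_trans m1); rewrite ltr_pM2l.
have : d r = 0 by apply: (cvg_unique _ e1 e2); exact: Rhausdorff.
by move=> /eqP; rewrite /d subr_eq0 => /eqP.
Unshelve. all: by end_near. Qed.

Lemma lowpass_sqr1 : exists2 eta, 0 < eta &
  forall r, 0 <= r -> r < 1 / 2 + eta -> W0 r ^+ 2 = 1.
Proof.
have [_ W2 _] := hW; have [eta eta0 H] := window_gap W2; exists eta => // r r0 reta.
have [_ /(_ r r0)] := hW0; rewrite esum1 ?sube0; first by case.
move=> j _; suff -> : W (2 ^- j * r) = 0 by rewrite expr0n.
apply/eqP/negPn/negP => /H /andP[h _].
have : 2 ^- j * r <= r.
  by rewrite ler_piMl// invf_le1 ?exprn_gt0// exprn_ege1// ler1n.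
by lra.
Qed.

(** A function with the same square as the low-pass window, and smooth even where
    the two cases meet, since [W] is constant to the right of 1. *)
Definition lowpass_root xi : R := if enorm xi <= 1 / 2 then W 1 else W (2 * enorm xi).

Lemma lowpass_root_sqr xi : W0 (enorm xi) ^+ 2 = lowpass_root xi ^+ 2.
Proof.
rewrite /lowpass_root; case: ifPn => [r|]; last by rewrite -ltNge => /ltW/lowpass_sqr.
have [eta eta0 H] := lowpass_sqr1.
rewrite (H _ (enorm_ge0 _)); last by lra.
have := @lowpass_sqr (1 / 2) (lexx _); rewrite H//; last by lra.
by rewrite mulrA mulr1 mulfV.
Qed.

Lemma lowpass_root_supported : supported 1 lowpass_root.
Proof.
move=> xi x1; have r : 1 <= enorm xi.
  by move: x1 => /orP[x1|x1]; apply: (le_trans x1);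
    [exact: norm1_le_enorm|exact: norm2_le_enorm].
rewrite /lowpass_root; case: ifPn => [|_]; first by lra.
by apply: (radial_window0 hW); right; lra.
Qed.

(** The square of [W] is 1 on an interval to the right of 1, and therefore [W]
    is constant there. *)
Lemma lowpass_root_Ck : Ck 2 setT lowpass_root.
Proof.
have [sW _ _] := hW; have [eta eta0 H] := lowpass_sqr1.
have W1 (x : R) : 1 <= x -> x < 1 + 2 * eta -> W x ^+ 2 = 1.
  move=> x1 x2; have -> : x = 2 * (x / 2) by field.
  by rewrite -lowpass_sqr ?H//; lra.
have Wcst (x : R) : 1 <= x -> x < 1 + 2 * eta -> W x = W 1.
  move=> x1 x2; have := W1 _ x1 x2.
  have := W1 1 (lexx _); move=> /(_ _)/wrap[|E1]; first by lra.
  move=> E2; have /eqP : W x ^+ 2 = W 1 ^+ 2 by rewrite E1 E2.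
  rewrite eqf_sqr => /orP[/eqP//|/eqP E]; exfalso.
  have [||c] := @IVT _ W 1 x 0 x1.
  - by apply: continuous_subspaceT; exact: radial_window_continuous.
  - rewrite E; have [|] := leP 0 (W 1) => h; rewrite ge_min le_max.
      by rewrite h oppr_le0 h orbT.
    by rewrite ltW//= oppr_ge0 (ltW h) orbT.
  rewrite in_itv/= => /andP[c1 c2] Wc.
  have := W1 c c1 (le_lt_trans c2 x2); rewrite Wc expr0n => /eqP.
  by rewrite eq_sym oner_eq0.
pose D1 : set (R * R) := [set xi | enorm xi < 1 / 2 + eta].
pose D2 : set (R * R) := [set xi | 1 / 2 < enorm xi].
have -> : setT = D1 `|` D2.
  apply/seteqP; split=> // xi _; have [h|h] := ltP (1 / 2) (enorm xi); first by right.
  by left; rewrite /D1/=; lra.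
apply: Ck_setU.
- exact: open_enorm_lt.
- exact: open_enorm_gt.
- apply: (@eq_Ck _ _ _ (fun=> W 1)); [exact: open_enorm_lt| |exact: Ck_cst].
  move=> xi; rewrite /D1/= => xD; rewrite /lowpass_root; case: ifPn => //.
  by rewrite -ltNge => h; rewrite Wcst//; lra.
- apply: (@eq_Ck _ _ _ (fun xi => derive1n 0 W (2 * enorm xi))).
  + exact: open_enorm_gt.
  + by move=> xi; rewrite /D2/= => h; rewrite /lowpass_root leNgt h.
  apply: (@Ck_comp _ _ _ (fun xi => 2 * enorm xi) (fun n => derive1n n W)).
    exact: smooth_is_derive.
  apply: CkM; first exact: Ck_cst.
  by apply: Ck_enorm => xi; rewrite /D2/= => h; lra.
Qed.

Lemma lowpass_neq0 : W0 0 != 0.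
Proof.
have [eta eta0 H] := lowpass_sqr1; apply/eqP => E.
have : W0 0 ^+ 2 = 1 by apply: H => //; lra.
by rewrite E expr0n => /eqP; rewrite eq_sym oner_eq0.
Qed.

Lemma continuous_lowpass_symbol : continuous (fun xi => W0 (enorm xi)).
Proof.
move=> x; apply: (@continuous_comp _ _ _ (@enorm R) W0); last exact: hW0.1.
exact: continuous_enorm.
Qed.

End LowpassWindow.

End Windows.

(** * Slices *)

Section Slices.
Variable R : realType.
Local Notation plane := (measurableTypeR R * measurableTypeR R)%type.
Local Notation leb1 := (leb1 R).
Local Notation leb2 := (leb2 R).
Local Notation integrable1 f := (leb1.-integrable setT (EFin \o f)).
Local Notation integrable2 f := (leb2.-integrable setT (EFin \o f)).
Implicit Types (f g : R * R -> R).

Let leb1s : {sigma_finite_measure set (measurableTypeR R) -> \bar R} :=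
  @lebesgue_measure R.

Lemma line_rot (theta s t : R) : line theta s t = Defs.rot (- theta) (s, t).
Proof.
by rewrite /line /Defs.rot/= cosN sinN opprK; congr (_, _); ring.
Qed.

Lemma sqr_rot (eta : R) (x : R * R) :
  (Defs.rot eta x).1 ^+ 2 + (Defs.rot eta x).2 ^+ 2 = x.1 ^+ 2 + x.2 ^+ 2.
Proof.
rewrite /Defs.rot/=.
transitivity ((cos eta ^+ 2 + sin eta ^+ 2) * (x.1 ^+ 2 + x.2 ^+ 2)); first by ring.
by rewrite cos2Dsin2 mul1r.
Qed.

Definition direction (theta : R) : R * R := (cos theta, sin theta).

Lemma dot_line (theta s t : R) : dot (line theta s t) (direction theta) = s.
Proof.
rewrite /dot /line/=.
transitivity ((cos theta ^+ 2 + sin theta ^+ 2) * s); first by ring.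
by rewrite cos2Dsin2 mul1r.
Qed.

Lemma continuous_line (theta s : R) : continuous (line theta s : R -> R * R).
Proof.
move=> t; rewrite /line.
have c1 : (s * cos theta - x * sin theta) @[x --> t] --> s * cos theta - t * sin theta.
  by apply: cvgB; [exact: cvg_cst|apply: cvgM; [exact: cvg_id|exact: cvg_cst]].
have c2 : (s * sin theta + x * cos theta) @[x --> t] --> s * sin theta + t * cos theta.
  by apply: cvgD; [exact: cvg_cst|apply: cvgM; [exact: cvg_id|exact: cvg_cst]].
exact: (@cvg_pair _ _ _ (nbhs t) (nbhs (s * cos theta - t * sin theta))
  (nbhs (s * sin theta + t * cos theta)) _ _ _ _ _ c1 c2).
Qed.

Lemma continuous_line_offset (theta t : R) : continuous (fun s => line theta s t : R * R).
Proof.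
move=> s; rewrite /line.
have c1 : (x * cos theta - t * sin theta) @[x --> s] --> s * cos theta - t * sin theta.
  by apply: cvgB; [apply: cvgM; [exact: cvg_id|exact: cvg_cst]|exact: cvg_cst].
have c2 : (x * sin theta + t * cos theta) @[x --> s] --> s * sin theta + t * cos theta.
  by apply: cvgD; [apply: cvgM; [exact: cvg_id|exact: cvg_cst]|exact: cvg_cst].
exact: (@cvg_pair _ _ _ (nbhs s) (nbhs (s * cos theta - t * sin theta))
  (nbhs (s * sin theta + t * cos theta)) _ _ _ _ _ c1 c2).
Qed.

Section DecayingFunction.
Variables (f : R * R -> R) (b : R * R) (K : R).
Hypotheses (cf : continuous f) (fi : integrable2 f) (K0 : 0 <= K).
Hypothesis fK : forall x,
  `|f x| <= K / (1 + (x - b).1 ^+ 2 + (x - b).2 ^+ 2).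
Variable theta : R.

Let beta : R * R := Defs.rot theta b.

Let line_sub s t :
  (line theta s t - b).1 ^+ 2 + (line theta s t - b).2 ^+ 2 =
  (s - beta.1) ^+ 2 + (t - beta.2) ^+ 2.
Proof.
rewrite /beta /line /Defs.rot/=.
pose L : R := s * (cos theta * b.1 + sin theta * b.2) +
  t * (- sin theta * b.1 + cos theta * b.2).
transitivity ((cos theta ^+ 2 + sin theta ^+ 2) * (s ^+ 2 + t ^+ 2) - 2 * L +
   (b.1 ^+ 2 + b.2 ^+ 2)); first by rewrite /L; ring.
transitivity (s ^+ 2 + t ^+ 2 - 2 * L +
   (cos theta ^+ 2 + sin theta ^+ 2) * (b.1 ^+ 2 + b.2 ^+ 2)).
  by rewrite cos2Dsin2 !mul1r.
by rewrite /L; ring.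
Qed.

Let f_line_le s t : `|f (line theta s t)| <= K * poisson 1 (t - beta.2).
Proof.
apply: (le_trans (fK _)); rewrite /poisson expr1n mul1r ler_wpM2l//.
rewrite lef_pV2 ?posrE; last 2 first.
- by rewrite -addrA ltr_pwDl// addr_ge0// sqr_ge0.
- by rewrite ltr_pwDl// sqr_ge0.
by rewrite -addrA line_sub lerD2l lerDr sqr_ge0.
Qed.

Let majorant_integrable : integrable1 (fun t => K * poisson 1 (t - beta.2)).
Proof.
apply: RintegrableZl; exact: (integrable_measure_preserving
  (measure_preserving_shift (- beta.2)) (integrable_poisson (@ltr01 R))).
Qed.

(** On a line the decay of [f] is that of a translate of the Poisson kernel. *)
Lemma integrable_line s : integrable1 (fun t => f (line theta s t)).
Proof.
have mf : measurable_fun [set: measurableTypeR R] (fun t => f (line theta s t)).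
  apply: continuous_measurable_fun => t.
  apply: (@continuous_comp _ _ _ (line theta s) f); last exact: cf.
  exact: continuous_line.
exact: (integrable_dominated mf (f_line_le s) majorant_integrable).
Qed.

Let slice s := Rintegral leb1 setT (fun t => f (line theta s t)).

Let continuous_slice : continuous slice.
Proof.
move=> s; have sI : s \in (`](s - 1), (s + 1)[%classic : set R).
  by rewrite inE/= in_itv/=; apply/andP; split; lra.
apply: (@continuity_under_integral _ _ _ leb1 (fun s t => f (line theta s t)) setT
  measurableT (s - 1) (s + 1) _ _ _ majorant_integrable _ s sI).
- by move=> x _; exact: integrable_line.
- apply: aeW => t _ x _.
  apply: (@continuous_comp _ _ _ (fun s => line theta s t) f); last exact: cf.
  exact: continuous_line_offset.
- by move=> x _; apply: aeW => t _; exact: f_line_le.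
Qed.

Let slice_bounded s :
  `|slice s| <= Rintegral leb1 setT (fun t => K * poisson 1 (t - beta.2)).
Proof.
apply: (le_trans (le_normr_Rintegral measurableT (integrable_line s))).
by apply: le_Rintegral => //; apply: integrable_norm; exact: integrable_line.
Qed.

(** The slice theorem: integrating a function of the offset against the slice
    is integrating over the plane, in rotated coordinates. *)
Let slice_moment (k : R -> R) : measurable_fun [set: R] k -> (forall s, `|k s| <= 1) ->
  Rintegral leb1 setT (fun s => slice s * k s) =
  Rintegral leb2 setT (fun x : plane => f x * k (dot x (direction theta))).
Proof.
move=> mk k1.
have mdk : measurable_fun [set: plane] (fun x : plane => k (dot x (direction theta))).
  apply: (measurableT_comp mk).
  by apply: measurable_funD; apply: measurable_funM.
have fki : integrable2 (fun x => f x * k (dot x (direction theta))).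
  exact: (integrableM_bounded fi mdk (fun x => k1 _)).
have mp := measure_preserving_rot (- theta).
have fkri := integrable_measure_preserving mp fki.
rewrite -(Rintegral_measure_preserving mp fki).
have E : (fun x : R * R => f x * k (dot x (direction theta))) \o Defs.rot (- theta) =
    (fun z : R * R => f (line theta z.1 z.2) * k z.1).
  by apply/funext => -[s t] /=; rewrite -line_rot dot_line.
rewrite E in fkri *.
rewrite -(@Rfubini _ _ _ _ _ leb1s leb1s _ fkri).
  apply: eq_Rintegral => s _ /=; rewrite RintegralZr//; exact: integrable_line.
move=> s /=; apply: (integrableM_bounded (integrable_line s) (measurable_cst (k s))).
by move=> t; exact: (k1 s).
Qed.

Let integrable_slice : integrable1 slice.
Proof.
have mp := measure_preserving_rot (- theta).
have fri := integrable_measure_preserving mp fi.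
have E : f \o Defs.rot (- theta) = (fun z : R * R => f (line theta z.1 z.2)).
  by apply/funext => -[s t] /=; rewrite -line_rot.
rewrite E in fri.
apply: eq_integrable (@integrable_fubini_F _ _ _ _ _ leb1s leb1s _ fri) => // s _.
by rewrite /fubini_F /slice /= Rintegral_EFin//; exact: integrable_line.
Qed.

Lemma Rintegral_line_eq0 :
  (forall sigma, Rintegral leb2 setT
     (fun x : plane => f x * cos (sigma * dot x (direction theta))) = 0) ->
  (forall sigma, Rintegral leb2 setT
     (fun x : plane => f x * sin (sigma * dot x (direction theta))) = 0) ->
  forall s, Rintegral leb1 setT (fun t => f (line theta s t)) = 0.
Proof.
move=> fcos fsin; apply: (fourier_uniqueness continuous_slice slice_bounded integrable_slice).
- move=> sigma; rewrite (@slice_moment (fun s => cos (sigma * s)))//.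
    exact: measurable_cosM.
  by move=> s; exact: cos_max.
- move=> sigma; rewrite (@slice_moment (fun s => sin (sigma * s)))//.
    exact: measurable_sinM.
  by move=> s; exact: sin_max.
Qed.

End DecayingFunction.

(** * Curvelets *)

Lemma inv_fourier_real g x : inv_fourier (fun xi => (g xi)%:C%C) x =
  (((2 * pi)^-1 * cos_transform g x) +i* ((2 * pi)^-1 * sin_transform g x))%C.
Proof.
rewrite /inv_fourier /cintegral.
have -> : (@complex.Re R \o (fun xi => ((g xi)%:C%C * cis (dot x xi)))) =
    (fun xi => g xi * cos (dot x xi)).
  by apply/funext => xi /=; rewrite mul0r subr0.
have -> : (@complex.Im R \o (fun xi => ((g xi)%:C%C * cis (dot x xi)))) =
    (fun xi => g xi * sin (dot x xi)).
  by apply/funext => xi /=; rewrite mul0r addr0.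
by apply/eqP; rewrite eq_complex/= !mul0r subr0 addr0 !eqxx.
Qed.

Local Notation Re := (@complex.Re R).
Local Notation Im := (@complex.Im R).

Lemma fourier_eq0 (h : R * R -> R[i]) xi :
  integrable2 (Re \o h) -> integrable2 (Im \o h) -> fourier h xi = 0 ->
  Rintegral leb2 setT (fun x : plane => Re (h x) * cos (dot x xi)) +
  Rintegral leb2 setT (fun x : plane => Im (h x) * sin (dot x xi)) = 0 /\
  Rintegral leb2 setT (fun x : plane => Im (h x) * cos (dot x xi)) -
  Rintegral leb2 setT (fun x : plane => Re (h x) * sin (dot x xi)) = 0.
Proof.
move=> h1 h2.
have dotC x : dot x xi = dot xi x by rewrite /dot; ring.
have ic (k : R * R -> R) : integrable2 k -> integrable2 (fun x => k x * cos (dot x xi)).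
  move=> /(integrable_cos_dot xi); apply: eq_integrable => // x _ /=.
  by rewrite dotC.
have is_ (k : R * R -> R) : integrable2 k -> integrable2 (fun x => k x * sin (dot x xi)).
  move=> /(integrable_sin_dot xi); apply: eq_integrable => // x _ /=.
  by rewrite dotC.
have pi2 : (2 * pi)^-1 != 0 :> R by rewrite invr_eq0 mulf_neq0// gt_eqF// pi_gt0.
rewrite /fourier /cintegral.
have -> : Re \o (fun x : plane => h x * cis (- dot x xi)) =
    (fun x => Re (h x) * cos (dot x xi) + Im (h x) * sin (dot x xi)).
  by apply/funext => x /=; case: (h x) => u v /=; rewrite cosN sinN; ring.
have -> : Im \o (fun x : plane => h x * cis (- dot x xi)) =
    (fun x => Im (h x) * cos (dot x xi) - Re (h x) * sin (dot x xi)).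
  by apply/funext => x /=; case: (h x) => u v /=; rewrite cosN sinN; ring.
move=> /eqP; rewrite eq_complex/= !mul0r subr0 addr0 !mulf_eq0 (negbTE pi2)/=.
move=> /andP[/eqP <- /eqP E].
rewrite -(RintegralD measurableT (ic _ h1) (is_ _ h2)).
by rewrite -(RintegralB measurableT (ic _ h2) (is_ _ h1)).
Qed.

Lemma invisible_fourier_eq0 W V W0 (Phi : R) i xi : invisible W V W0 Phi i ->
  wedge Phi xi -> fourier (curvelet W V W0 i) xi = 0.
Proof.
move=> [_ H] xiP; apply/eqP/negPn/negP => fxi.
have : (csupp (fourier (curvelet W V W0 i)) `&` wedge Phi) xi.
  by split=> //; exact: subset_closure.
by rewrite H.
Qed.

Section Family.
Variables (W V W0 : R -> R).
Hypotheses (hW : radial_window W) (hV : angular_window V) (hW0 : lowpass_window W W0).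

Let lowpass_symbol (xi : R * R) : R := W0 (enorm xi).

Let lowpass_C2 : exists C1 C2 : R, C2_plane 1 C1 C2 (lowpass_root W).
Proof.
apply: Ck2_C2_plane; first exact: lowpass_root_Ck hW0.
exact: lowpass_root_supported.
Qed.

Let lowpass_integrable : integrable2 lowpass_symbol.
Proof.
have [C1 [C2 H]] := lowpass_C2.
have cl := continuous_lowpass_symbol hW0.
have sq := lowpass_root_sqr hW hW0.
exact: supported_integrable (continuous_measurable_plane cl)
  (sqrt_supported H sq) (sqrt_bounded ler01 H sq).
Qed.

(** The origin lies in the wedge, and the value there of the Fourier transform is
    a multiple of the integral of the function, which is not 0 by Fourier
    inversion at the origin. *)
Lemma lowpass_visible (Phi : R) (l : int) (k : int * int) : 0 < Phi ->
  ~ invisible W V W0 Phi (-1, l, k).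
Proof.
move=> Phi0 inv; have [C1 [C2 H]] := lowpass_C2.
have cl := continuous_lowpass_symbol hW0.
have sq := lowpass_root_sqr hW hW0.
have Ci := integrable_cos_transform_sqrt ler01 H cl sq.
have Si := integrable_sin_transform_sqrt ler01 H cl sq.
pose b : R * R := (k.1%:~R, k.2%:~R).
have E x : curvelet W V W0 (-1, l, k) x =
    (((2 * pi)^-1 * cos_transform lowpass_symbol (x - b)) +i*
     ((2 * pi)^-1 * sin_transform lowpass_symbol (x - b)))%C.
  by rewrite /= -inv_fourier_real.
have mp : measure_preserving leb2 (fun x : plane => x - b : plane).
  exact: measure_preserving_shift2.
have ReE : Re \o curvelet W V W0 (-1, l, k) =
    (fun x => (2 * pi)^-1 * cos_transform lowpass_symbol (x - b)).
  by apply/funext => x; rewrite -[LHS]/(Re (curvelet W V W0 (-1, l, k) x)) E.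
have ImE : Im \o curvelet W V W0 (-1, l, k) =
    (fun x => (2 * pi)^-1 * sin_transform lowpass_symbol (x - b)).
  by apply/funext => x; rewrite -[LHS]/(Im (curvelet W V W0 (-1, l, k) x)) E.
have Csi : integrable2 (fun x => cos_transform lowpass_symbol (x - b)).
  exact: (integrable_measure_preserving mp Ci).
have Ssi : integrable2 (fun x => sin_transform lowpass_symbol (x - b)).
  exact: (integrable_measure_preserving mp Si).
have w0 : wedge Phi (0 : R * R).
  by exists 0, 0; split; rewrite ?normr0 ?(ltW Phi0)// !mul0r.
have := fourier_eq0 (xi := 0) _ _ (invisible_fourier_eq0 inv w0).
rewrite ReE ImE => /(_ (RintegrableZl _ Csi) (RintegrableZl _ Ssi)) [H1 _].
have dot0 (x : R * R) : dot x 0 = 0 by rewrite /dot/= !mulr0 addr0.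
have : Rintegral leb2 setT (fun x : plane =>
    (2 * pi)^-1 * cos_transform lowpass_symbol (x - b)) = 0.
  move: H1; rewrite [X in _ + X](_ : _ = 0) ?addr0 => [<-|].
    apply: eq_Rintegral => x _; rewrite dot0 cos0 mulr1.
    by rewrite -[RHS]/((Re \o curvelet W V W0 (-1, l, k)) x) ReE.
  transitivity (Rintegral leb2 setT (fun _ : plane => 0 : R)).
    by apply: eq_Rintegral => x _; rewrite dot0 sin0 mulr0.
  by rewrite Rintegral_cst// mul0r.
rewrite RintegralZl// => /eqP; rewrite mulf_eq0 invr_eq0 mulf_eq0 pnatr_eq0/=.
rewrite gt_eqF ?pi_gt0//= => /eqP H2.
have C0 : Rintegral leb2 setT (cos_transform lowpass_symbol) = 0.
  by rewrite -(Rintegral_measure_preserving mp Ci).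
have := Rintegral_cos_transform_eq0 cl (sqrt_bounded ler01 H sq) lowpass_integrable Ci C0.
rewrite /lowpass_symbol /enorm/= !expr0n/= addr0 sqrtr0 => W00.
by have := lowpass_neq0 hW hW0; rewrite W00 eqxx.
Qed.

Section Scale.
Variables (j : nat) (l : int) (k : int * int).

Let g : R * R -> R := curvelet_symbol W V j.
Let M : R := 2 ^+ j.+1.
Let b : R * R := curvelet_center R j l k.
Let eta : R := curvelet_angle R j l.
Let place (x : R * R) : R * R := Defs.rot eta (x - b).

Let M0 : 0 <= M. Proof. by rewrite exprn_ge0. Qed.

Let g_supported : supported M g.
Proof. exact: curvelet_symbol_supported. Qed.

Let g_C2 : exists C1 C2 : R, C2_plane M C1 C2 g.
Proof. by apply: Ck2_C2_plane g_supported; exact: curvelet_symbol_Ck. Qed.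

Let g_continuous : continuous g.
Proof. by move=> x; exact: Ck_continuous (curvelet_symbol_Ck j hW hV) _. Qed.

Let g_integrable : integrable2 g.
Proof.
have [C1 [C2 H]] := g_C2.
exact: supported_integrable (continuous_measurable_plane g_continuous) g_supported
  (C2_plane_bounded M0 H).
Qed.

Let psi := curvelet W V W0 (Posz j, l, k).

Let psiE x : psi x = (((2 * pi)^-1 * cos_transform g (place x)) +i*
                      ((2 * pi)^-1 * sin_transform g (place x)))%C.
Proof. by rewrite /psi /= -inv_fourier_real. Qed.

Let Re_psiE : Re \o psi = (fun x => (2 * pi)^-1 * cos_transform g (place x)).
Proof. by apply/funext => x; rewrite -[LHS]/(Re (psi x)) psiE. Qed.

Let Im_psiE : Im \o psi = (fun x => (2 * pi)^-1 * sin_transform g (place x)).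
Proof. by apply/funext => x; rewrite -[LHS]/(Im (psi x)) psiE. Qed.

Let place_continuous : continuous place.
Proof.
move=> x.
have s1 : (y.1 - b.1) @[y --> x] --> x.1 - b.1.
  by apply: cvgB; [exact: cvg_fst|exact: cvg_cst].
have s2 : (y.2 - b.2) @[y --> x] --> x.2 - b.2.
  by apply: cvgB; [exact: cvg_snd|exact: cvg_cst].
have r1 : (cos eta * (y.1 - b.1) + sin eta * (y.2 - b.2)) @[y --> x] -->
    cos eta * (x.1 - b.1) + sin eta * (x.2 - b.2).
  by apply: cvgD; apply: cvgM => //; exact: cvg_cst.
have r2 : (- sin eta * (y.1 - b.1) + cos eta * (y.2 - b.2)) @[y --> x] -->
    - sin eta * (x.1 - b.1) + cos eta * (x.2 - b.2).
  by apply: cvgD; apply: cvgM => //; exact: cvg_cst.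
exact: (@cvg_pair _ _ _ (nbhs x) (nbhs _) (nbhs _) _ _ _ _ _ r1 r2).
Qed.

Let place_preserving : measure_preserving leb2 (place : plane -> plane).
Proof.
exact: (measure_preserving_comp (measure_preserving_rot eta)
  (measure_preserving_shift2 (- b))).
Qed.

(* What [cos_transform g] and [sin_transform g] have in common. *)
Let component (u : R * R -> R) := [/\ continuous u, integrable2 u &
  exists2 K, 0 <= K & forall x, `|u x| <= K / (1 + x.1 ^+ 2 + x.2 ^+ 2)].

Let component_cos : component (cos_transform g).
Proof.
have [C1 [C2 H]] := g_C2; split.
- exact: continuous_cos_transform g_integrable g_supported.
- exact: (integrable_cos_transform_sqrt M0 H g_continuous).
- have [K K0 HK] := transform_decay M0 H g_continuous.
  by exists K => // x; have [] := HK x.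
Qed.

Let component_sin : component (sin_transform g).
Proof.
have [C1 [C2 H]] := g_C2; split.
- exact: continuous_sin_transform g_integrable g_supported.
- exact: (integrable_sin_transform_sqrt M0 H g_continuous).
- have [K K0 HK] := transform_decay M0 H g_continuous.
  by exists K => // x; have [] := HK x.
Qed.

Let placed u x : R := (2 * pi)^-1 * u (place x).

Let placed_continuous u : component u -> continuous (placed u).
Proof.
move=> [cu _ _] x; apply: cvgM; first exact: cvg_cst.
by apply: (@continuous_comp _ _ _ place u); [exact: place_continuous|exact: cu].
Qed.

Let placed_integrable u : component u -> integrable2 (placed u).
Proof.
move=> [_ ui _]; apply: RintegrableZl.
exact: (integrable_measure_preserving place_preserving ui).
Qed.

Let placed_decay u : component u -> exists2 K, 0 <= K &
  forall x, `|placed u x| <= K / (1 + (x - b).1 ^+ 2 + (x - b).2 ^+ 2).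
Proof.
move=> [_ _ [K K0 HK]]; have c0 : 0 <= (2 * pi)^-1 :> R.
  by rewrite invr_ge0 mulr_ge0// pi_ge0.
exists ((2 * pi)^-1 * K); first exact: mulr_ge0.
move=> x; rewrite /placed normrM ger0_norm// -mulrA ler_wpM2l//.
by apply: (le_trans (HK _)); rewrite -!addrA sqr_rot.
Qed.

Lemma curvelet_scale_continuous : continuous (Re \o psi) /\ continuous (Im \o psi).
Proof.
by rewrite Re_psiE Im_psiE; split; apply: placed_continuous;
  [exact: component_cos|exact: component_sin].
Qed.

(** The line spanned by [direction theta] lies in the wedge, so that the Fourier
    transform of [psi] vanishes on it, and [Rintegral_line_eq0] applies to the
    real and imaginary parts of [psi]. *)
Lemma invisible_radon_eq0 (Phi theta s : R) :
  invisible W V W0 Phi (Posz j, l, k) -> `|theta| <= Phi ->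
  cintegrable leb1 setT (fun t => psi (line theta s t)) /\
  cintegral leb1 setT (fun t => psi (line theta s t)) = 0.
Proof.
move=> inv thetaP.
have ReI : integrable2 (Re \o psi).
  by rewrite Re_psiE; exact: placed_integrable component_cos.
have ImI : integrable2 (Im \o psi).
  by rewrite Im_psiE; exact: placed_integrable component_sin.
have F0 (sigma : R) : fourier psi (sigma * cos theta, sigma * sin theta) = 0.
  by apply: (invisible_fourier_eq0 inv); exists sigma, theta.
have dotE (sigma : R) x : dot x (sigma * cos theta, sigma * sin theta) =
    sigma * dot x (direction theta) by rewrite /dot/=; ring.
pose A (u : R * R -> R) (q : R -> R) (sigma : R) :=
  Rintegral leb2 setT (fun x : plane => u x * q (sigma * dot x (direction theta))).
have mom (sigma : R) : A (Re \o psi) cos sigma + A (Im \o psi) sin sigma = 0 /\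
    A (Im \o psi) cos sigma - A (Re \o psi) sin sigma = 0.
  have [E1 E2] := fourier_eq0 ReI ImI (F0 sigma).
  have AE (u : R * R -> R) q : A u q sigma = Rintegral leb2 setT
      (fun x : plane => u x * q (dot x (sigma * cos theta, sigma * sin theta))).
    by apply: eq_Rintegral => x _; rewrite dotE.
  by split; [rewrite -[RHS]E1 !AE|rewrite -[RHS]E2 !AE].
(* The transforms of the two parts are separated by comparing [sigma] with its
   opposite. *)
have cosA u (sigma : R) : A u cos (- sigma) = A u cos sigma.
  by apply: eq_Rintegral => x _; rewrite mulNr cosN.
have sinA u (sigma : R) : integrable2 u -> A u sin (- sigma) = - A u sin sigma.
  move=> ui; rewrite -[RHS]mulN1r -RintegralZl//.
    by apply: eq_Rintegral => x _; rewrite mulNr sinN; ring.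
  move: (integrable_sin_dot (sigma * cos theta, sigma * sin theta) ui).
  apply: eq_integrable => // x _ /=; congr (_ * sin _)%:E.
  by rewrite -dotE /dot/=; ring.
have all0 (sigma : R) : [/\ A (Re \o psi) cos sigma = 0, A (Re \o psi) sin sigma = 0,
    A (Im \o psi) cos sigma = 0 & A (Im \o psi) sin sigma = 0].
  have := mom sigma; have := mom (- sigma); rewrite !cosA !sinA//.
  by move=> [? ?] [? ?]; split; lra.
have part (h : R * R -> R) u : h = placed u -> component u ->
    (forall sigma, A h cos sigma = 0) -> (forall sigma, A h sin sigma = 0) ->
    integrable1 (fun t => h (line theta s t)) /\
    Rintegral leb1 setT (fun t => h (line theta s t)) = 0.
  move=> -> cu Hc Hs; have [K K0 HK] := placed_decay cu; split.
    exact: (integrable_line (placed_continuous cu) K0 HK).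
  exact: (Rintegral_line_eq0 (placed_continuous cu) (placed_integrable cu) K0 HK Hc Hs).
have [R1 R2] := part _ _ Re_psiE component_cos
  (fun sigma => let: And4 h _ _ _ := all0 sigma in h)
  (fun sigma => let: And4 _ h _ _ := all0 sigma in h).
have [I1 I2] := part _ _ Im_psiE component_sin
  (fun sigma => let: And4 _ _ h _ := all0 sigma in h)
  (fun sigma => let: And4 _ _ _ h := all0 sigma in h).
split; first by split.
by rewrite /cintegral; congr (_ +i* _)%C; [exact: R2|exact: I2].
Qed.

End Scale.

Lemma curvelet_continuous i : continuous (Re \o curvelet W V W0 i) /\
  continuous (Im \o curvelet W V W0 i).
Proof.
case: i => -[[j|j] l] k; first exact: curvelet_scale_continuous.
have [C1 [C2 H]] := lowpass_C2.
have sq := lowpass_root_sqr hW hW0.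
have gs := sqrt_supported H sq.
pose placed (u : R * R -> R) x := (2 * pi)^-1 * u (x - (k.1%:~R, k.2%:~R)).
have placed_continuous u : continuous u -> continuous (placed u).
  by move=> /continuous_shift_plane cu x; apply: cvgM; [exact: cvg_cst|exact: cu].
have E x : curvelet W V W0 (Negz j, l, k) x =
    (placed (cos_transform lowpass_symbol) x +i*
     placed (sin_transform lowpass_symbol) x)%C.
  by rewrite /= -inv_fourier_real.
split.
  have -> : Re \o curvelet W V W0 (Negz j, l, k) = placed (cos_transform lowpass_symbol).
    by apply/funext => x; rewrite -[LHS]/(Re (curvelet W V W0 (Negz j, l, k) x)) E.
  apply: placed_continuous; exact: continuous_cos_transform lowpass_integrable gs.
have -> : Im \o curvelet W V W0 (Negz j, l, k) = placed (sin_transform lowpass_symbol).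
  by apply/funext => x; rewrite -[LHS]/(Im (curvelet W V W0 (Negz j, l, k) x)) E.
apply: placed_continuous; exact: continuous_sin_transform lowpass_integrable gs.
Qed.

End Family.
End Slices.

(** * Minimizers *)

Section NonIntegrable.
Context d (T : measurableType d) (R : realType) (mu : {measure set T -> \bar R}).
Local Notation integrable f := (mu.-integrable setT (EFin \o f)).

(** The extended integral is infinite or of the form [+oo - +oo], and infinite
    values are sent to 0. *)
Lemma Rintegral_not_integrable (f : T -> R) : measurable_fun setT f ->
  ~ integrable f -> Rintegral mu setT f = 0.
Proof.
move=> mf nfi; rewrite /Rintegral integralE.
have mEf : measurable_fun setT (EFin \o f) by exact/measurable_EFinP.
have p0 : (0 <= \int[mu]_x (EFin \o f)^\+ x)%E by exact: integral_ge0.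
have n0 : (0 <= \int[mu]_x (EFin \o f)^\- x)%E by exact: integral_ge0.
have : ~ ((\int[mu]_x (EFin \o f)^\+ x < +oo)%E /\
          (\int[mu]_x (EFin \o f)^\- x < +oo)%E).
  move=> [plt nlt]; apply: nfi; apply/integrableP; split=> //.
  rewrite (eq_integral (fun x => (EFin \o f)^\+ x + (EFin \o f)^\- x)%E).
    rewrite ge0_integralD//; [exact: lte_add_pinfty| |].
      exact: measurable_funepos.
    exact: measurable_funeneg.
  by move=> x _; rewrite -[LHS]/((abse \o (EFin \o f)) x) fune_abse.
move: p0 n0; case: (\int[mu]_x _)%E => [p| |]//; case: (\int[mu]_x _)%E => [q| |]//=.
by move=> _ _ []; split; exact: ltry.
Qed.

Lemma Rintegral_add_null (f g : T -> R) : measurable_fun setT f ->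
  integrable g -> Rintegral mu setT g = 0 ->
  Rintegral mu setT (fun x => f x + g x) = Rintegral mu setT f.
Proof.
move=> mf gi g0; have mg := integrable_measurable gi.
have [fi|nfi] := pselect (integrable f); first by rewrite RintegralD// g0 addr0.
rewrite !Rintegral_not_integrable//; first exact: measurable_funD.
move=> fgi; apply: nfi.
have := integrableB measurableT fgi gi.
by apply: eq_integrable => // x _ /=; rewrite -EFinB addrK.
Qed.

End NonIntegrable.

Section Synthesis.
Variables (R : realType) (N : nat) (psi : 'I_N -> R * R -> R[i]).
Local Notation Re := (@complex.Re R).
Local Notation Im := (@complex.Im R).
Local Notation leb1 := (leb1 R).
Hypothesis psi_continuous : forall n,
  continuous (Re \o psi n) /\ continuous (Im \o psi n).

Lemma Re_synthesis c x : Re (synthesis psi c x) = \sum_(m < N) c 0 m * Re (psi m x).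
Proof.
rewrite /synthesis (big_morph Re (id1 := 0) (op1 := +%R))//; last by move=> [? ?] [? ?].
by apply: eq_bigr => m _; case: (psi m x) => a b /=; rewrite mul0r subr0.
Qed.

Lemma Im_synthesis c x : Im (synthesis psi c x) = \sum_(m < N) c 0 m * Im (psi m x).
Proof.
rewrite /synthesis (big_morph Im (id1 := 0) (op1 := +%R))//; last by move=> [? ?] [? ?].
by apply: eq_bigr => m _; case: (psi m x) => a b /=; rewrite mul0r addr0.
Qed.

Lemma synthesis0 : synthesis psi 0 = (fun=> 0).
Proof. by apply/funext => x; rewrite /synthesis big1// => m _; rewrite mxE mul0r. Qed.

Definition drop_entry (n : 'I_N) (c : 'rV[R]_N) : 'rV[R]_N :=
  \row_m (if m == n then 0 else c 0 m).

Lemma sum_drop_entry n (c : 'rV[R]_N) (a : 'I_N -> R) :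
  \sum_(m < N) c 0 m * a m = \sum_(m < N) drop_entry n c 0 m * a m + c 0 n * a n.
Proof.
rewrite (bigD1 n)//= [X in _ = X + _](bigD1 n)//= mxE eqxx mul0r add0r addrC.
by congr (_ + _); apply: eq_bigr => m /negPf mn; rewrite mxE mn.
Qed.

Let sum_measurable (u : 'I_N -> R * R -> R) (c : 'rV[R]_N) theta s :
  (forall m, continuous (u m)) ->
  measurable_fun [set: measurableTypeR R]
    (fun t => \sum_(m < N) c 0 m * u m (line theta s t)).
Proof.
move=> cu; apply: measurable_sum => m; apply: measurable_funM => //.
apply: continuous_measurable_fun => t.
apply: (@continuous_comp _ _ _ (line theta s) (u m)); last exact: cu.
exact: continuous_line.
Qed.

(** The component of [psi n] contributes nothing to the integral, even along
    lines on which the remaining sum is not integrable. *)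
Lemma radon_drop_entry n c (p : R * R) :
  cintegrable leb1 setT (fun t => psi n (line p.1 p.2 t)) ->
  cintegral leb1 setT (fun t => psi n (line p.1 p.2 t)) = 0 ->
  radon (synthesis psi (drop_entry n c)) p = radon (synthesis psi c) p.
Proof.
move=> [ri ii] /eqP; rewrite eq_complex/= => /andP[/eqP r0 /eqP i0].
have part (u : 'I_N -> R * R -> R) : (forall m, continuous (u m)) ->
    leb1.-integrable setT (EFin \o (fun t => u n (line p.1 p.2 t))) ->
    Rintegral leb1 setT (fun t => u n (line p.1 p.2 t)) = 0 ->
    Rintegral leb1 setT (fun t => \sum_(m < N) c 0 m * u m (line p.1 p.2 t)) =
    Rintegral leb1 setT (fun t => \sum_(m < N) drop_entry n c 0 m * u m (line p.1 p.2 t)).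
  move=> cu ui u0.
  rewrite -(@Rintegral_add_null _ _ _ leb1
    (fun t => \sum_(m < N) drop_entry n c 0 m * u m (line p.1 p.2 t))
    (fun t => c 0 n * u n (line p.1 p.2 t))).
  - by apply: eq_Rintegral => t _; exact: sum_drop_entry.
  - exact: sum_measurable.
  - exact: (RintegrableZl _ ui).
  - by rewrite RintegralZl// u0 mulr0.
have fRe c' : Re \o (fun t => synthesis psi c' (line p.1 p.2 t)) =
    (fun t => \sum_(m < N) c' 0 m * (Re \o psi m) (line p.1 p.2 t)).
  by apply/funext => t; exact: Re_synthesis.
have fIm c' : Im \o (fun t => synthesis psi c' (line p.1 p.2 t)) =
    (fun t => \sum_(m < N) c' 0 m * (Im \o psi m) (line p.1 p.2 t)).
  by apply/funext => t; exact: Im_synthesis.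
rewrite /radon /cintegral !fRe !fIm.
have Er := part (fun m => Re \o psi m) (fun m => (psi_continuous m).1) ri r0.
have Ei := part (fun m => Im \o psi m) (fun m => (psi_continuous m).2) ii i0.
by congr (_ +i* _)%C; [exact: esym Er|exact: esym Ei].
Qed.

End Synthesis.

Lemma weighted_l1_drop_entry (R : realType) (N : nat) (w : 'I_N -> R) n (c : 'rV[R]_N) :
  weighted_l1 w c = weighted_l1 w (drop_entry n c) + w n * `|c 0 n|.
Proof.
rewrite /weighted_l1 (bigD1 n)//= [X in _ = X + _](bigD1 n)//=.
rewrite mxE eqxx normr0 mulr0 add0r addrC.
by congr (_ + _); apply: eq_bigr => m /negPf mn; rewrite mxE mn.
Qed.

Lemma objective_finite (R : realType) (N : nat) (psi : 'I_N -> R * R -> R[i])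
    (w : 'I_N -> R) (Phi : R) (y : R * R -> R[i]) :
  (data_sqnorm Phi y < +oo)%E -> (objective psi w Phi y 0 < +oo)%E.
Proof.
move=> ylt; rewrite /objective.
have -> : data_sqnorm Phi (fun p => radon (synthesis psi 0) p - y p) = data_sqnorm Phi y.
  apply: eq_integral => p _.
  have -> : radon (synthesis psi 0) p = 0.
    rewrite synthesis0 /radon /cintegral.
    have z0 : Rintegral (leb1 R) setT (fun=> 0 : R) = 0 by rewrite Rintegral_cst// mul0r.
    by congr (_ +i* _)%C; exact: z0.
  by rewrite add0r; case: (y p) => a b /=; rewrite !sqrrN.
rewrite lte_add_pinfty//; last exact: ltry.
by rewrite lte_mul_pinfty// lee_fin invr_ge0.
Qed.

Theorem theorem4p2 (R : realType)
    (W V W0 : R -> R)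
    (hW : radial_window W) (hV : angular_window V) (hW0 : lowpass_window W W0)
    (N : nat) (idx : 'I_N -> curvelet_triple)
    (idx_inj : injective idx) (idxP : forall n, curvelet_index (idx n))
    (w0 : R) (w : 'I_N -> R) (w0_gt0 : 0 < w0) (w_ge : forall n, w0 <= w n)
    (Phi : R) (Phi_gt0 : 0 < Phi) (Phi_lt : Phi < pi / 2)
    (y : R * R -> R[i])
    (y_L2 : data_L2 Phi y) (y_ran : in_radon_range Phi y)
    (chat : 'rV[R]_N)
    (chat_min :
       minimizer (objective (fun n => curvelet W V W0 (idx n)) w Phi y) chat) :
  forall n : 'I_N, invisible W V W0 Phi (idx n) -> chat 0 n = 0.
Proof.
move=> n inv; apply/eqP/negPn/negP => cn.
pose psi m := curvelet W V W0 (idx m).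
have psi_continuous m := curvelet_continuous hW hV hW0 (idx m).
have sq0 c : (0 <= data_sqnorm Phi (fun p => radon (synthesis psi c) p - y p)%R)%E.
  by apply: integral_ge0 => p _; rewrite lee_fin addr_ge0// sqr_ge0.
have same : data_sqnorm Phi (fun p => radon (synthesis psi chat) p - y p) =
    data_sqnorm Phi (fun p => radon (synthesis psi (drop_entry n chat)) p - y p).
  apply: eq_integral => p; rewrite inE => -[/= p1 _].
  suff [ci c0] : cintegrable (leb1 R) setT (fun t => psi n (line p.1 p.2 t)) /\
      cintegral (leb1 R) setT (fun t => psi n (line p.1 p.2 t)) = 0.
    by rewrite (radon_drop_entry psi_continuous _ ci c0).
  rewrite /psi; case: (idxP n) inv => [[k _ <-]|[j [l [k [-> _]]]]] inv.
    by have := lowpass_visible hW hW0 Phi_gt0 inv.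
  apply: (invisible_radon_eq0 hW hV p.2 inv).
  by move: p1; rewrite in_itv/= ler_norml.
have wn : 0 < w n * `|chat 0 n|.
  by apply: mulr_gt0 (lt_le_trans w0_gt0 (w_ge n)) _; rewrite normr_gt0.
have := le_lt_trans (chat_min 0) (objective_finite psi w y_L2.2).
have := chat_min (drop_entry n chat).
rewrite /objective -/psi same (weighted_l1_drop_entry w n chat).
move: (sq0 (drop_entry n chat)) wn.
clear -w0; move: (data_sqnorm _ _) (weighted_l1 _ _) (w n * _) => [q| |] u v // _ v0.
  by rewrite -EFinM -!EFinD lee_fin => ? _; lra.
by rewrite gt0_muley ?lte_fin ?invr_gt0.
Qed.
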